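(* Let $(M,\alpha_1,\alpha_2,\phi,g)$ be a metric contact pair of type $(h,0)$ with Reeb vector fields $Z_1$ and $Z_2$. If $Z_2$ is a Killing vector field of $(M,g)$, then the metric contact pair $M$ is locally the product of a contact metric manifold with $\mathbb{R}$.
   Context: All objects are smooth. A contact pair of type $(h,k)$ on a manifold $M$ of dimension $2h+2k+2$ is a pair of $1$-forms $(\alpha_1,\alpha_2)$ such that $\alpha_1\wedge(d\alpha_1)^h\wedge\alpha_2\wedge(d\alpha_2)^k$ is a volume form, $(d\alpha_1)^{h+1}=0$ and $(d\alpha_2)^{k+1}=0$; so type $(h,0)$ means $\dim M=2h+2$, $\alpha_1\wedge(d\alpha_1)^h\wedge\alpha_2$ is a volume form, $(d\alpha_1)^{h+1}=0$ and $d\alpha_2=0$. Convention: $2\,d\alpha(X,Y)=X\alpha(Y)-Y\alpha(X)-\alpha([X,Y])$ for $1$-forms. The Reeb vector fields $Z_1,Z_2$ are the unique vector fields with $\alpha_i(Z_j)=\delta_{ij}$ and $i_{Z_i}d\alpha_j=0$ for all $i,j\in\{1,2\}$. A contact pair structure $(\alpha_1,\alpha_2,\phi)$ is a contact pair together with a $(1,1)$-tensor field $\phi$ with $\phi^2=-\mathrm{Id}+\alpha_1\otimes Z_1+\alpha_2\otimes Z_2$ and $\phi Z_1=\phi Z_2=0$. A metric contact pair $(M,\alpha_1,\alpha_2,\phi,g)$ is a contact pair structure with a Riemannian metric $g$ that is associated: $g(X,\phi Y)=(d\alpha_1+d\alpha_2)(X,Y)$ and $g(X,Z_i)=\alpha_i(X)$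 for $i=1,2$ and all $X,Y$. A contact metric manifold $(F,\omega,\zeta,\varphi,g_F)$ is a manifold of dimension $2h+1$ with a contact form $\omega$, its Reeb vector field $\zeta$, a $(1,1)$-tensor $\varphi$ with $\varphi^2=-\mathrm{Id}+\omega\otimes\zeta$, $\varphi\zeta=0$, and a Riemannian metric $g_F$ with $g_F(X,\zeta)=\omega(X)$ and $g_F(X,\varphi Y)=d\omega(X,Y)$. Its product with $\mathbb{R}$ (coordinate $t$) is the metric contact pair $(F\times\mathbb{R},\ \omega,\ dt,\ \varphi\oplus 0,\ g_F+dt^2)$. ''Locally the product'' means that every point of $M$ has a neighborhood isomorphic, as a metric contact pair (with $\alpha_1$ corresponding to $\omega$ and $\alpha_2$ to $dt$), to an open subset of such a product. *)

(* Defs.v *)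
From HB Require Import structures.
From mathcomp Require Import all_boot all_order all_algebra all_fingroup.
From mathcomp Require Import all_classical all_reals all_analysis.

Set Implicit Arguments.
Unset Strict Implicit.
Unset Printing Implicit Defensive.

Import Order.TTheory GRing.Theory Num.Theory.
Import numFieldNormedType.Exports.

Local Open Scope classical_set_scope.
Local Open Scope ring_scope.

Section Smooth.
Context {R : realType}.

(* [V] is always finite dimensional below, where class C^k amounts to the
   existence and continuity of all iterated directional derivatives. *)
Fixpoint classC {V W : normedModType R} (k : nat) (U : set V) (f : V -> W)
    : Prop :=
  (forall x, U x -> {for x, continuous f}) /\
  (if k is k'.+1 then
     forall v, (forall x, U x -> derivable f x v) /\ classC k' U ('D_v f)
   else True).

Definition smooth_on {V W : normedModType R} (U : set V) (f : V -> W) : Prop :=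
  forall k, classC k U f.

End Smooth.

Section Manifold.
Context (R : realType).

(* [cinv] is the inverse of [cmap], extended arbitrarily outside the image of
   the domain. *)
Record chart (n : nat) (T : topologicalType) := Chart {
  cdom : set T;
  cmap : T -> 'rV[R]_n;
  cinv : 'rV[R]_n -> T;
  cdom_open : open cdom;
  cimg_open : open (cmap @` cdom);
  cmapK : forall p, cdom p -> cinv (cmap p) = p;
  cmap_cont : forall p, cdom p -> {for p, continuous cmap};
  cinv_cont : forall x, (cmap @` cdom) x -> {for x, continuous cinv} }.

(* [chart_at p] is a chart around [p], chosen once and for all; it identifies
   the tangent space at [p] with the row vectors of size [n].  No regularity
   in [p] is asked of this choice. *)
Record manifold (n : nat) := Manifold {
  msort :> topologicalType;
  mhausdorff : hausdorff_space msort;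
  mcountable : @second_countable msort;
  atlas : set (chart n msort);
  atlas_compat : forall c c', atlas c -> atlas c' ->
    smooth_on (cmap c @` (cdom c `&` cdom c')) (cmap c' \o cinv c);
  chart_at : msort -> chart n msort;
  chart_at_atlas : forall p, atlas (chart_at p);
  chart_at_dom : forall p, cdom (chart_at p) p }.

End Manifold.

Section Tensors.
Context {R : realType} {n : nat} (M : manifold R n).

(* The value of a tensor field at [p] is expressed in the frame of
   [chart_at p]; tangent vectors are rows [v].  A 1-form [a] evaluates to
   [v *m a], an endomorphism field [f] maps [v] to [v *m f], and a bilinear
   field [b] takes the value [v *m b *m w^T] on [v], [w]. *)
Definition vector_field := M -> 'rV[R]_n.
Definition one_form := M -> 'cV[R]_n.
Definition endo_field := M -> 'M[R]_n.
Definition bilin_field := M -> 'M[R]_n.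

(* A vector with coordinates [v] in the chart [c] has coordinates
   [v *m trans c c' p] in the chart [c']. *)
Definition trans (c c' : chart R n M) (p : M) : 'M[R]_n :=
  jacobian (cmap c' \o cinv c) (cmap c p).

(* Components of tensor fields in the chart [c], as functions on the open set
   [cmap c @` cdom c]. *)
Definition vf_loc (c : chart R n M) (X : vector_field) (x : 'rV[R]_n)
    : 'rV[R]_n :=
  let p := cinv c x in X p *m trans (chart_at p) c p.
Definition form_loc (c : chart R n M) (a : one_form) (x : 'rV[R]_n)
    : 'cV[R]_n :=
  let p := cinv c x in trans c (chart_at p) p *m a p.
Definition endo_loc (c : chart R n M) (f : endo_field) (x : 'rV[R]_n)
    : 'M[R]_n :=
  let p := cinv c x in
  trans c (chart_at p) p *m f p *m trans (chart_at p) c p.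
Definition bilin_loc (c : chart R n M) (b : bilin_field) (x : 'rV[R]_n)
    : 'M[R]_n :=
  let p := cinv c x in
  trans c (chart_at p) p *m b p *m (trans c (chart_at p) p)^T.

Definition smooth_vf (X : vector_field) : Prop :=
  forall c, atlas c -> smooth_on (cmap c @` cdom c) (vf_loc c X).
Definition smooth_form (a : one_form) : Prop :=
  forall c, atlas c -> smooth_on (cmap c @` cdom c) (form_loc c a).
Definition smooth_endo (f : endo_field) : Prop :=
  forall c, atlas c -> smooth_on (cmap c @` cdom c) (endo_loc c f).
Definition smooth_bilin (b : bilin_field) : Prop :=
  forall c, atlas c -> smooth_on (cmap c @` cdom c) (bilin_loc c b).

Definition ev (a : 'cV[R]_n) (v : 'rV[R]_n) : R := (v *m a) 0 0.
Definition bil (b : 'M[R]_n) (v w : 'rV[R]_n) : R := (v *m b *m w^T) 0 0.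

(* The convention 2 da(X, Y) = X a(Y) - Y a(X) - a([X, Y]), on coordinate
   fields (whose brackets vanish). *)
Definition ext_d (a : one_form) : bilin_field := fun p =>
  let c := chart_at p in
  let pd (i j : 'I_n) :=
    'D_(delta_mx 0 i) (fun x => form_loc c a x j 0 : R) (cmap c p) in
  \matrix_(i, j) (2^-1 * (pd i j - pd j i)).

(* (L_X b)_ij = X^k d_k b_ij + (d_i X^k) b_kj + b_ik (d_j X^k) *)
Definition lie_bilin (X : vector_field) (b : bilin_field) : bilin_field :=
  fun p =>
  let c := chart_at p in
  let x := cmap c p in
  let J := jacobian (vf_loc c X) x in
  'D_(X p) (bilin_loc c b) x + J *m b p + b p *m J^T.

Definition riemannian (g : bilin_field) : Prop :=
  [/\ smooth_bilin g,
      forall p v w, bil (g p) v w = bil (g p) w v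
    & forall p v, v != 0 -> 0 < bil (g p) v v].

Definition killing (g : bilin_field) (X : vector_field) : Prop :=
  forall p, lie_bilin X g p = 0.

End Tensors.

Section Exterior.
Context {R : realType} {n : nat}.

(* Multilinear forms of degree [k] on R^n, the [k] arguments being the rows of
   a matrix. *)
Definition kform (k : nat) := 'M[R]_(k, n) -> R.

(* Normalized by 1/(k+l)!, in accordance with the factor 2 in the convention
   for the exterior derivative. *)
Definition wedge {k l : nat} (a : kform k) (b : kform l) : kform (k + l) :=
  fun v => ((k + l)`!%:R)^-1 *
    \sum_(s : 'S_(k + l))
      (-1) ^+ s * (a (usubmx (row_perm s v)) * b (dsubmx (row_perm s v))).

(* The degree [k.+1 * 2] is convertible to [2 + k * 2]. *)
Fixpoint wedge_pow (b : kform 2) (k : nat) : kform (k * 2) :=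
  if k is k'.+1 then wedge b (@wedge_pow b k') else fun=> 1.


Definition kform1 (a : 'cV[R]_n) : kform 1 := ev a.
Definition kform2 (b : 'M[R]_n) : kform 2 :=
  fun v => bil b (row 0 v) (row 1 v).

End Exterior.

Arguments wedge_pow {R n} b k v.

Section ContactPairs.
Context {R : realType} {n : nat} (M : manifold R n).
Implicit Types (a om : one_form M) (Z : vector_field M)
  (phi : endo_field M) (g : bilin_field M).

(* The wedge product in [cp_volume] has top degree by [cp_dim], hence is a
   volume form if and only if it vanishes nowhere. *)
Record contact_pair (h k : nat) a1 a2 : Prop := ContactPair {
  cp_smooth1 : smooth_form a1;
  cp_smooth2 : smooth_form a2;
  cp_dim : n = (h.*2 + k.*2).+2;
  cp_volume : forall p, exists v,
    wedge (wedge (kform1 (a1 p)) (wedge_pow (kform2 (ext_d a1 p)) h))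
          (wedge (kform1 (a2 p)) (wedge_pow (kform2 (ext_d a2 p)) k)) v != 0;
  cp_class1 : forall p v, wedge_pow (kform2 (ext_d a1 p)) h.+1 v = 0;
  cp_class2 : forall p v, wedge_pow (kform2 (ext_d a2 p)) k.+1 v = 0 }.

Record reeb_pair a1 a2 Z1 Z2 : Prop := ReebPair {
  reeb_smooth1 : smooth_vf Z1;
  reeb_smooth2 : smooth_vf Z2;
  reeb11 : forall p, ev (a1 p) (Z1 p) = 1;
  reeb12 : forall p, ev (a1 p) (Z2 p) = 0;
  reeb21 : forall p, ev (a2 p) (Z1 p) = 0;
  reeb22 : forall p, ev (a2 p) (Z2 p) = 1;
  reeb_d11 : forall p v, bil (ext_d a1 p) (Z1 p) v = 0;
  reeb_d12 : forall p v, bil (ext_d a1 p) (Z2 p) v = 0;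
  reeb_d21 : forall p v, bil (ext_d a2 p) (Z1 p) v = 0;
  reeb_d22 : forall p v, bil (ext_d a2 p) (Z2 p) v = 0 }.

Record contact_pair_structure (h k : nat) a1 a2 phi Z1 Z2 : Prop :=
  ContactPairStructure {
  cps_pair : contact_pair h k a1 a2;
  cps_reeb : reeb_pair a1 a2 Z1 Z2;
  cps_smooth : smooth_endo phi;
  cps_sqr : forall p v, v *m phi p *m phi p =
    - v + ev (a1 p) v *: Z1 p + ev (a2 p) v *: Z2 p;
  cps_Z1 : forall p, Z1 p *m phi p = 0;
  cps_Z2 : forall p, Z2 p *m phi p = 0 }.

Record metric_contact_pair (h k : nat) a1 a2 phi g Z1 Z2 : Prop :=
  MetricContactPair {
  mcp_structure : contact_pair_structure h k a1 a2 phi Z1 Z2;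
  mcp_riemannian : riemannian g;
  mcp_assoc : forall p u v,
    bil (g p) u (v *m phi p) = bil (ext_d a1 p + ext_d a2 p) u v;
  mcp_Z1 : forall p v, bil (g p) v (Z1 p) = ev (a1 p) v;
  mcp_Z2 : forall p v, bil (g p) v (Z2 p) = ev (a2 p) v }.

Record contact_metric (h : nat) om phi g Z : Prop := ContactMetric {
  cm_smooth_form : smooth_form om;
  cm_smooth_vf : smooth_vf Z;
  cm_smooth_endo : smooth_endo phi;
  cm_riemannian : riemannian g;
  cm_dim : n = h.*2.+1;
  cm_contact : forall p, exists v,
    wedge (kform1 (om p)) (wedge_pow (kform2 (ext_d om p)) h) v != 0;
  cm_reeb : forall p, ev (om p) (Z p) = 1;
  cm_reeb_d : forall p v, bil (ext_d om p) (Z p) v = 0;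
  cm_sqr : forall p v, v *m phi p *m phi p = - v + ev (om p) v *: Z p;
  cm_Z : forall p, Z p *m phi p = 0;
  cm_metric_Z : forall p v, bil (g p) v (Z p) = ev (om p) v;
  cm_assoc : forall p u v, bil (g p) u (v *m phi p) = bil (ext_d om p) u v }.

End ContactPairs.

Section Maps.
Context {R : realType} {m n : nat} (M : manifold R m) (N : manifold R n).

Definition smooth_map_on (U : set M) (f : M -> N) : Prop :=
  (forall p, U p -> {for p, continuous f}) /\
  forall c c', atlas c -> atlas c' ->
    smooth_on (cmap c @` (U `&` cdom c `&` f @^-1` cdom c'))
              (cmap c' \o f \o cinv c).

(* The differential at [p], acting on rows: [v |-> v *m tangent_map f p]. *)
Definition tangent_map (f : M -> N) (p : M) : 'M[R]_(m, n) :=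
  jacobian (cmap (chart_at (f p)) \o f \o cinv (chart_at p))
           (cmap (chart_at p) p).

End Maps.

Record diffeo_on {R : realType} {m n : nat} (M : manifold R m)
    (N : manifold R n) (U : set M) (V : set N) (f : M -> N) : Prop := DiffeoOn {
  diffeo_openl : open U;
  diffeo_openr : open V;
  diffeo_img : f @` U = V;
  diffeo_smooth : smooth_map_on U f;
  diffeo_inv : exists f' : N -> M,
    (forall p, U p -> f' (f p) = p) /\ smooth_map_on V f' }.

Section ClassCTheory.
Context {R : realType}.
Implicit Types V W : normedModType R.

Lemma eq_classC V W k (U : set V) (f g : V -> W) :
  open U -> (forall x, U x -> f x = g x) -> classC k U f -> classC k U g.
Proof.
move=> oU; elim: k f g => [|k IH] f g fg [fc fd].
all: have nfg x : U x -> {near x, f =1 g}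
  by move=> Ux; apply: filterS (open_nbhs_nbhs (conj oU Ux)).
all: have gc x : U x -> {for x, continuous g}
  by move=> Ux; rewrite /prop_for /continuous_at -(fg x Ux);
    apply: cvg_trans (fc x Ux); apply: near_eq_cvg; exact: nfg.
  by split.
split=> // v; have [fdv fcv] := fd v; split.
  by move=> x Ux; apply: near_eq_derivable (fdv x Ux); exact: nfg.
apply: IH fcv => x Ux; exact: near_eq_derive (nfg x Ux).
Qed.

Lemma sub_classC V W k (U U' : set V) (f : V -> W) :
  U' `<=` U -> classC k U f -> classC k U' f.
Proof.
move=> sU; elim: k f => [|k IH] f [fc fd]; split; try by move=> x /sU /fc.
  by [].
by move=> v; have [fdv fcv] := fd v; split; [move=> x /sU /fdv | exact: IH].
Qed.

Lemma classC_cst V W k (U : set V) (a : W) : classC k U (cst a).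
Proof.
elim: k a => [|k IH] a; split; try by move=> x _; exact: cst_continuous.
  by [].
move=> v; split; first by move=> x _; exact: derivable_cst.
have -> : 'D_v (cst a : V -> W) = cst 0 by apply/funext => x; exact: derive_cst.
exact: IH.
Qed.

Lemma classC_add V W k (U : set V) (f g : V -> W) : open U ->
  classC k U f -> classC k U g -> classC k U (f \+ g).
Proof.
move=> oU; elim: k f g => [|k IH] f g [fc fd] [gc gd]; split=> //.
- by move=> x Ux; apply: continuousD; [exact: fc | exact: gc].
- by move=> x Ux; apply: continuousD; [exact: fc | exact: gc].
move=> v; have [fdv fcv] := fd v; have [gdv gcv] := gd v; split.
  by move=> x Ux; apply: derivableD; [exact: fdv | exact: gdv].
apply: (@eq_classC _ _ _ _ ('D_v f \+ 'D_v g)) => //; last exact: IH.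
by move=> x Ux /=; rewrite deriveD //; [exact: fdv | exact: gdv].
Qed.

Lemma classC_lin_comp V W W' k (U : set V) (L : {linear W -> W'})
    (f : V -> W) : open U -> continuous L ->
  classC k U f -> classC k U (L \o f).
Proof.
move=> oU Lc; elim: k f => [|k IH] f [fc fd].
  by split=> // x Ux; apply: continuous_comp; [exact: fc | exact: Lc].
have key x v : derivable f x v ->
    (fun h : R => h^-1 *: (((L \o f) \o shift x) (h *: v) - (L \o f) x)) @ 0^'
      --> L ('D_v f x).
  move=> fdx.
  have -> : (fun h : R =>
      h^-1 *: (((L \o f) \o shift x) (h *: v) - (L \o f) x)) =
      L \o (fun h : R => h^-1 *: ((f \o shift x) (h *: v) - f x)).
    by apply/funext => h /=; rewrite -(linearB L) (linearZZ L).
  by apply: cvg_comp; [exact: fdx | exact: Lc].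
split.
  by move=> x Ux; apply: continuous_comp; [exact: fc | exact: Lc].
move=> v; have [fdv fcv] := fd v; split.
  by move=> x /fdv /key fx; apply/cvg_ex; exists (L ('D_v f x)).
apply: (@eq_classC _ _ _ _ (L \o 'D_v f)) => //; last exact: IH.
by move=> x /fdv /key fx; apply/esym/cvg_lim.
Qed.

Lemma classC_comp_lin V W V' k (U : set V) (L : {linear V' -> V})
    (f : V -> W) : continuous L ->
  classC k U f -> classC k (L @^-1` U) (f \o L).
Proof.
move=> Lc; elim: k f => [|k IH] f [fc fd]; split=> //.
- by move=> x Ux; apply: continuous_comp; [exact: Lc | exact: fc].
- by move=> x Ux; apply: continuous_comp; [exact: Lc | exact: fc].
have key x v :
    (fun h : R => h^-1 *: (((f \o L) \o shift x) (h *: v) - (f \o L) x)) =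
    (fun h : R => h^-1 *: ((f \o shift (L x)) (h *: L v) - f (L x))).
  by apply/funext => h /=; rewrite (linearD L) (linearZZ L).
move=> v; have [fdv fcv] := fd (L v); split.
  by move=> x /fdv; rewrite /derivable key.
have -> : 'D_v (f \o L) = 'D_(L v) f \o L.
  by apply/funext => x; rewrite /derive key.
exact: IH.
Qed.

Lemma classC_lin V W k (U : set V) (L : {linear V -> W}) :
  continuous L -> classC k U L.
Proof.
move=> Lc; case: k => [|k]; split=> //; try by move=> x _; exact: Lc.
move=> v; split.
  by move=> x _; apply: diff_derivable; exact: linear_differentiable.
have -> : 'D_v L = cst (L v).
  apply/funext => x; rewrite deriveE; last exact: linear_differentiable.
  by rewrite diff_lin.
exact: classC_cst.
Qed.

End ClassCTheory.

Section ProductR.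
Context {R : realType} {n : nat}.

Definition row_injl (v : 'rV[R]_n) : 'rV[R]_(n + 1) := row_mx v 0.
Definition row_projr (v : 'rV[R]_(n + 1)) : 'rV[R]_(n + 1) :=
  row_mx 0 (rsubmx v).

Fact row_injl_linear : linear row_injl.
Proof.
by move=> a u v; rewrite /row_injl scale_row_mx add_row_mx scaler0 addr0.
Qed.
HB.instance Definition _ := GRing.isLinear.Build R 'rV[R]_n 'rV[R]_(n + 1) _
  row_injl row_injl_linear.

Fact row_projr_linear : linear row_projr.
Proof.
move=> a u v; rewrite /row_projr scale_row_mx add_row_mx scaler0 addr0.
by congr row_mx; rewrite linearD linearZ.
Qed.
HB.instance Definition _ := GRing.isLinear.Build R 'rV[R]_(n + 1)
  'rV[R]_(n + 1) _ row_projr row_projr_linear.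

Lemma row_mx_continuous (T : topologicalType) (f : T -> 'rV[R]_n)
    (g : T -> 'rV[R]_1) p :
  {for p, continuous f} -> {for p, continuous g} ->
  {for p, continuous (fun q => row_mx (f q) (g q))}.
Proof.
move=> fc gc A /nbhs_ballP[e /= e0 eA].
have /fc /= Bf : nbhs (f p) (ball (f p) e) by exact: nbhsx_ballx.
have /gc /= Bg : nbhs (g p) (ball (g p) e) by exact: nbhsx_ballx.
rewrite /nbhs /=; near=> q.
have [_ fq] : @mx_ball _ _ R _ (f p) e (f q) by near: q; exact: Bf.
have [_ gq] : @mx_ball _ _ R _ (g p) e (g q) by near: q; exact: Bg.
by apply: eA; split=> // i j; rewrite !mxE; case: (fintype.split j) => k.
Unshelve. all: by end_near. Qed.

Variable M : manifold R n.

Section ProdChart.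
Variable c : chart R n M.

Definition pc_dom : set (M * R)%type := [set p | cdom c p.1].
Definition pc_map (p : M * R) : 'rV[R]_(n + 1) :=
  row_mx (cmap c p.1) (p.2)%:M.
Definition pc_inv (x : 'rV[R]_(n + 1)) : M * R :=
  (cinv c (lsubmx x), rsubmx x 0 0).

Lemma pc_img : pc_map @` pc_dom = lsubmx @^-1` (cmap c @` cdom c).
Proof.
apply/seteqP; split=> [x [p cp <-]|x [p cp px]] /=.
  by exists p.1 => //; rewrite row_mxKl.
exists (p, rsubmx x 0 0) => //.
by rewrite /pc_map /= px -mx11_scalar hsubmxK.
Qed.

Lemma pc_dom_open : open pc_dom.
Proof.
by apply: (@open_comp _ _ fst) (cdom_open c) => p _; exact: cvg_fst.
Qed.

Lemma pc_img_open : open (pc_map @` pc_dom).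
Proof.
rewrite pc_img; apply: open_comp; last exact: cimg_open.
by move=> x _; exact: continuous_lsubmx.
Qed.

Lemma pc_mapK p : pc_dom p -> pc_inv (pc_map p) = p.
Proof.
case: p => p t cp; rewrite /pc_inv /pc_map /= row_mxKl row_mxKr.
by rewrite cmapK // mxE eqxx mulr1n.
Qed.

Lemma pc_map_cont p : pc_dom p -> {for p, continuous pc_map}.
Proof.
move=> cp; apply: row_mx_continuous.
  by apply: (@continuous_comp _ _ _ fst (cmap c));
    [exact: cvg_fst | exact: cmap_cont].
apply: (@continuous_comp _ _ _ snd (fun t : R => t%:M : 'rV_1)).
  exact: cvg_snd.
move=> A /nbhs_ballP[e /= e0 eA]; apply/nbhs_ballP; exists e => //= t pt.
by apply: eA; split=> // i j; rewrite !ord1 !mxE !eqxx !mulr1n.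
Qed.

Lemma pc_inv_cont x : (pc_map @` pc_dom) x -> {for x, continuous pc_inv}.
Proof.
rewrite pc_img => cx.
have fc : {for x, continuous (cinv c \o lsubmx)}.
  apply: continuous_comp; first exact: continuous_lsubmx.
  exact: cinv_cont.
have gc : {for x, continuous ((fun y : 'rV[R]_1 => y 0 0) \o rsubmx)}.
  by apply: continuous_comp;
    [exact: continuous_rsubmx | exact: coord_continuous].
exact: (cvg_pair fc gc).
Qed.

Definition prod_chart : chart R (n + 1) (M * R)%type :=
  Chart pc_dom_open pc_img_open pc_mapK pc_map_cont pc_inv_cont.

End ProdChart.

Lemma prodR_hausdorff : hausdorff_space (M * R)%type.
Proof.
move=> [p s] [q t] pq; congr pair.
  apply: (@mhausdorff _ _ M) => A B pA qB.
  have pA' : nbhs (p, s) (A `*` setT).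
    by exists (A, setT) => //; split=> //=; exact: filterT.
  have qB' : nbhs (q, t) (B `*` setT).
    by exists (B, setT) => //; split=> //=; exact: filterT.
  have [[u v] [/= Au Bu]] := pq _ _ pA' qB'.
  by exists u; split; [case: Au | case: Bu].
apply: (@norm_hausdorff _ R) => A B pA qB.
have pA' : nbhs (p, s) (setT `*` A).
  by exists (setT, A) => //; split=> //=; exact: filterT.
have qB' : nbhs (q, t) (setT `*` B).
  by exists (setT, B) => //; split=> //=; exact: filterT.
have [[u v] [/= Au Bu]] := pq _ _ pA' qB'.
by exists v; split; [case: Au | case: Bu].
Qed.

Lemma prodR_countable : @second_countable (M * R)%type.
Proof.
have [B Bc [Bo Bb]] := @mcountable _ _ M.
pose I (q : rat * rat) : set R := ball (ratr q.1 : R) (ratr q.2).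
exists ((fun z : set M * (rat * rat) => z.1 `*` I z.2) @` (B `*` setT)).
  by apply: card_le_trans (card_image_le _ _) _; apply: countableX.
split=> [_ [[A q] [/= /Bo Ao _] <-]|[p t] D [[A C] [/= pA tC] AC]].
  rewrite openE => -[p t] [/= Ap Iq]; exists (A, I q) => //; split=> /=.
    exact: open_nbhs_nbhs.
  by apply: open_nbhs_nbhs; split=> //; exact: ball_open.
have [A' [BA' A'p] A'A] := Bb p A pA.
have [|a [r [/set_mem tar arC]]] := @open_subball_rat R C^° t (open_interior _).
  exact/mem_set.
exists (A' `*` I (a, r)); first by split; [exists (A', (a, r)) |].
move=> [q s] [/= A'q Is]; apply: AC; split; first exact: A'A.
apply: interior_subset; apply: arC.
exact: Is.
Qed.

Lemma prod_chart_compat (c c' : chart R n M) : atlas c -> atlas c' ->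
  smooth_on (cmap (prod_chart c) @` (cdom (prod_chart c) `&`
                                     cdom (prod_chart c')))
            (cmap (prod_chart c') \o cinv (prod_chart c)).
Proof.
move=> ac ac' k; set f := cmap c' \o cinv c.
set U := cmap c @` (cdom c `&` cdom c').
have UE : U = cmap c @` cdom c `&` cinv c @^-1` cdom c'.
  apply/seteqP; split=> [_ [p [cp c'p] <-]|_ [[p cp <-]] /= c'p].
    by split; [exists p | rewrite /= cmapK].
  by exists p => //; split=> //; rewrite cmapK in c'p.
have oU : open U.
  rewrite openE UE => x [cx c'x]; apply: filterI.
    by apply: open_nbhs_nbhs; split=> //; exact: cimg_open.
  apply: (cinv_cont cx); apply: open_nbhs_nbhs; split=> //; exact: cdom_open.
have lc : continuous (lsubmx : 'rV[R]_(n + 1) -> 'rV[R]_n).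
  exact: continuous_lsubmx.
have jc : continuous row_injl.
  by move=> x; apply: (@row_mx_continuous _ id (fun=> 0));
    [exact: cvg_id | exact: cst_continuous].
have pc : continuous row_projr.
  move=> x; apply: (@row_mx_continuous _ (fun=> 0) rsubmx).
    exact: cst_continuous.
  exact: continuous_rsubmx.
have oV : open ((lsubmx : 'rV[R]_(n + 1) -> 'rV[R]_n) @^-1` U).
  by apply: open_comp oU => x _; exact: lc.
apply: (@sub_classC _ _ _ _ (lsubmx @^-1` U)).
  move=> _ [[p t] [/= cp c'p] <-]; exists p => //=.
  by rewrite row_mxKl.
have -> : cmap (prod_chart c') \o cinv (prod_chart c) =
    ((row_injl \o (f \o lsubmx)) \+ row_projr : _ -> 'rV[R]_(n + 1)).
  apply/funext => x /=; rewrite /row_injl /row_projr /pc_map /=.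
  by rewrite add_row_mx addr0 add0r -mx11_scalar.
apply: classC_add => //; last exact: classC_lin.
apply: classC_lin_comp => //.
by apply: classC_comp_lin => //; exact: atlas_compat.
Qed.

Definition prodR : manifold R (n + 1).
Proof.
refine (@Manifold R (n + 1) (M * R)%type prodR_hausdorff prodR_countable
  [set prod_chart c | c in @atlas _ _ M] _
  (fun p => prod_chart (chart_at p.1)) _ _).
- by move=> _ _ [c ac <-] [c' ac' <-]; exact: prod_chart_compat.
- by move=> p; exists (chart_at p.1) => //; exact: chart_at_atlas.
- by move=> p; exact: chart_at_dom.
Defined.

End ProductR.

Section ProductPair.
Context {R : realType} {n : nat} (F : manifold R n).

(* The last coordinate is [t]. *)
Definition prod_form (om : one_form F) : one_form (prodR F) :=
  fun p => col_mx (om p.1) 0.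
Definition dt_form : one_form (prodR F) := fun=> col_mx 0 1%:M.
Definition prod_endo (phi : endo_field F) : endo_field (prodR F) :=
  fun p => block_mx (phi p.1) 0 0 0.
Definition prod_metric (g : bilin_field F) : bilin_field (prodR F) :=
  fun p => block_mx (g p.1) 0 0 1%:M.

End ProductPair.

Arguments dt_form {R n} F p.

Record preserves_on {R : realType} {m n : nat} (M : manifold R m)
    (N : manifold R n) (U : set M) (f : M -> N)
    (a1 a2 : one_form M) (phi : endo_field M) (g : bilin_field M)
    (b1 b2 : one_form N) (psi : endo_field N) (k : bilin_field N) : Prop :=
  PreservesOn {
  pres_form1 : forall p, U p -> forall v,
    ev (b1 (f p)) (v *m tangent_map f p) = ev (a1 p) v;
  pres_form2 : forall p, U p -> forall v,
    ev (b2 (f p)) (v *m tangent_map f p) = ev (a2 p) v;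
  pres_endo : forall p, U p -> forall v : 'rV[R]_m,
    v *m tangent_map f p *m psi (f p) = v *m phi p *m tangent_map f p;
  pres_metric : forall p, U p -> forall v w,
    bil (k (f p)) (v *m tangent_map f p) (w *m tangent_map f p) =
    bil (g p) v w }.

Definition locally_product {R : realType} {n : nat} (M : manifold R n)
    (h : nat) (a1 a2 : one_form M) (phi : endo_field M) (g : bilin_field M)
    : Prop :=
  forall p : M,
  exists (m : nat) (F : manifold R m) (om : one_form F) (phiF : endo_field F)
    (gF : bilin_field F) (Z : vector_field F),
  contact_metric h om phiF gF Z /\
  exists (U : set M) (V : set (prodR F)) (f : M -> prodR F),
  [/\ U p, diffeo_on U V f
    & preserves_on U f a1 a2 phi g
        (prod_form om) (dt_form F) (prod_endo phiF) (prod_metric gF)].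

(* Main.v *)
From HB Require Import structures.
From mathcomp Require Import all_boot all_order all_algebra all_fingroup.
From mathcomp Require Import all_classical all_reals all_analysis.
From mathcomp Require Import ring lra.
Require Import Defs.

(** Since the contact pair has type (h, 0), the second form a2 is closed, and
    a2(Z2) = 1.  Locally a2 is therefore dt for a potential t, and flowing a
    slice t = 0 along Z2 produces coordinates (u, t) on R^m x R, where
    m = 2 h + 1, in which a2 = dt and Z2 is the coordinate field of t
    ([adapted_chart]).  In such coordinates the Lie derivative along Z2 is the
    partial derivative in t, and the three remaining tensors do not depend
    on t:
    - g, because Z2 is a Killing field;
    - a1, because a1(Z2) = 0 and Z2 is in the kernel of d a1, so that Cartan's
      formula gives zero for the Lie derivative of a1 along Z2;
    - phi, because g(X, phi Y) = d a1(X, Y) determines it from g and a1.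
    Moreover g(X, Z2) = a2(X) says that the coordinate t is orthogonal to the
    others and of unit length, and the equations a1(Z2) = 0 and phi Z2 = 0 kill
    the last components of a1 and phi.  Thus all the tensors are in block form,
    the last block being that of the line, and the first block at t = 0 lives
    on a ball F of R^m.  The equations of a contact metric structure on F are
    the first blocks of those of M ([slice_contact_metric]); the chart itself,
    read with values in F x R, is the isomorphism ([splitting_diffeo],
    [splitting_preserves]).

    Almost all of the work is the construction of adapted coordinates from
    elementary calculus.  The potential t is an integral along rays
    ([poincare]).  The flow of Z2 comes from Picard iteration ([picard]); its
    smoothness is obtained one order at a time, because the derivative of a
    flow is a component of the flow of another field, the tangent field on
    pairs (x, v) ([flow_tangent], [flow_smooth]).  The flow applied to the slice
    is a smooth map with invertible Jacobian, hence a parametrization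
    ([inverse_function], [straighten]).  The quantitative tools behind all three
    are a mean value inequality with a majorant ([mean_value_le]), strict
    differentiability of C^1 maps ([strict_differentiable]) and Gronwall's
    inequality ([gronwall]).

    Tensor fields on M are given by components in one preferred chart at each
    point, while the adapted chart is only compatible with the atlas; exterior
    and Lie derivatives are compared between charts by their naturality
    ([ext_d_coord_pullback], [lie_coord_pullback]), which rests on the symmetry
    of second derivatives ([derive_sym]). *)

Set Implicit Arguments.
Unset Strict Implicit.
Unset Printing Implicit Defensive.

Import Order.TTheory GRing.Theory Num.Theory.
Import numFieldNormedType.Exports.

Local Open Scope classical_set_scope.
Local Open Scope ring_scope.

(** * Matrix-valued functions of class C^k *)

Section MatrixFunctions.
Context {R : realType}.

Lemma mx_continuousP (T : topologicalType) m n (f : T -> 'M[R]_(m, n)) x :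
  {for x, continuous f} <->
  forall i j, {for x, continuous (fun y => f y i j)}.
Proof.
split=> [fc i j|fc A [P MP sPA]].
  by apply: (@continuous_comp _ _ _ f (fun M => M i j)) => //;
    exact: coord_continuous.
rewrite /nbhs /=.
have : \forall y \near x, forall i j, P i j (f y i j).
  by apply: filter_forall => i; apply: filter_forall => j; exact: fc (MP i j).
by apply: filterS => y Py; exact: sPA.
Qed.

Lemma derive_mxE (V : normedModType R) m n (f : V -> 'M[R]_(m, n)) x v i j :
  derivable f x v -> 'D_v f x i j = 'D_v (fun y => f y i j) x.
Proof. by move=> /derive_mx ->; rewrite mxE. Qed.

Lemma mx_norm_entry m n (A : 'M[R]_(m, n)) i j : `|A i j| <= `|A|.
Proof.
rewrite [leRHS]/Num.Def.normr/= mx_normrE.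
exact: (le_bigmax _ (fun ij => `|A ij.1 ij.2|) (i, j)).
Qed.

Lemma mx_norm_leP m n (A : 'M[R]_(m, n)) e : 0 <= e ->
  (forall i j, `|A i j| <= e) -> `|A| <= e.
Proof.
move=> e0 Ae; rewrite [leLHS]/Num.Def.normr/= mx_normrE.
by apply: bigmax_le => // -[i j] _; exact: Ae.
Qed.

Lemma mulmx_norm m n p (A : 'M[R]_(m, n)) (B : 'M[R]_(n, p)) :
  `|A *m B| <= n%:R * (`|A| * `|B|).
Proof.
apply: mx_norm_leP => [|i j]; first by rewrite !mulr_ge0.
rewrite mxE (le_trans (ler_norm_sum _ _ _))//.
rewrite -[X in _ <= X%:R * _](card_ord n) -sumr_const mulr_suml.
apply: ler_sum => k _; rewrite mul1r normrM.
by apply: ler_pM => //; exact: mx_norm_entry.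
Qed.

End MatrixFunctions.

Section ClassC.
Context {R : realType}.
Implicit Types V W : normedModType R.

Lemma classC_continuous V W k (U : set V) (f : V -> W) x :
  classC k U f -> U x -> {for x, continuous f}.
Proof. by case: k => [|k] [fc _]; exact: fc. Qed.

Lemma classC_derivable V W k (U : set V) (f : V -> W) x v :
  classC k.+1 U f -> U x -> derivable f x v.
Proof. by move=> [_ /(_ v)[fd _]]; exact: fd. Qed.

Arguments classC_derivable {V W k U f x v}.

Lemma classC_derive V W k (U : set V) (f : V -> W) v :
  classC k.+1 U f -> classC k U ('D_v f).
Proof. by move=> [_ /(_ v)[_]]. Qed.

Lemma classC_pred V W k (U : set V) (f : V -> W) :
  classC k.+1 U f -> classC k U f.
Proof.
elim: k f => [|k IH] f; first by move=> [fc _]; split.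
move=> [fc fd]; split=> // v; have [fdv fcv] := fd v; split=> //; exact: IH.
Qed.

Lemma classC_leq V W k l (U : set V) (f : V -> W) :
  (k <= l)%N -> classC l U f -> classC k U f.
Proof.
move=> kl; rewrite -(subnK kl); elim: (l - k)%N => // j IH.
by rewrite addSn => /classC_pred.
Qed.

Lemma classC_mxP V m n k (U : set V) (f : V -> 'M[R]_(m, n)) : open U ->
  classC k U f <-> forall i j, classC k U (fun x => f x i j).
Proof.
move=> oU; elim: k f => [|k IH] f.
  split=> [[fc _] i j|fc]; split=> // x Ux.
    by move/mx_continuousP: (fc x Ux); exact.
  by apply/mx_continuousP => i j; have [+ _] := fc i j; exact.
split=> [[fc fd] i j|fc].
  split=> [x Ux|v]; first by move/mx_continuousP: (fc x Ux); exact.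
  have [fdv fcv] := fd v; split.
    by move=> x Ux; move/derivable_mxP: (fdv x Ux); exact.
  apply: (@eq_classC _ _ _ _ _ (fun x => 'D_v f x i j)) => //.
    by move=> x Ux; rewrite derive_mxE //; exact: fdv.
  by move/IH: fcv; exact.
have fdv x v : U x -> derivable f x v.
  by move=> Ux; apply/derivable_mxP => i j; exact: classC_derivable (fc i j) Ux.
split=> [x Ux|v].
  by apply/mx_continuousP => i j; exact: classC_continuous (fc i j) Ux.
split=> [x|]; first exact: fdv.
apply/IH => i j; apply: eq_classC (classC_derive v (fc i j)) => // x Ux.
by rewrite derive_mxE //; exact: fdv.
Qed.

Lemma classC_mul V k (U : set V) (f g : V -> R) : open U ->
  classC k U f -> classC k U g -> classC k U (fun x => f x * g x).
Proof.
move=> oU; elim: k f g => [|k IH] f g fC gC.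
  split=> // x Ux; by apply: continuousM;
    [exact: classC_continuous fC Ux|exact: classC_continuous gC Ux].
split=> [x Ux|v]; first by apply: continuousM;
    [exact: classC_continuous fC Ux|exact: classC_continuous gC Ux].
have fd x : U x -> derivable f x v by exact: classC_derivable fC.
have gd x : U x -> derivable g x v by exact: classC_derivable gC.
split=> [x Ux|]; first by apply: derivableM; [exact: fd|exact: gd].
apply: (@eq_classC _ _ _ _ _
    ((fun x => f x * 'D_v g x) \+ (fun x => g x * 'D_v f x))) => //.
  by move=> x Ux; rewrite deriveM; [|exact: fd|exact: gd].
by apply: classC_add => //; apply: IH => //;
  [exact: classC_pred|exact: classC_derive|exact: classC_pred|
   exact: classC_derive].
Qed.

Lemma classC_sum V W k (U : set V) I (r : seq I) (P : pred I)
    (f : I -> V -> W) : open U -> (forall i, P i -> classC k U (f i)) ->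
  classC k U (fun x => \sum_(i <- r | P i) f i x).
Proof.
move=> oU fC; elim: r => [|i r IH].
  apply: (@eq_classC _ _ _ _ _ (cst 0)) => //; last exact: classC_cst.
  by move=> x _; rewrite big_nil.
case Pi : (P i); last first.
  by apply: eq_classC IH => // x _; rewrite big_cons Pi.
apply: (@eq_classC _ _ _ _ _
    (f i \+ (fun x => \sum_(i <- r | P i) f i x))) => //.
  by move=> x _; rewrite big_cons Pi.
by apply: classC_add => //; exact: fC.
Qed.

Lemma classC_prod V k (U : set V) I (r : seq I) (P : pred I)
    (f : I -> V -> R) : open U -> (forall i, P i -> classC k U (f i)) ->
  classC k U (fun x => \prod_(i <- r | P i) f i x).
Proof.
move=> oU fC; elim: r => [|i r IH].
  apply: (@eq_classC _ _ _ _ _ (fun=> 1 : R)) => //; last exact: classC_cst.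
  by move=> x _; rewrite big_nil.
case Pi : (P i); last first.
  by apply: eq_classC IH => // x _; rewrite big_cons Pi.
apply: (@eq_classC _ _ _ _ _
    (fun x => f i x * \prod_(i <- r | P i) f i x)) => //.
  by move=> x _; rewrite big_cons Pi.
by apply: classC_mul => //; exact: fC.
Qed.

Lemma classC_mulmx V m n p k (U : set V) (f : V -> 'M[R]_(m, n))
    (g : V -> 'M[R]_(n, p)) : open U ->
  classC k U f -> classC k U g -> classC k U (fun x => f x *m g x).
Proof.
move=> oU /classC_mxP fC /classC_mxP gC; apply/classC_mxP => // i j.
apply: (@eq_classC _ _ _ _ _ (fun x => \sum_l f x i l * g x l j)) => //.
  by move=> x _; rewrite mxE.
by apply: classC_sum => // l _; apply: classC_mul => //;
  [exact: fC|exact: gC].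
Qed.

Lemma classC_scalemx V m n k (U : set V) (c : V -> R)
    (f : V -> 'M[R]_(m, n)) : open U ->
  classC k U c -> classC k U f -> classC k U (fun x => c x *: f x).
Proof.
move=> oU cC /classC_mxP fC; apply/classC_mxP => // i j.
apply: (@eq_classC _ _ _ _ _ (fun x => c x * f x i j)) => //.
  by move=> x _; rewrite mxE.
by apply: classC_mul => //; exact: fC.
Qed.

Lemma classC_trmx V m n k (U : set V) (f : V -> 'M[R]_(m, n)) : open U ->
  classC k U f -> classC k U (fun x => (f x)^T).
Proof.
move=> oU /classC_mxP fC; apply/classC_mxP => // i j.
by apply: eq_classC (fC oU j i) => // x _; rewrite mxE.
Qed.

Lemma classC_inv V k (U : set V) (f : V -> R) : open U ->
  (forall x, U x -> f x != 0) -> classC k U f ->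
  classC k U (fun x => (f x)^-1).
Proof.
move=> oU f0; elim: k => [|k IH] fC.
  by split=> // x Ux; apply: continuousV; [exact: f0|
    exact: classC_continuous fC Ux].
split=> [x Ux|v].
  by apply: continuousV; [exact: f0|exact: classC_continuous fC Ux].
have fd x : U x -> derivable f x v by exact: classC_derivable fC.
split=> [x Ux|]; first by apply: derivableV; [exact: f0|exact: fd].
apply: (@eq_classC _ _ _ _ _
    (fun x => (- 1) * ((f x)^-1 * (f x)^-1) * 'D_v f x)) => //.
  by move=> x Ux; rewrite deriveV; [rewrite expr2 invfM mulN1r|exact: f0|exact: fd].
have fI : classC k U (fun x => (f x)^-1) by apply: IH; exact: classC_pred.
apply: classC_mul => //; last exact: classC_derive.
apply: classC_mul => //; first exact: (@classC_cst R V R^o).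
exact: classC_mul.
Qed.

Lemma classC_det V n k (U : set V) (A : V -> 'M[R]_n) : open U ->
  classC k U A -> classC k U (fun x => \det (A x)).
Proof.
move=> oU /classC_mxP AC; rewrite /determinant; apply: classC_sum => // s _.
apply: classC_mul => //; first exact: (@classC_cst R V R^o).
by apply: classC_prod => // i _; exact: AC.
Qed.

Lemma classC_invmx V n k (U : set V) (A : V -> 'M[R]_n) : open U ->
  (forall x, U x -> A x \in unitmx) -> classC k U A ->
  classC k U (fun x => invmx (A x)).
Proof.
move=> oU Au AC; apply: (@eq_classC _ _ _ _ _
    (fun x => (\det (A x))^-1 *: \adj (A x))) => //.
  by move=> x Ux; rewrite /invmx Au.
apply: classC_scalemx => //.
  apply: classC_inv => //; last exact: classC_det.
  by move=> x /Au; rewrite unitmxE unitfE.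
apply/classC_mxP => // i j.
apply: (@eq_classC _ _ _ _ _
    (fun x => (-1) ^+ (j + i) * \det (row' j (col' i (A x))))) => //.
  by move=> x Ux; rewrite mxE.
apply: classC_mul => //; first exact: (@classC_cst R V R^o).
apply: classC_det => //; apply/classC_mxP => // a b.
move/classC_mxP: AC => /(_ oU (lift j a) (lift i b)).
by apply: eq_classC => // x _; rewrite !mxE.
Qed.

End ClassC.

(** * Mean value inequalities *)

Section MeanValue.
Context {R : realType}.

Lemma is_derive_line (V W : normedModType R) (f : V -> W) y v (r : R) :
  derivable f (y + r *: v) v ->
  is_derive r 1 (fun s : R => f (y + s *: v)) ('D_v f (y + r *: v)).
Proof.
move=> fd.
have e : (fun h : R => h^-1 *: (((fun s : R => f (y + s *: v)) \o shift r) (h *: 1)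
    - f (y + r *: v))) =
  (fun h : R => h^-1 *: ((f \o shift (y + r *: v)) (h *: v) - f (y + r *: v))).
  apply/funext => h /=; congr (_ *: (f _ - _)).
  by rewrite [h *: 1]mulr1 scalerDl addrCA.
by split; [rewrite /derivable e|rewrite /derive e].
Qed.

Lemma is_derive_cont (W : normedModType R) (f : R -> W) (r : R) df :
  is_derive r 1 f df -> {for r, continuous f}.
Proof.
by case=> /derivable1_diffP + _; exact: differentiable_continuous.
Qed.

Lemma is_derive_mxP (V : normedModType R) m n (f : V -> 'M[R]_(m, n)) x v df :
  is_derive x v f df <-> forall i j, is_derive x v (fun y => f y i j) (df i j).
Proof.
split=> [[fd <-] i j|fd].
  apply: DeriveDef; first by move/derivable_mxP: fd; exact.
  by rewrite derive_mxE.
have fD : derivable f x v by apply/derivable_mxP => i j; case: (fd i j).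
apply: DeriveDef => //.
by apply/matrixP => i j; rewrite derive_mxE //; case: (fd i j).
Qed.

Lemma le_of_is_derive_ge0 (f df : R -> R) (a b : R) : a <= b ->
  (forall t, a <= t <= b -> is_derive t 1 f (df t)) ->
  (forall t, a <= t <= b -> 0 <= df t) -> f a <= f b.
Proof.
move=> ab fd df0.
have [||c cab fE] := @MVT_segment R f df a b ab.
- by move=> t; rewrite in_itv /= => /andP[ta tb]; apply: fd; rewrite !ltW.
- apply: derivable_within_continuous => t; rewrite in_itv /= => tab.
  by have [] := fd t tab.
- rewrite -subr_ge0 fE mulr_ge0 ?subr_ge0 //.
  by apply: df0; move: cab; rewrite in_itv.
Qed.

Lemma mean_value_le_real (f df g dg : R -> R) (a b : R) : a <= b ->
  (forall t, a <= t <= b -> is_derive t 1 f (df t)) ->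
  (forall t, a <= t <= b -> is_derive t 1 g (dg t)) ->
  (forall t, a <= t <= b -> `|df t| <= dg t) ->
  `|f b - f a| <= g b - g a.
Proof.
move=> ab fd gd dfg; rewrite ler_norml; apply/andP; split.
  have : (g \+ f) a <= (g \+ f) b.
    apply: (@le_of_is_derive_ge0 _ (dg \+ df)) => // t tab /=.
      by have := fd t tab; have := gd t tab; move=> *; exact: is_deriveD.
    by have := dfg t tab; rewrite ler_norml => /andP[]; lra.
  by rewrite /=; lra.
have : (g \- f) a <= (g \- f) b.
  apply: (@le_of_is_derive_ge0 _ (dg \- df)) => // t tab /=.
    by have := fd t tab; have := gd t tab; move=> *; exact: is_deriveB.
  by have := dfg t tab; rewrite ler_norml => /andP[]; lra.
by rewrite /=; lra.
Qed.

(** Majorizing a curve by a scalar function, rather than by a constant speed,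
    is what makes the exponentially weighted estimates below possible. *)
Lemma mean_value_le m n (f df : R -> 'M[R]_(m, n)) (g dg : R -> R) (a b : R) :
  a <= b ->
  (forall t, a <= t <= b -> is_derive t 1 f (df t)) ->
  (forall t, a <= t <= b -> is_derive t 1 g (dg t)) ->
  (forall t, a <= t <= b -> `|df t| <= dg t) ->
  `|f b - f a| <= g b - g a.
Proof.
move=> ab fd gd dfg; apply: mx_norm_leP => [|i j].
  rewrite subr_ge0; apply: le_of_is_derive_ge0 gd _ => // t tab.
  exact: le_trans (dfg t tab).
rewrite !mxE.
apply: (@mean_value_le_real (fun s => f s i j) (fun s => df s i j) g dg) => //.
  by move=> t tab; have /is_derive_mxP := fd t tab; exact.
by move=> t tab; apply: le_trans (dfg t tab); exact: mx_norm_entry.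
Qed.

Lemma mean_value_cst m n (f df : R -> 'M[R]_(m, n)) c e (a b : R) :
  a <= b ->
  (forall t, a <= t <= b -> is_derive t 1 f (df t)) ->
  (forall t, a <= t <= b -> `|df t - c| <= e) ->
  `|f b - f a - (b - a) *: c| <= e * (b - a).
Proof.
move=> ab fd dfe.
have H : forall t, a <= t <= b ->
    is_derive t 1 (fun s : R => f s - s *: c) (df t - c).
  move=> t /fd fdt; apply: is_deriveB; rewrite -[c in is_derive _ _ _ c]scale1r.
  by apply/is_derive_mxP => i j; rewrite !mxE;
    under eq_fun do rewrite mxE mulrC; rewrite mulrC; exact: is_deriveZ.
have He t : a <= t <= b -> is_derive t 1 (fun s : R => e * s) e.
  by move=> _; rewrite -[e in is_derive _ _ _ e]mulr1; exact: is_deriveZ.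
have := mean_value_le ab H He dfe.
by rewrite -mulrBr; congr (`| _ | <= _); apply/matrixP => i j; rewrite !mxE; ring.
Qed.

Lemma mean_value_line (V : normedModType R) m n (f : V -> 'M[R]_(m, n)) y v
    (s : R) c e :
  (forall r, `|r| <= `|s| -> derivable f (y + r *: v) v /\
     `|'D_v f (y + r *: v) - c| <= e) ->
  `|f (y + s *: v) - f y - s *: c| <= e * `|s|.
Proof.
move=> fd; have [s0|s0] := leP 0 s.
  have := @mean_value_cst _ _ (fun r : R => f (y + r *: v))
    (fun r => 'D_v f (y + r *: v)) c e 0 s s0.
  rewrite scale0r addr0 subr0 (ger0_norm s0); apply.
    move=> t /andP[t0 ts]; apply: is_derive_line; apply: (fd _ _).1.
    by rewrite !ger0_norm.
  by move=> t /andP[t0 ts]; apply: (fd _ _).2; rewrite !ger0_norm.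
have := @mean_value_cst _ _ (fun r : R => f (y + r *: v))
    (fun r => 'D_v f (y + r *: v)) c e s 0 (ltW s0).
rewrite scale0r addr0 sub0r (ltr0_norm s0) -normrN.
have -> : - (f y - f (y + s *: v) - - s *: c) = f (y + s *: v) - f y - s *: c.
  by rewrite scaleNr; apply/matrixP => i j; rewrite !mxE; ring.
apply.
  move=> t /andP[st t0]; apply: is_derive_line; apply: (fd _ _).1.
  by rewrite (ltr0_norm s0) (ler0_norm t0) lerN2.
by move=> t /andP[st t0]; apply: (fd _ _).2; rewrite (ltr0_norm s0) (ler0_norm t0) lerN2.
Qed.

End MeanValue.

Section C1.
Context {R : realType}.

Lemma continuous_near_dist (V W : normedModType R) (f : V -> W) x e :
  {for x, continuous f} -> 0 < e -> \forall y \near x, `|f y - f x| <= e.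
Proof.
move=> /cvgrPdist_le fc /fc; apply: filterS => y yn.
rewrite distrC; exact: yn.
Qed.

Lemma differentiable_eps (V W : normedModType R) (f : V -> W) x
    (L : {linear V -> W}) : continuous L ->
  (forall e, 0 < e -> \forall u \near 0, `|f (u + x) - f x - L u| <= e * `|u|) ->
  differentiable f x /\ 'd f x = L :> (V -> W).
Proof.
move=> Lc fe.
have fo : f \o shift x = cst (f x) + (L : V -> W) +o_ 0 id.
  apply/eqaddoP => e e0; have := fe e e0.
  by apply: filterS => u; rewrite opprD addrA.
have dL := diff_unique Lc fo; split=> //.
by apply/diff_locallyP; rewrite dL.
Qed.

(** The vertices of the path from 0 to u which runs parallel to the axes. *)
Let part n (u : 'rV[R]_n) k : 'rV[R]_n := \row_i (u 0 i *+ (i < k)%N).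

(** Class C^1 only speaks of directional derivatives.  The increment from x to
    x + u is cut along the axes; on each edge the mean value inequality applies
    with the derivative at x as reference slope. *)
Lemma classC1_differentiable_mx n p q (U : set 'rV[R]_n)
    (f : 'rV[R]_n -> 'M[R]_(p, q)) x :
  open U -> classC 1 U f -> U x ->
  differentiable f x /\
  forall v, 'D_v f x = \sum_k v 0 k *: 'D_(delta_mx 0 k) f x.
Proof.
move=> oU fC Ux.
pose c (k : 'I_n) : 'M[R]_(p, q) := 'D_(delta_mx 0 k) f x.
pose L (u : 'rV[R]_n) : 'M[R]_(p, q) := \sum_k u 0 k *: c k.
have Llin : linear L.
  move=> a u v; rewrite /L scaler_sumr -big_split; apply: eq_bigr => k _ /=.
  by rewrite !mxE scalerDl scalerA.
pose Lm := GRing.isLinear.Build _ _ _ _ L Llin.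
pose LL : {linear 'rV[R]_n -> 'M[R]_(p, q)} := HB.pack L Lm.
have Lc : continuous LL.
  suff LC : classC 0 setT L by move=> u; exact: classC_continuous LC I.
  apply: classC_sum => [|k _]; first exact: openT.
  split; last exact: I.
  by move=> u _; apply: continuousZr_tmp; exact: coord_continuous.
suff [fd dE] : differentiable f x /\ 'd f x = LL :> (_ -> _).
  by split=> // v; rewrite deriveE // dE.
apply: differentiable_eps => // e e0.
have n0 : 0 < e / n.+1%:R by rewrite divr_gt0.
have Unear : \forall y \near x, U y by exact: open_nbhs_nbhs.
have cnear : \forall y \near x,
    forall k : 'I_n, `|'D_(delta_mx 0 k) f y - c k| <= e / n.+1%:R.
  apply: (@filter_forall _ _ (fun k y =>
    `|derive f y (delta_mx 0 k) - c k| <= e / n.+1%:R) _ (nbhs_filter x)) => k.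
  have fkc := classC_continuous (classC_derive (delta_mx 0 k) fC) Ux.
  exact: (continuous_near_dist fkc n0).
have /nbhs_ballP[d /= d0 dP] : \forall y \near x, U y /\
    forall k : 'I_n, `|'D_(delta_mx 0 k) f y - c k| <= e / n.+1%:R.
  by apply: filterS2 Unear cnear.
apply/nbhs_ballP; exists d => //= u; rewrite -ball_normE /= sub0r normrN => ud.
have step k : `|f (x + part u k.+1) - f (x + part u k) -
    (\sum_(j < n | j == k :> nat) u 0 j *: c j)| <= e / n.+1%:R * `|u|.
  case: (ltnP k n) => kn; last first.
    have -> : part u k.+1 = part u k.
      apply/rowP => i; rewrite !mxE (leq_trans (ltn_ord i) kn).
      by rewrite (leq_trans (ltn_ord i) (leqW kn)).
    rewrite subrr sub0r normrN big_pred0 ?normr0 ?mulr_ge0 // ?ltW //.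
    by move=> j; apply/negbTE; rewrite neq_ltn (leq_trans (ltn_ord j) kn).
  rewrite (big_pred1 (Ordinal kn)); last first.
    by move=> j /=; apply/eqP/eqP => [jk|->] //; exact: val_inj.
  have -> : part u k.+1 = part u k + u 0 (Ordinal kn) *: delta_mx 0 (Ordinal kn).
    apply/rowP => i; rewrite !mxE eqxx /= ltnS leq_eqVlt -val_eqE /=.
    case: eqP => [ik|_] /=; last by rewrite mulr0 addr0.
    rewrite mulr1 ik ltnn mulr0n add0r; congr (u 0 _); exact: val_inj.
  rewrite addrA; apply: le_trans (mean_value_line _) _; last first.
    by apply: ler_wpM2l; [exact: ltW|exact: mx_norm_entry].
  move=> r ru.
  have [|Uy Dy] := dP (x + part u k + r *: delta_mx 0 (Ordinal kn)).
    rewrite -ball_normE /= -addrA opprD addrA subrr sub0r normrN.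
    apply: le_lt_trans ud; apply: mx_norm_leP => // i j.
    rewrite !mxE (ord1 i) eqxx /= -val_eqE /=.
    case: eqP => [jk|jk].
      rewrite jk ltnn mulr0n add0r mulr1; apply: le_trans ru _; exact: mx_norm_entry.
    rewrite mulr0 addr0; case: (_ < _)%N; rewrite ?mulr1n ?mulr0n ?normr0 //.
    exact: mx_norm_entry.
  by split; [exact: classC_derivable fC Uy|exact: Dy].
have tele : forall N, `|f (x + part u N) - f x -
    \sum_(k < N) (\sum_(j < n | j == k :> nat) u 0 j *: c j)| <=
    N%:R * (e / n.+1%:R * `|u|).
  elim=> [|N IH].
    have -> : part u 0 = 0 by apply/rowP => i; rewrite !mxE mulr0n.
    by rewrite addr0 subrr big_ord0 subr0 normr0 mul0r.
  rewrite big_ord_recr /= -natr1 mulrDl mul1r.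
  apply: le_trans (lerD IH (step N)); apply: le_trans (ler_normD _ _).
  by rewrite le_eqVlt; apply/orP; left; apply/eqP; congr `| _ |;
    apply/matrixP => i j; rewrite !mxE; ring.
have := tele n.
have -> : part u n = u by apply/rowP => i; rewrite !mxE ltn_ord.
have -> : \sum_(k < n) (\sum_(j < n | j == k :> nat) u 0 j *: c j) = L u.
  apply: eq_bigr => k _; rewrite (big_pred1 k) // => j.
rewrite [x + u]addrC => /le_trans H; apply: H.
rewrite mulrA; apply: ler_wpM2r => //.
by rewrite mulrCA ler_piMr ?(ltW e0) // ler_pdivrMr // mul1r ler_nat.
Qed.

End C1.

(** * Chain rule and symmetry of second derivatives *)

Section ChainRule.
Context {R : realType}.

Lemma derive_curve (V W : normedModType R) (f : V -> W) x v :
  'D_v f x = 'D_1 (fun h : R => f (h *: v + x)) 0.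
Proof.
rewrite /derive; set g1 := fun h => h^-1 *: _; set g2 := fun h => h^-1 *: _.
suff -> : g1 = g2 by [].
by rewrite funeqE /g1 /g2 => h /=; rewrite addr0 scale0r add0r [_%:A]mulr1.
Qed.

(** Along one direction the inner map matters only through a curve, so it may be
    merely derivable. *)
Lemma derive_comp (V W W' : normedModType R) (f : V -> W) (g : W -> W') x v :
  derivable f x v -> differentiable g (f x) ->
  derivable (g \o f) x v /\ 'D_v (g \o f) x = 'D_('D_v f x) g (f x).
Proof.
rewrite (derive_curve f) => /derivable1P fd gd.
set c := fun h : R => f (h *: v + x) in fd *.
have c0 : c 0 = f x by rewrite /c scale0r add0r.
have cd : differentiable c 0 by apply/derivable1_diffP.
have gcd : differentiable g (c 0) by rewrite c0.
have gc : differentiable (g \o c) 0 by exact: differentiable_comp.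
split; first by apply/derivable1P/derivable1_diffP.
rewrite (derive_curve (g \o f)) -[fun h : R => _]/(g \o c) (deriveE _ gc) diff_comp //=.
by rewrite -(deriveE _ cd) -c0 (deriveE _ gcd).
Qed.

(** The derivative of the composite is a sum of products of a derivative of f
    and a partial derivative of g composed with f, to which the induction
    hypothesis applies. *)
Lemma classC_comp (V : normedModType R) n p q k (U : set V)
    (U' : set 'rV[R]_n) (f : V -> 'rV[R]_n) (g : 'rV[R]_n -> 'M[R]_(p, q)) :
  open U -> open U' -> (forall x, U x -> U' (f x)) ->
  classC k U f -> classC k U' g -> classC k U (g \o f).
Proof.
move=> oU oU' fU; elim: k g => [|k IH] g fC gC.
  split; last by [].
  move=> x Ux; apply: continuous_comp; first exact: classC_continuous fC Ux.
  by apply: classC_continuous gC _; exact: fU.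
have gd x : U x -> differentiable g (f x) /\
    forall v, 'D_v g (f x) = \sum_k v 0 k *: 'D_(delta_mx 0 k) g (f x).
  move=> Ux; apply: (classC1_differentiable_mx oU'); last exact: fU.
  exact: classC_leq gC.
split=> [x Ux|v].
  apply: continuous_comp; first exact: classC_continuous fC Ux.
  by apply: classC_continuous gC _; exact: fU.
have fgd x : U x -> derivable (g \o f) x v /\
    'D_v (g \o f) x = 'D_('D_v f x) g (f x).
  by move=> Ux; apply: derive_comp (gd x Ux).1; exact: classC_derivable fC Ux.
split=> [x /fgd[]//|].
apply: (@eq_classC _ _ _ _ _ (fun x =>
    \sum_j ('D_v f x) 0 j *: 'D_(delta_mx 0 j) g (f x))) => //.
  by move=> x Ux; rewrite (fgd x Ux).2 (gd x Ux).2.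
apply: (@classC_sum _ _ _ _ _ _ _ _ (fun (j : 'I_n) x =>
  ('D_v f x) 0 j *: 'D_(delta_mx 0 j) g (f x))) => // j _.
apply: classC_scalemx => //.
  by have /classC_mxP := classC_derive v fC; exact.
by apply: (IH ('D_(delta_mx 0 j) g)); [exact: classC_pred|exact: classC_derive].
Qed.

(** The inverse of a smooth map, and more generally a solution of an
    autonomous first order system, inherits its smoothness from the equation. *)
Lemma smooth_bootstrap (V : normedModType R) n (U : set V)
    (U' : set 'rV[R]_n) (f : V -> 'rV[R]_n) (G : V -> 'rV[R]_n -> 'rV[R]_n) :
  open U -> open U' -> (forall x, U x -> U' (f x)) ->
  (forall x, U x -> {for x, continuous f}) ->
  (forall v, smooth_on U' (G v)) ->
  (forall v x, U x -> derivable f x v /\ 'D_v f x = G v (f x)) ->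
  smooth_on U f.
Proof.
move=> oU oU' fU fc Gs fd; elim=> [|k IH]; split=> // v; split.
  by move=> x /(fd v)[].
apply: (@eq_classC _ _ _ _ _ (G v \o f)) => //.
  by move=> x /(fd v)[_ ->].
exact: (classC_comp oU oU' fU IH (Gs v k)).
Qed.

(** Two applications of the mean value inequality, first along v to the
    increment in w and then along w to the derivative in v, identify the mixed
    second difference with a mixed derivative. *)
Let mixed_difference (V : normedModType R) m n (U : set V)
    (f : V -> 'M[R]_(m, n)) x v w e :
  open U -> classC 2 U f -> U x -> 0 < e ->
  \forall s \near 0^'+, `|f (x + s *: v + s *: w) - f (x + s *: v)
     - (f (x + s *: w) - f x) - s ^+ 2 *: 'D_w ('D_v f) x| <= e * s ^+ 2.
Proof.
move=> oU fC Ux e0.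
have Unear : \forall y \near x, U y by exact: open_nbhs_nbhs.
have fvwc := classC_continuous (classC_derive w (classC_derive v fC)) Ux.
have cnear := continuous_near_dist fvwc e0.
have /nbhs_ballP[d /= d0 dP] : \forall y \near x, U y /\
    `|'D_w ('D_v f) y - 'D_w ('D_v f) x| <= e.
  by apply: filterS2 Unear cnear.
set N := `|v| + `|w| + 1.
have N0 : 0 < N by rewrite ltr_wpDl // addr_ge0.
near=> s.
have s0 : 0 < s by [].
have sN : s * N < d by rewrite -ltr_pdivlMr //; near: s; apply: nbhs_right_lt; rewrite divr_gt0.
have inb a b : `|a| <= s -> `|b| <= s -> ball x d (x + a *: v + b *: w).
  move=> a_s b_s; rewrite -ball_normE /= -addrA opprD addrA subrr sub0r normrN.
  apply: le_lt_trans sN; apply: le_trans (ler_normD _ _) _.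
  rewrite !normrZ /N !mulrDr mulr1.
  rewrite -[leLHS]addr0; apply: lerD (ltW s0).
  by apply: lerD; apply: ler_wpM2r.
have [s1 s2] : `|0 : R| <= s /\ `|s| <= s by rewrite normr0 ger0_norm ltW.
have Pd a b u : `|a| <= s -> `|b| <= s -> derivable f (x + a *: v + b *: w) u.
  by move=> a_s b_s; apply: classC_derivable fC _; apply: (dP _ (inb _ _ _ _)).1.
pose phi y := f (y + s *: w) - f y.
have phid r : `|r| <= s -> derivable phi (x + r *: v) v /\
    'D_v phi (x + r *: v) = 'D_v f (x + r *: v + s *: w) - 'D_v f (x + r *: v).
  move=> rs.
  have sh : is_derive (x + r *: v) v (fun y => f (y + s *: w))
      ('D_v f (x + r *: v + s *: w)).
    have e2 : (fun h : R => h^-1 *: (((fun y => f (y + s *: w)) \o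
        shift (x + r *: v)) (h *: v) - f (x + r *: v + s *: w))) =
      (fun h : R => h^-1 *: ((f \o shift (x + r *: v + s *: w)) (h *: v) -
         f (x + r *: v + s *: w))).
      by apply/funext => h /=; rewrite -!addrA.
    have := Pd r s v rs s2; rewrite /derivable -e2 => fd.
    apply: DeriveDef; first exact: fd.
    by rewrite /derive e2.
  have fd : is_derive (x + r *: v) v f ('D_v f (x + r *: v)).
    by apply: derivableP; have := Pd r 0 v rs s1; rewrite scale0r addr0.
  by have [? ?] := is_deriveB sh fd.
have := @mean_value_line _ _ _ _ phi x v s (s *: 'D_w ('D_v f) x) (e * s).
rewrite /phi scalerA -expr2 (ger0_norm (ltW s0)) -mulrA -expr2; apply.
move=> r rs; have [rd rE] := phid r rs; split=> //; rewrite rE.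
have := @mean_value_line _ _ _ _ ('D_v f) (x + r *: v) w s ('D_w ('D_v f) x) e.
rewrite (ger0_norm (ltW s0)); apply => b bs; split.
  apply: (classC_derivable (classC_derive v fC)).
  exact: (dP _ (inb _ _ _ _)).1.
exact: (dP _ (inb _ _ _ _)).2.
Unshelve. all: by end_near. Qed.

(** The mixed second difference is symmetric in v and w. *)
Lemma derive_sym (V : normedModType R) m n (U : set V)
    (f : V -> 'M[R]_(m, n)) x v w :
  open U -> classC 2 U f -> U x -> 'D_v ('D_w f) x = 'D_w ('D_v f) x.
Proof.
move=> oU fC Ux; apply/eqP; rewrite -subr_eq0 -normr_le0; apply/ler_addgt0Pr => e e0.
rewrite add0r.
have e2 : 0 < e / 2 by rewrite divr_gt0.
have N1 := mixed_difference v w oU fC Ux e2.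
have N2 := mixed_difference w v oU fC Ux e2.
have N0 : \forall s \near (0 : R)^'+, 0 < s by exact: nbhs_right_gt.
have [s [[s0 H1] H2]] := filter_ex (filterI (filterI N0 N1) N2).
have ss : 0 < s ^+ 2 by rewrite exprn_gt0.
rewrite -(ler_pM2r ss) -[X in _ * X](ger0_norm (ltW ss)) mulrC -normrZ.
have := lerD H1 H2; rewrite -mulrDl -splitr; apply: le_trans.
apply: le_trans (ler_normB _ _).
rewrite [x + s *: w + s *: v]addrAC.
have aux (a b c d p q : 'M[R]_(m, n)) t :
    t *: (p - q) = a - b - (c - d) - t *: q - (a - c - (b - d) - t *: p).
  by apply/matrixP => i j; rewrite !mxE; ring.
by rewrite -aux.
Qed.

Lemma ball_segment (V : normedModType R) (x y z : V) d r :
  ball x d y -> ball x d z -> 0 <= r <= 1 -> ball x d (z + r *: (y - z)).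
Proof.
rewrite -!ball_normE /= => xy xz /andP[r0 r1].
have -> : x - (z + r *: (y - z)) = r *: (x - y) + (1 - r) *: (x - z).
  have e : z - y = (x - y) - (x - z) by rewrite opprB [RHS]addrC addrA subrK.
  by rewrite opprD addrA -scalerN opprB e scalerBr scalerBl scale1r addrCA.
apply: le_lt_trans (ler_normD _ _) _; rewrite !normrZ (ger0_norm r0).
rewrite ger0_norm ?subr_ge0 //.
have [->|r_gt0] := eqVneq r 0; first by rewrite mul0r add0r subr0 mul1r.
rewrite (_ : d = r * d + (1 - r) * d); last by rewrite -mulrDl addrC subrK mul1r.
apply: ltr_leD; first by rewrite ltr_pM2l // lt_neqAle eq_sym r_gt0.
by apply: ler_wpM2l; [rewrite subr_ge0|exact: ltW].
Qed.

(** The increments f y - f z are approximated uniformly in both points, and by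
    the derivative at any third point: this is what injectivity estimates and
    the comparison of nearby trajectories require. *)
Lemma strict_differentiable n p q (U : set 'rV[R]_n)
    (f : 'rV[R]_n -> 'M[R]_(p, q)) x e :
  open U -> classC 1 U f -> U x -> 0 < e ->
  exists2 d, 0 < d & forall y z, ball x d y -> ball x d z ->
    U z /\ forall w, ball x d w -> `|f y - f z - 'D_(y - z) f w| <= e * `|y - z|.
Proof.
move=> oU fC Ux e0.
have n0 : 0 < e / (2 * n.+1%:R) by rewrite divr_gt0 // mulr_gt0.
have Unear : \forall y \near x, U y by exact: open_nbhs_nbhs.
have cnear : \forall y \near x,
    forall k : 'I_n, `|'D_(delta_mx 0 k) f y - 'D_(delta_mx 0 k) f x|
      <= e / (2 * n.+1%:R).
  apply: (@filter_forall _ _ (fun k y =>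
    `|derive f y (delta_mx 0 k) - derive f x (delta_mx 0 k)| <= _) _ (nbhs_filter x)) => k.
  have fkc := classC_continuous (classC_derive (delta_mx 0 k) fC) Ux.
  exact: (continuous_near_dist fkc n0).
have /nbhs_ballP[d /= d0 dP] : \forall y \near x, U y /\
    forall k : 'I_n, `|'D_(delta_mx 0 k) f y - 'D_(delta_mx 0 k) f x|
      <= e / (2 * n.+1%:R).
  by apply: filterS2 Unear cnear.
exists d => // y z xy xz; split=> [|w xw]; first exact: (dP z xz).1.
have := @mean_value_cst _ _ _ (fun r : R => f (z + r *: (y - z)))
  (fun r => 'D_(y - z) f (z + r *: (y - z))) ('D_(y - z) f w) (e * `|y - z|)
  0 1 ler01.
rewrite subr0 mulr1 !scale1r scale0r addr0 [z + _]addrC subrK; apply => r r01.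
  apply: is_derive_line; apply: classC_derivable fC (dP _ _).1.
  exact: ball_segment.
have xr : ball x d (z + r *: (y - z)) by exact: ball_segment.
have [_ ->] := classC1_differentiable_mx oU fC (dP _ xr).1.
have [_ ->] := classC1_differentiable_mx oU fC (dP _ xw).1.
rewrite -sumrB; apply: le_trans (ler_norm_sum _ _ _) _.
apply: (@le_trans _ _ (\sum_(k < n) `|y - z| * (e / n.+1%:R))).
  apply: ler_sum => k _; rewrite -scalerBr normrZ; apply: ler_pM => //.
    exact: mx_norm_entry.
  have := lerD ((dP _ xr).2 k) ((dP _ xw).2 k).
  have -> : e / (2 * n.+1%:R) + e / (2 * n.+1%:R) = e / n.+1%:R.
    have nn : (n.+1%:R : R) != 0 by rewrite pnatr_eq0.
    by field.
  apply: le_trans; rewrite [X in _ <= _ + X]distrC.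
  by apply: le_trans (ler_normD _ _); rewrite addrA subrK.
rewrite sumr_const card_ord -mulrnAr mulrC; apply: ler_wpM2r => //.
by rewrite -mulr_natl mulrCA ler_piMr ?(ltW e0) // ler_pdivrMr // mul1r ler_nat.
Qed.

End ChainRule.

(** * Primitives and Gronwall's inequality *)

Section Primitives.
Context {R : realType}.

Lemma is_derive_comp_scale (W : normedModType R) (f : R -> W) (a t : R) df :
  is_derive (a * t) 1 f df -> is_derive t 1 (fun s : R => f (a * s)) (a *: df).
Proof.
case=> /derivable1_diffP fd <-.
have ad : derivable ( *%R a) t 1 by exact: derivableZ.
have [cd cE] := derive_comp (f := *%R a) (g := f) ad fd.
split => //; rewrite cE.
have aE : is_derive t 1 (a \*: id) (a *: 1) by exact: is_deriveZ.
have -> : 'D_1 ( *%R a) t = a *: 1 by exact: (@derive_val _ _ _ _ _ _ _ aE).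
by rewrite !deriveE // linearZ.
Qed.

Lemma is_derive_expRM (A K t : R) :
  is_derive t 1 (fun s => A * expR (K * s)) (K * A * expR (K * t)).
Proof.
rewrite (_ : K * A * _ = A *: (K *: expR (K * t))); last first.
  by rewrite /GRing.scale /=; ring.
by apply: is_deriveZ; apply: is_derive_comp_scale; exact: is_derive_expR.
Qed.

(** The curves below live on the unit interval; the larger interval makes the
    two-sided derivative available at its end points. *)
Lemma primitive_real (f : R -> R) : continuous f ->
  exists P : R -> R, P 0 = 0 /\ forall t : R, `|t| < 2 -> is_derive t 1 P (f t).
Proof.
move=> fc; pose mu := @lebesgue_measure R.
pose F x := (\int[mu]_(t in [set` `[- 2 : R, x]]) (f t))%R.
exists (fun t => F t - F 0); rewrite subrr; split=> // t.
rewrite ltr_norml => /andP[t2 t2'].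
have fi : mu.-integrable `[- 2 : R, 2 : R] (EFin \o f).
  apply: continuous_compact_integrable; first exact: segment_compact.
  exact: continuous_subspaceT.
have [Fd FE] := continuous_FTC1_closed t2' fi t2 (fc t).
have Fi : is_derive t 1 F (f t) by apply: DeriveDef; [exact: Fd|rewrite -derive1E; exact: FE].
by rewrite -[f t]subr0; apply: is_deriveB.
Qed.

Lemma primitive_mx m n (f : R -> 'M[R]_(m, n)) : continuous f ->
  exists P : R -> 'M[R]_(m, n),
    P 0 = 0 /\ forall t : R, `|t| < 2 -> is_derive t 1 P (f t).
Proof.
move=> fc.
have fP i j : exists P : R -> R,
    P 0 = 0 /\ forall t : R, `|t| < 2 -> is_derive t 1 P (f t i j).
  by apply: primitive_real => t; move/mx_continuousP: (fc t); exact.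
exists (fun t => \matrix_(i, j) sval (cid (fP i j)) t); split=> [|t t2].
  by apply/matrixP => i j; rewrite !mxE; case: cid => P [].
apply/is_derive_mxP => i j; under eq_fun do rewrite mxE.
by case: cid => P /= [_]; exact.
Qed.

Lemma cvg_half_expr (C : R) : C * 2^-1 ^+ m @[m --> \oo] --> 0.
Proof.
rewrite -[X in _ --> X](mulr0 C); apply: cvgM; first exact: cvg_cst.
by apply: cvg_expr; rewrite ger0_norm // invf_lt1 // ltr1n.
Qed.
Lemma geometric_cvg p q (u : nat -> 'M[R]_(p, q)) C :
  (forall m, `|u m.+1 - u m| <= C * 2^-1 ^+ m) ->
  exists l, forall m, `|l - u m| <= 2 * C * 2^-1 ^+ m.
Proof.
move=> uC.
have C0 : 0 <= C by have := uC 0%N; rewrite expr0 mulr1; exact: le_trans.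
have uD m k : `|u (m + k)%N - u m| <= 2 * C * 2^-1 ^+ m * (1 - 2^-1 ^+ k).
  elim: k => [|k IH]; first by rewrite addn0 subrr normr0 expr0 subrr mulr0.
  rewrite addnS -(subrK (u (m + k)%N) (u (m + k).+1)) -addrA.
  apply: le_trans (ler_normD _ _) _; apply: le_trans (lerD (uC _) IH) _.
  by rewrite exprD exprS le_eqVlt; apply/orP; left; apply/eqP; field.
have uB m k : (m <= k)%N -> `|u k - u m| <= 2 * C * 2^-1 ^+ m.
  move=> mk; rewrite -(subnKC mk); apply: le_trans (uD _ _) _.
  by rewrite ler_piMr ?mulr_ge0 // lerBlDr lerDl exprn_ge0.
have u_small e : 0 < e -> exists m, 2 * C * 2^-1 ^+ m < e.
  move=> e0; have := cvg_half_expr (2 * C).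
  move=> /cvgrPdist_lt /(_ _ e0) [m _ /(_ m (leqnn m))].
  rewrite sub0r normrN ger0_norm; first by exists m.
  by rewrite mulr_ge0 ?mulr_ge0 // exprn_ge0.
have : cauchy_ex (u @ \oo).
  move=> e e0; have [m mP] := u_small e e0; exists (u m).
  exists m => // k /= mk; rewrite -ball_normE /= distrC.
  exact: le_lt_trans (uB _ _ mk) mP.
move=> /cauchy_exP /cauchy_cvgP /cvg_ex[l ul]; exists l => m.
rewrite distrC; have ul' : `|u m - u k| @[k --> \oo] --> `|u m - l|.
  by apply: cvg_norm; apply: cvgB; [exact: cvg_cst|exact: ul].
apply: (cvgr_to_le ul'); exists m => // k /= mk.
by rewrite distrC; exact: uB.
Qed.

End Primitives.

Section ExponentialEstimates.
Context {R : realType}.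

(** Integration against the weight exp(K |t|) gains a factor 1 / K on an
    interval of any length. *)
Lemma weighted_primitive m n (D dD : R -> 'M[R]_(m, n)) (K A T : R) :
  0 <= A -> D 0 = 0 ->
  (forall s : R, `|s| <= T -> is_derive s 1 D (dD s) /\
     `|dD s| <= K * A * expR (K * `|s|)) ->
  forall t : R, `|t| <= T -> `|D t| <= A * expR (K * `|t|).
Proof.
move=> A0 D0 Dd t tT; have [t0|t0] := leP 0 t.
  have inT s : 0 <= s <= t -> `|s| <= T.
    by move=> /andP[s0 st]; rewrite ger0_norm // (le_trans st) // -(ger0_norm t0).
  have := @mean_value_le _ _ _ D dD (fun s => A * expR (K * s))
    (fun s => K * A * expR (K * s)) 0 t t0.
  rewrite D0 subr0 mulr0 expR0 mulr1 (ger0_norm t0) => H.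
  apply: le_trans (H _ _ _) _.
  - by move=> s /inT /Dd[].
  - by move=> s _; exact: is_derive_expRM.
  - by move=> s /[dup] /andP[s0 _] /inT /Dd[_]; rewrite (ger0_norm s0).
  by rewrite lerBlDr lerDl.
have inT s : t <= s <= 0 -> `|s| <= T.
  move=> /andP[ts s0]; rewrite ler0_norm // (le_trans _ tT) //.
  by rewrite ltr0_norm // lerN2.
have := @mean_value_le _ _ _ D dD (fun s => - A * expR (- K * s))
  (fun s => - K * - A * expR (- K * s)) t 0 (ltW t0).
rewrite D0 sub0r normrN mulr0 expR0 mulr1 (ltr0_norm t0) => H.
apply: le_trans (H _ _ _) _.
- by move=> s /inT /Dd[].
- by move=> s _; exact: is_derive_expRM.
- move=> s /[dup] /andP[_ s0] /inT /Dd[_]; rewrite (ler0_norm s0).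
  by rewrite mulrNN mulrN mulNr.
by rewrite mulNr opprK mulrN mulNr gerDr oppr_le0.
Qed.

(** Gronwall's inequality.  The norm is not differentiable, so the supremum of
    the norm against an exponential weight is estimated by itself. *)
Lemma gronwall m n (u du : R -> 'M[R]_(m, n)) (L eta eta0 : R) :
  0 <= L -> 0 <= eta ->
  (forall t : R, 0 <= t <= 1 -> is_derive t 1 u (du t)) ->
  (forall t : R, 0 <= t <= 1 -> `|du t| <= L * `|u t| + eta) ->
  `|u 0| <= eta0 ->
  forall t : R, 0 <= t <= 1 -> `|u t| <= (2 * eta0 + eta) * expR (2 * (L + 1)).
Proof.
move=> L0 eta_ge0 ud duL u0 t t01.
(* A weight growing twice as fast as the equation allows makes the integral of
   L |u| at most half of the maximum M of f, which is then absorbed. *)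
set K := 2 * (L + 1).
have K2 : 2 <= K by rewrite /K ler_peMr // lerDr.
have K0 : 0 < K by apply: lt_le_trans K2.
pose f s := `|u s| * expR (- K * s).
have fc : {within `[0, 1], continuous f}.
  apply/continuous_in_subspaceT => s /[1!inE] /=; rewrite in_itv /= => s01.
  apply: (@continuousM _ _ (fun s => `|u s|) (fun s => expR (- K * s))).
    apply: continuous_comp; last exact: norm_continuous.
    exact: is_derive_cont (ud s s01).
  apply: (@continuous_comp _ _ _ ( *%R (- K)) expR); last exact: continuous_expR.
  exact: mulrl_continuous.
have [c c01 fmax] := EVT_max ler01 fc; move: c01; rewrite in_itv /= => c01.
set M := f c.
have uM s : 0 <= s <= 1 -> `|u s| <= M * expR (K * s).
  move=> s01; rewrite -ler_pdivrMr ?expR_gt0 // -expRN -mulNr.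
  by apply: fmax; rewrite in_itv.
have M0 : 0 <= M by rewrite mulr_ge0 // expR_ge0.
have /andP[c0 c1] := c01.
have in01 s : 0 <= s <= c -> 0 <= s <= 1.
  by move=> /andP[-> sc] /=; exact: le_trans sc c1.
have := @mean_value_le _ _ _ u du (fun s => (L * M + eta) / K * expR (K * s))
    (fun s => K * ((L * M + eta) / K) * expR (K * s)) 0 c c0.
rewrite mulr0 expR0 mulr1 => H.
have {}H : `|u c - u 0| <= (L * M + eta) / K * expR (K * c) - (L * M + eta) / K.
  apply: H.
  - by move=> s /in01 /ud.
  - by move=> s _; exact: is_derive_expRM.
  - move=> s sc; have s01 := in01 s sc; apply: le_trans (duL s s01) _.
    rewrite [K * (_ / _)]mulrC divfK ?gt_eqF // mulrDl -mulrA; apply: lerD.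
      by apply: ler_wpM2l => //; exact: uM.
    rewrite ler_peMr // -expR0 ler_expR mulr_ge0 ?(ltW K0) //.
    by case/andP: s01.
have e1 : 1 <= expR (K * c) by rewrite -expR0 ler_expR mulr_ge0 // ltW.
have Mc : M * expR (K * c) = `|u c|.
  by rewrite /M /f -mulrA -expRD mulNr addrC subrr expR0 mulr1.
have eta00 : 0 <= eta0 by apply: le_trans u0.
have P0 : 0 <= (L * M + eta) / K.
  by rewrite divr_ge0 ?(ltW K0) // addr_ge0 // mulr_ge0.
have Me : M * expR (K * c) <= (eta0 + (L * M + eta) / K) * expR (K * c).
  rewrite Mc -(subrK (u 0) (u c)); apply: le_trans (ler_normD _ _) _.
  apply: le_trans (lerD H u0) _.
  have : eta0 <= eta0 * expR (K * c) by rewrite ler_peMr.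
  move: P0; set P := _ / K; set E := expR _ => P0 E0.
  by rewrite [(eta0 + _) * _]mulrDl; lra.
have {}Me : M <= eta0 + (L * M + eta) / K.
  by move: Me; rewrite ler_pM2r // expR_gt0.
have M2 : (L * M + eta) / K <= M / 2 + eta / 2.
  rewrite -mulrDl ler_pdivrMr // /K.
  have -> : (M + eta) / 2 * (2 * (L + 1)) = (M + eta) * (L + 1) by field.
  have : 0 <= eta * L by rewrite mulr_ge0.
  nra.
have MM : M <= 2 * eta0 + eta by lra.
apply: le_trans (uM t t01) _; apply: ler_pM => //.
by rewrite ler_expR ler_piMr ?(ltW K0) //; case/andP: t01.
Qed.

End ExponentialEstimates.

(** * Lipschitz differential equations *)

Section Clamp.
Context {R : realType}.

Definition clamp (a b t : R) : R := Num.max a (Num.min t b).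

Lemma clamp_in a b t : a <= b -> a <= clamp a b t <= b.
Proof.
move=> ab; rewrite /clamp le_max lexx /= ge_max ab /=.
by rewrite ge_min lexx orbT.
Qed.

Lemma clamp_id a b t : a <= t <= b -> clamp a b t = t.
Proof.
by move=> /andP[ta tb]; rewrite /clamp (min_idPl tb); apply/max_idPr.
Qed.

Lemma clamp_lipschitz a b s t : `|clamp a b s - clamp a b t| <= `|s - t|.
Proof.
have N0 : 0 <= `|s - t| by [].
have := ler_norm (s - t); have := ler_norm (t - s); rewrite (distrC t s).
move: N0; set N := `| _ | => N0 N1 N2; rewrite /clamp !maxEle !minEle ler_norml.
by case: (leP s b) => ?; case: (leP t b) => ?; case: (leP a s) => ?;
  case: (leP a t) => ?; case: (leP a b) => ?; lra.
Qed.

Lemma lipschitz_continuous (V W : normedModType R) (f : V -> W) L :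
  0 <= L -> (forall x y, `|f x - f y| <= L * `|x - y|) -> continuous f.
Proof.
move=> L0 fL x; apply/cvgrPdist_le => e e0.
have L1 : 0 < L + 1 by rewrite ltr_wpDl.
have d0 : 0 < e / (L + 1) by rewrite divr_gt0.
apply/nbhs_ballP; exists (e / (L + 1)) => //= y; rewrite -ball_normE /= => xy.
apply: le_trans (fL x y) _.
apply: (@le_trans _ _ ((L + 1) * `|x - y|)).
  by apply: ler_wpM2r => //; rewrite lerDl.
by rewrite mulrC -ler_pdivlMr // ltW.
Qed.

Lemma clamp_continuous a b : continuous (clamp a b).
Proof.
apply: (@lipschitz_continuous R R _ 1) => // s t.
by rewrite mul1r; exact: clamp_lipschitz.
Qed.

(** The retraction of a sphere of the sup norm is componentwise, hence does not
    increase distances. *)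
Definition clamp_row n (x0 : 'rV[R]_n) r (x : 'rV[R]_n) : 'rV[R]_n :=
  \row_i clamp (x0 0 i - r) (x0 0 i + r) (x 0 i).

Lemma clamp_row_lipschitz n (x0 : 'rV[R]_n) r x y :
  `|clamp_row x0 r x - clamp_row x0 r y| <= `|x - y|.
Proof.
apply: mx_norm_leP => // i j; rewrite !mxE.
apply: le_trans (clamp_lipschitz _ _ _ _) _.
have := mx_norm_entry (x - y) 0 j.
by rewrite !mxE.
Qed.

Lemma clamp_row_in n (x0 : 'rV[R]_n) r x : 0 <= r ->
  `|clamp_row x0 r x - x0| <= r.
Proof.
move=> r0; apply: mx_norm_leP => // i j; rewrite !mxE (ord1 i) ler_norml.
have ab : x0 0 j - r <= x0 0 j + r by lra.
have /andP[] := clamp_in (x 0 j) ab.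
by move: (clamp _ _ _) => c; lra.
Qed.

Lemma clamp_row_id n (x0 : 'rV[R]_n) r x :
  `|x - x0| <= r -> clamp_row x0 r x = x.
Proof.
move=> xr; apply/rowP => i; rewrite !mxE clamp_id //.
have := mx_norm_entry (x - x0) 0 i; rewrite !mxE => /le_trans /(_ xr).
by rewrite ler_norml; lra.
Qed.

End Clamp.

Section Picard.
Context {R : realType}.

Lemma norm_le_geometric_eq0 (W : normedModType R) (x : W) C :
  (forall m, `|x| <= C * 2^-1 ^+ m) -> x = 0.
Proof.
move=> xC; apply/eqP; rewrite -normr_le0.
by have /cvgr_to_ge := @cvg_half_expr R C; apply; exists 0%N => // m _; exact: xC.
Qed.

(** Picard iteration.  The weight exp(2L|t|) makes the iteration contract by
    one half on an interval of any length. *)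
Theorem picard n (F : R -> 'rV[R]_n -> 'rV[R]_n) (L : R) (v : 'rV[R]_n) :
  0 <= L ->
  (forall w : R -> 'rV[R]_n, continuous w -> continuous (fun t => F t (w t))) ->
  (forall t y z, `|F t y - F t z| <= L * `|y - z|) ->
  exists w : R -> 'rV[R]_n, w 0 = v /\
    forall t : R, `|t| <= 1 -> is_derive t 1 w (F t (w t)).
Proof.
move=> L0 Fc FL.
have [prim primP] : exists prim : (R -> 'rV[R]_n) -> R -> 'rV[R]_n,
    forall f, continuous f -> prim f 0 = 0 /\
      forall t : R, `|t| < 2 -> is_derive t 1 (prim f) (f t).
  have /choice[prim primP] : forall f : R -> 'rV[R]_n,
      exists P : R -> 'rV[R]_n, continuous f -> P 0 = 0 /\
      forall t : R, `|t| < 2 -> is_derive t 1 P (f t).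
    move=> f; have [fc|fc] := pselect (continuous f).
      by have [P PP] := primitive_mx fc; exists P.
    by exists f.
  by exists prim.
(* The iterates are extended beyond [-T, T] by clamping the time; T lies between
   1, where derivatives are wanted, and 2, where primitives exist. *)
pose T : R := 3 / 2.
have T0 : - T <= T by rewrite /T; lra.
pose cl := clamp (- T) T.
have clT s : `|cl s| <= T by rewrite ler_norml; exact: clamp_in.
have clE (s : R) : `|s| <= T -> cl s = s by rewrite ler_norml; exact: clamp_id.
have T2 (s : R) : `|s| <= T -> `|s| < 2.
  by move=> sT; apply: le_lt_trans sT _; rewrite /T; lra.
pose P0 (w : R -> 'rV[R]_n) (t : R) : 'rV[R]_n := v + prim (fun s => F s (w s)) t.
have P0d w (t : R) : continuous w -> `|t| < 2 -> is_derive t 1 (P0 w) (F t (w t)).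
  move=> wc t2; have [_ pd] := primP _ (Fc w wc).
  by rewrite -[F t (w t)]add0r; apply: is_deriveD; exact: pd.
have P00 w : continuous w -> P0 w 0 = v.
  by move=> wc; have [p0 _] := primP _ (Fc w wc); rewrite /P0 p0 addr0.
pose G m := iter m (fun G => P0 (G \o cl)) (fun=> v).
have Gc m : continuous (G m \o cl).
  elim: m => [|m IH]; first by move=> s; exact: cst_continuous.
  move=> s; apply: continuous_comp; first exact: clamp_continuous.
  by apply: is_derive_cont (P0d _ _ IH _); exact: T2.
have G0 m : G m 0 = v by case: m => [//|m]; exact: P00.
have Gd m (t : R) : `|t| <= T -> is_derive t 1 (G m.+1) (F t (G m t)).
  by move=> tT; have := P0d _ t (Gc m) (T2 t tT); rewrite /= clE.
have G1c : {within `[- T, T], continuous (fun t => `|G 1%N t - v|)}.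
  apply/continuous_in_subspaceT => s /[1!inE] /=; rewrite in_itv /= -ler_norml => sT.
  apply: continuous_comp; last exact: norm_continuous.
  apply: (@continuousB _ _ _ (G 1%N) (fun=> v)); last exact: cst_continuous.
  exact: is_derive_cont (Gd 0%N s sT).
have [c0 _ cmax] := EVT_max T0 G1c.
set C := `|G 1%N c0 - v| in cmax.
have C0 : 0 <= C by exact: normr_ge0.
have GD m (t : R) : `|t| <= T ->
    `|G m.+1 t - G m t| <= C * 2^-1 ^+ m * expR (2 * L * `|t|).
  elim: m t => [|m IH] t tT.
    rewrite expr0 mulr1; apply: le_trans (cmax t _) _.
      by rewrite in_itv /= -ler_norml.
    by rewrite ler_peMr // -expR0 ler_expR !mulr_ge0.
  apply: (@weighted_primitive _ _ _ (fun t => G m.+2 t - G m.+1 t)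
    (fun t => F t (G m.+1 t) - F t (G m t)) (2 * L) (C * 2^-1 ^+ m.+1) T) => //.
  - by rewrite mulr_ge0 // exprn_ge0.
  - by rewrite !G0 subrr.
  move=> s sT; split.
    by apply: is_deriveB; exact: Gd.
  apply: le_trans (FL _ _ _) _.
  rewrite (_ : _ * _ * _ = L * (C * 2^-1 ^+ m * expR (2 * L * `|s|))).
    by apply: ler_wpM2l => //; exact: IH.
  by rewrite exprS; field.
set C' := C * expR (2 * L * T).
have /choice[w wP] : forall s, exists l, forall m,
    `|l - G m (cl s)| <= 2 * C' * 2^-1 ^+ m.
  move=> s; apply: (@geometric_cvg _ _ _ (fun m => G m (cl s))) => m.
  apply: le_trans (GD m _ (clT s)) _.
  rewrite /C' mulrAC; apply: ler_wpM2r; first by rewrite exprn_ge0.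
  apply: ler_wpM2l => //; rewrite ler_expR; apply: ler_wpM2l; last exact: clT.
  by rewrite mulr_ge0.
have C'0 : 0 <= C' by rewrite mulr_ge0 // expR_ge0.
clearbody C'.
have wc : continuous w.
  move=> s; apply/cvgrPdist_le => e e0.
  have [m mP] : exists m, 2 * C' * 2^-1 ^+ m <= e / 3.
    have e3 : 0 < e / 3 by rewrite divr_gt0.
    have := @cvg_half_expr R (2 * C').
    move=> /cvgrPdist_le /(_ _ e3) [m _ /(_ m (leqnn m))].
    rewrite sub0r normrN ger0_norm; first by exists m.
    by rewrite mulr_ge0 ?mulr_ge0 // exprn_ge0.
  have e3 : 0 < e / 3 by rewrite divr_gt0.
  have /cvgrPdist_le /(_ _ e3) := Gc m s.
  apply: filterS => t /= Ht.
  have := lerD (lerD (le_trans (wP s m) mP) Ht) (le_trans (wP t m) mP).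
  rewrite (_ : e / 3 + e / 3 + e / 3 = e); last by field.
  apply: le_trans; rewrite [X in _ <= _ + X]distrC.
  apply: le_trans (lerD (ler_normD _ _) (lexx _)).
  apply: le_trans (ler_normD _ _).
  by rewrite !addrA subrK subrK.
exists (P0 w); split; first exact: P00.
move=> t t1; have tT : `|t| <= T by apply: le_trans t1 _; rewrite /T; lra.
suff -> : P0 w t = w t by apply: P0d => //; exact: T2.
apply/eqP; rewrite -subr_eq0; apply/eqP.
apply: (@norm_le_geometric_eq0 _ _ (L * 2 * C' * expR (1 * `|t|) + C')) => m.
have H : `|P0 w t - G m.+1 t| <= L * 2 * C' * 2^-1 ^+ m * expR (1 * `|t|).
  apply: (@weighted_primitive _ _ _ (fun t => P0 w t - G m.+1 t)
    (fun t => F t (w t) - F t (G m t)) 1 (L * 2 * C' * 2^-1 ^+ m) T) => //.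
  - by rewrite !mulr_ge0 ?expR_ge0 ?exprn_ge0.
  - by rewrite G0 P00 // subrr.
  move=> s sT; split.
    by apply: is_deriveB; [apply: P0d => //; exact: T2|exact: Gd].
  apply: le_trans (FL _ _ _) _; rewrite mul1r -!mulrA.
  apply: ler_wpM2l => //; rewrite !mulrA.
  have := wP s m; rewrite clE // => H; apply: le_trans H _.
  rewrite ler_peMr ?mulr_ge0 ?expR_ge0 ?exprn_ge0 //.
  by rewrite -expR0 ler_expR mulr_ge0.
have := wP t m.+1; rewrite clE // => H'.
have := lerD H H'; rewrite [X in _ <= _ + X -> _](_ : _ = C' * 2^-1 ^+ m); last first.
  by rewrite exprS; field.
rewrite [X in _ <= X + _ -> _]mulrAC -mulrDl; apply: le_trans.
rewrite [X in _ <= _ + X]distrC; apply: le_trans (ler_normD _ _).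
by rewrite addrA subrK.
Qed.

End Picard.

(** * Differentiability of flows *)

Section Jacobian.
Context {R : realType}.

Lemma classC_differentiable n p q k (U : set 'rV[R]_n)
    (f : 'rV[R]_n -> 'M[R]_(p, q)) x :
  open U -> classC k.+1 U f -> U x -> differentiable f x.
Proof.
move=> oU fC Ux; apply: (classC1_differentiable_mx oU _ Ux).1.
exact: classC_leq fC.
Qed.

Lemma classC_deriveE n m k (U : set 'rV[R]_n)
    (f : 'rV[R]_n -> 'rV[R]_m) x v :
  open U -> classC k.+1 U f -> U x -> 'D_v f x = v *m jacobian f x.
Proof.
by move=> oU fC Ux; rewrite deriveEjacobian //; exact: classC_differentiable oU fC Ux.
Qed.

Lemma classC_jacobian n m k (U : set 'rV[R]_n) (f : 'rV[R]_n -> 'rV[R]_m) :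
  open U -> classC k.+1 U f -> classC k U (jacobian f).
Proof.
move=> oU fC; apply/classC_mxP => // i j.
have /classC_mxP := classC_derive (delta_mx 0 i) fC => /(_ oU 0 j).
apply: eq_classC => // x Ux.
by rewrite (classC_deriveE _ oU fC Ux) -rowE mxE.
Qed.

Lemma classC_row_mx (V : normedModType R) m n p k (U : set V)
    (f : V -> 'M[R]_(m, n)) (g : V -> 'M[R]_(m, p)) : open U ->
  classC k U f -> classC k U g -> classC k U (fun x => row_mx (f x) (g x)).
Proof.
move=> oU /classC_mxP fC /classC_mxP gC; apply/classC_mxP => // i j.
rewrite -(splitK j); case: (fintype.split j) => l /=.
  by apply: eq_classC (fC oU i l) => // x _; rewrite row_mxEl.
by apply: eq_classC (gC oU i l) => // x _; rewrite row_mxEr.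
Qed.

Lemma classC_entries (V : normedModType R) m n p q k (U : set V)
    (f : V -> 'M[R]_(m, n)) (g : V -> 'M[R]_(p, q)) (r : 'I_p -> 'I_m)
    (c : 'I_q -> 'I_n) : open U ->
  (forall x i j, f x (r i) (c j) = g x i j) -> classC k U f -> classC k U g.
Proof.
move=> oU fg /classC_mxP fC; apply/classC_mxP; [exact: oU|move=> i j].
by apply: eq_classC oU _ (fC oU (r i) (c j)) => x _; exact: fg.
Qed.

Lemma classC_lsubmx (V : normedModType R) m n p k (U : set V)
    (f : V -> 'M[R]_(m, n + p)) : open U ->
  classC k U f -> classC k U (fun x => lsubmx (f x)).
Proof.
by move=> oU; apply: (classC_entries (r := id) (c := lshift p) oU) => x i j;
  rewrite mxE.
Qed.

Lemma classC_rsubmx (V : normedModType R) m n p k (U : set V)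
    (f : V -> 'M[R]_(m, n + p)) : open U ->
  classC k U f -> classC k U (fun x => rsubmx (f x)).
Proof.
by move=> oU; apply: (classC_entries (r := id) (c := @rshift n p) oU) => x i j;
  rewrite mxE.
Qed.

Lemma classC_id (V : normedModType R) k (U : set V) : classC k U (id : V -> V).
Proof.
case: k => [|k]; (split; first by move=> x _; exact: cvg_id); first by [].
move=> v; split; first by move=> x _; exact: derivable_id.
have -> : 'D_v (id : V -> V) = cst v by apply/funext => x; exact: derive_id.
exact: classC_cst.
Qed.

Lemma open_lsubmx m n (U : set 'rV[R]_m) : open U ->
  open ((lsubmx : 'rV[R]_(m + n) -> 'rV[R]_m) @^-1` U).
Proof. by move=> oU; apply: open_comp oU => x _; exact: continuous_lsubmx. Qed.

Lemma classC_comp_lsubmx m n p q k (U : set 'rV[R]_m)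
    (f : 'rV[R]_m -> 'M[R]_(p, q)) : open U -> classC k U f ->
  classC k ((lsubmx : 'rV[R]_(m + n) -> 'rV[R]_m) @^-1` U)
    (fun z => f (lsubmx z)).
Proof.
move=> oU fC; apply: (classC_comp (open_lsubmx oU) oU) => //.
by apply: classC_lsubmx; [exact: open_lsubmx|exact: classC_id].
Qed.

End Jacobian.

Lemma continuous_dist {R : realType} (V W : normedModType R) (f : V -> W) x :
  (forall e, 0 < e -> \forall y \near x, `|f y - f x| <= e) ->
  {for x, continuous f}.
Proof.
move=> fx; apply/cvgrPdist_le => e /fx.
by apply: filterS => y; rewrite distrC.
Qed.

Section CurveUniformity.
Context {R : realType}.

(** Compactness of the time interval, in the form in which it is used: a
    property of pairs of nearby points which holds near each point of a curve
    holds in a tube of constant radius. *)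
Lemma curve_tube n (c : R -> 'rV[R]_n) (Q : 'rV[R]_n -> 'rV[R]_n -> Prop) :
  (forall t : R, 0 <= t <= 1 -> {for t, continuous c}) ->
  (forall t : R, 0 <= t <= 1 -> exists2 d, 0 < d &
     forall y z, ball (c t) d y -> ball (c t) d z -> Q y z) ->
  exists2 d, 0 < d & forall (t : R) y, 0 <= t <= 1 -> `|y - c t| <= d -> Q y (c t).
Proof.
move=> cc cQ.
have /compact_near_coveringP near01 := @segment_compact R 0 1.
pose P (d : R) (t : R) := forall y, `|y - c t| <= d -> Q y (c t).
have /near01 : forall t : R, `[0, 1]%classic t ->
    \forall t' \near t & d \near (0 : R)^'+, P d t'.
  move=> t /=; rewrite in_itv /= => t01.
  have [d d0 dQ] := cQ t t01.
  have d2 : 0 < d / 2 by rewrite divr_gt0.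
  have cn : \forall t' \near t, ball (c t) (d / 2) (c t').
    by apply: cc => //; exact: nbhsx_ballx.
  have dn : \forall d' \near (0 : R)^'+, d' < d / 2 by exact: nbhs_right_lt.
  exists ([set t' | ball (c t) (d / 2) (c t')], [set d' | d' < d / 2]) => //.
  move=> [t' d'] /= [ct' dd'] y yd; apply: dQ; last first.
    by apply: le_ball ct'; lra.
  move: ct'; rewrite -!ball_normE /= => ct'.
  rewrite -(subrK (c t') (c t)) -addrA; apply: le_lt_trans (ler_normD _ _) _.
  rewrite (splitr d); apply: ltr_leD ct' _.
  by rewrite distrC (le_trans yd) // ltW.
move=> H; have [d [d0 dP]] := filter_ex (filterI (nbhs_right_gt (0 : R)) H).
by exists d => // t y t01 yd; apply: (dP t) => //=; rewrite in_itv.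
Qed.

Lemma curve_bounded m n (c : R -> 'M[R]_(m, n)) :
  (forall t : R, 0 <= t <= 1 -> {for t, continuous c}) ->
  exists2 B, 0 <= B & forall t : R, 0 <= t <= 1 -> `|c t| <= B.
Proof.
move=> cc.
have fc : {within `[0, 1], continuous (fun t => `|c t|)}.
  apply/continuous_in_subspaceT => s /[1!inE] /=; rewrite in_itv /= => s01.
  by apply: continuous_comp; [exact: cc|exact: norm_continuous].
have [s _ smax] := EVT_max (@ler01 R) fc.
by exists `|c s| => // t t01; apply: smax; rewrite in_itv.
Qed.

End CurveUniformity.

Section Flow.
Context {R : realType}.

(** The last field replaces joint continuity: it is the form of continuity
    which passes to the tangent flow by Gronwall's inequality alone. *)
Record is_flow n (U W : set 'rV[R]_n) (X : 'rV[R]_n -> 'rV[R]_n)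
    (Phi : R -> 'rV[R]_n -> 'rV[R]_n) : Prop := IsFlow {
  flow0 : forall x, W x -> Phi 0 x = x;
  flow_in : forall x (t : R), W x -> 0 <= t <= 1 -> U (Phi t x);
  flow_ode : forall x (t : R), W x -> 0 <= t <= 1 ->
    is_derive t 1 (Phi ^~ x) (X (Phi t x));
  flow_equicontinuous : forall x e, W x -> 0 < e ->
    \forall y \near x, forall t : R, 0 <= t <= 1 -> `|Phi t y - Phi t x| <= e }.

(** The pair (x, v) stands for the tangent vector v at x; the second component
    is the variational equation. *)
Definition tangent_field n (X : 'rV[R]_n -> 'rV[R]_n) (z : 'rV[R]_(n + n)) :
    'rV[R]_(n + n) :=
  row_mx (X (lsubmx z)) (rsubmx z *m jacobian X (lsubmx z)).

Section FlowDerivative.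
Variables (n : nat) (U W : set 'rV[R]_n) (X : 'rV[R]_n -> 'rV[R]_n)
  (Phi : R -> 'rV[R]_n -> 'rV[R]_n).
Hypotheses (oU : open U) (oW : open W) (XC : smooth_on U X)
  (PhiF : is_flow U W X Phi).

Let J := jacobian X.

Let Phic x (t : R) : W x -> 0 <= t <= 1 -> {for t, continuous (Phi ^~ x)}.
Proof. by move=> Wx t01; exact: is_derive_cont (flow_ode PhiF Wx t01). Qed.

Let Jc y : U y -> {for y, continuous J}.
Proof. by move=> Uy; exact: classC_continuous (classC_jacobian oU (XC 1%N)) Uy. Qed.

Let JPhic x (t : R) : W x -> 0 <= t <= 1 -> {for t, continuous (fun t => J (Phi t x))}.
Proof.
move=> Wx t01; apply: (@continuous_comp _ _ _ (Phi ^~ x) J).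
  exact: Phic.
by apply: Jc; exact: flow_in PhiF _ _ Wx t01.
Qed.

Let remainder x e : W x -> 0 < e -> exists2 d, 0 < d & forall (t : R) y,
  0 <= t <= 1 -> `|y - Phi t x| <= d ->
  `|X y - X (Phi t x) - (y - Phi t x) *m J (Phi t x)| <= e * `|y - Phi t x|.
Proof.
move=> Wx e0; apply: (@curve_tube _ _ (Phi ^~ x)
  (fun y z => `|X y - X z - (y - z) *m J z| <= e * `|y - z|)).
  by move=> t t01; exact: Phic.
move=> t t01; have UP := flow_in PhiF Wx t01.
have [d d0 dP] := strict_differentiable oU (XC 1%N) UP e0.
exists d => // y z yd zd; have [Uz H] := dP y z yd zd.
by rewrite -(classC_deriveE _ oU (XC 1%N) Uz); exact: H.
Qed.

Let J_tube x e : W x -> 0 < e -> exists2 d, 0 < d & forall (t : R) y,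
  0 <= t <= 1 -> `|y - Phi t x| <= d -> `|J y - J (Phi t x)| <= e.
Proof.
move=> Wx e0; apply: (@curve_tube _ _ (Phi ^~ x)
  (fun y z => `|J y - J z| <= e)).
  by move=> t t01; exact: Phic.
move=> t t01; have UP := flow_in PhiF Wx t01.
have e2 : 0 < e / 2 by rewrite divr_gt0.
have /cvgrPdist_le /(_ _ e2) /nbhs_ballP[d /= d0 dP] := Jc UP.
exists d => // y z yd zd.
rewrite -(subrK (J (Phi t x)) (J y)) -addrA; apply: le_trans (ler_normD _ _) _.
by rewrite (splitr e); apply: lerD; [rewrite distrC|]; exact: dP.
Qed.

(** The variational equation along a trajectory is linear with bounded
    coefficients, hence globally Lipschitz. *)
Lemma linearized_flow_exists x v : W x ->
  exists w : R -> 'rV[R]_n, w 0 = v /\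
    forall t : R, 0 <= t <= 1 -> is_derive t 1 w (w t *m J (Phi t x)).
Proof.
move=> Wx; have [B B0 JB] := curve_bounded (fun t t01 => JPhic Wx t01).
pose F t (u : 'rV[R]_n) := u *m J (Phi (clamp 0 1 t) x).
have cl01 (t : R) : 0 <= clamp 0 1 t <= 1 by exact: clamp_in.
have [|||w [w0 wd]] := @picard R n F (n%:R * B) v.
- by rewrite mulr_ge0.
- move=> w wc t; suff FC : classC 0 setT (fun t => w t *m J (Phi (clamp 0 1 t) x)).
    exact: classC_continuous FC I.
  apply: classC_mulmx;
    [exact: openT| |]; split; try by [].
    by move=> s _; exact: wc.
  move=> s _.
  apply: (@continuous_comp _ _ _ (clamp 0 1) (fun t => J (Phi t x))).
    exact: clamp_continuous.
  exact: JPhic.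
- move=> t y z; rewrite -mulmxBl; apply: le_trans (mulmx_norm _ _) _.
  rewrite -mulrA; apply: ler_wpM2l => //; rewrite mulrC.
  by apply: ler_wpM2r => //; exact: JB.
exists w; split=> // t t01; have := wd t; rewrite /F clamp_id //; apply.
by case/andP: t01 => t0 t1; rewrite ger0_norm.
Qed.

(** The increment of the flow and h w satisfy the same linear equation up to
    the remainder of X, which is small compared to the increment by strict
    differentiability along the trajectory; Gronwall's inequality is applied
    first to the increment, then to its difference with h w. *)
Lemma flow_is_derive x v (w : R -> 'rV[R]_n) : W x -> w 0 = v ->
  (forall t : R, 0 <= t <= 1 -> is_derive t 1 w (w t *m J (Phi t x))) ->
  forall t : R, 0 <= t <= 1 -> is_derive x v (Phi t) (w t).
Proof.
move=> Wx w0 wd t t01.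
suff H : (fun h : R => h^-1 *: ((Phi t \o shift x) (h *: v) - Phi t x)) @ 0^' --> w t.
  apply: DeriveDef; first by apply/cvg_ex; exists (w t).
  exact: cvg_lim H.
apply/cvgrPdist_le => e e0.
have [B B0 JB] := curve_bounded (fun t t01 => JPhic Wx t01).
(* The summand 1 absorbs the remainder of the first order expansion of X. *)
set L := n%:R * B + 1; have L0 : 0 <= L by rewrite addr_ge0 // mulr_ge0.
set E := expR (2 * (L + 1)); have E0 : 0 < E by exact: expR_gt0.
set K := 2 * `|v| * E * E + 1.
have K0 : 0 < K by rewrite ltr_wpDl // !mulr_ge0 // ltW.
have e'0 : 0 < e / K by rewrite divr_gt0.
have [d1 d10 rem1] := remainder Wx ltr01.
have [d2 d20 rem2] := remainder Wx e'0.
set d := Num.min d1 d2; have d0 : 0 < d by rewrite lt_min d10.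
have vx : h *: v + x @[h --> (0 : R)^'] --> x.
  suff : h *: v + x @[h --> (0 : R)^'] --> 0 *: v + x by rewrite scale0r add0r.
  apply: cvgD; last exact: cvg_cst.
  by apply: cvgZr_tmp; exact: nbhs_dnbhs.
have Wn : \forall h \near (0 : R)^', W (h *: v + x).
  by apply: vx; exact: open_nbhs_nbhs.
have dn : \forall h \near (0 : R)^', forall t : R, 0 <= t <= 1 ->
    `|Phi t (h *: v + x) - Phi t x| <= d.
  exact: (vx _ (flow_equicontinuous PhiF Wx d0)).
have hn : \forall h \near (0 : R)^', h != 0 by exact: nbhs_dnbhs_neq.
apply: filterS3 Wn dn hn => h Wy yd h0 /=.
set y := h *: v + x in Wy yd *.
have uP (s : R) : 0 <= s <= 1 -> is_derive s 1 (fun s => Phi s y - Phi s x)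
    (X (Phi s y) - X (Phi s x)).
  by move=> s01; apply: is_deriveB;
    [exact: (flow_ode PhiF Wy s01)|exact: (flow_ode PhiF Wx s01)].
have mJ (s : R) (u : 'rV[R]_n) : 0 <= s <= 1 -> `|u *m J (Phi s x)| <= n%:R * B * `|u|.
  move=> s01; apply: le_trans (mulmx_norm _ _) _; rewrite -mulrA mulrC [leRHS]mulrC.
  apply: ler_wpM2r => //; rewrite mulrC; apply: ler_wpM2r => //; exact: JB.
have yd1 (s : R) : 0 <= s <= 1 -> `|Phi s y - Phi s x| <= d1.
  by move=> /yd /le_trans; apply; rewrite ge_min lexx.
have yd2 (s : R) : 0 <= s <= 1 -> `|Phi s y - Phi s x| <= d2.
  by move=> /yd /le_trans; apply; rewrite ge_min lexx orbT.
have u_le (s : R) : 0 <= s <= 1 -> `|Phi s y - Phi s x| <= 2 * (`|h| * `|v|) * E.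
  move=> s01.
  have := @gronwall _ _ _ (fun s => Phi s y - Phi s x)
    (fun s => X (Phi s y) - X (Phi s x)) L 0 (`|h| * `|v|) L0 (lexx _) uP.
  rewrite addr0; apply => //; last first.
    by rewrite !(flow0 PhiF) // addrK normrZ.
  move=> r r01; rewrite addr0.
  rewrite -(subrK ((Phi r y - Phi r x) *m J (Phi r x)) (X (Phi r y) - X (Phi r x))).
  apply: le_trans (ler_normD _ _) _; rewrite addrC /L mulrDl; apply: lerD.
    exact: mJ.
  by apply: rem1 => //; exact: yd1.
have u2P (s : R) : 0 <= s <= 1 -> is_derive s 1 (fun s => Phi s y - Phi s x - h *: w s)
    (X (Phi s y) - X (Phi s x) - h *: (w s *m J (Phi s x))).
  by move=> s01; apply: is_deriveB; [exact: uP|apply: is_deriveZ; exact: wd].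
have eta0 : 0 <= e / K * (2 * (`|h| * `|v|) * E).
  apply: mulr_ge0; [exact: ltW|]; apply: mulr_ge0; last exact: ltW.
  by rewrite !mulr_ge0.
have u2_le : `|Phi t y - Phi t x - h *: w t| <=
    (2 * 0 + e / K * (2 * (`|h| * `|v|) * E)) * E.
  apply: (@gronwall _ _ _ (fun s => Phi s y - Phi s x - h *: w s)
    (fun s => X (Phi s y) - X (Phi s x) - h *: (w s *m J (Phi s x))) L _ 0) => //.
    move=> r r01.
    have -> : X (Phi r y) - X (Phi r x) - h *: (w r *m J (Phi r x)) =
        (X (Phi r y) - X (Phi r x) - (Phi r y - Phi r x) *m J (Phi r x)) +
        (Phi r y - Phi r x - h *: w r) *m J (Phi r x).
      by rewrite scalemxAl [(_ - h *: w r) *m _]mulmxBl addrA subrK.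
    apply: le_trans (ler_normD _ _) _; rewrite addrC; apply: lerD.
      apply: le_trans (mJ _ _ r01) _; rewrite /L mulrDl lerDl mul1r.
      exact: normr_ge0.
    apply: le_trans (rem2 _ _ r01 (yd2 _ r01)) _.
    by apply: ler_wpM2l; [exact: ltW|exact: u_le].
  by rewrite !(flow0 PhiF) // w0 addrK subrr normr0.
have -> : w t - h^-1 *: (Phi t y - Phi t x) =
    - (h^-1 *: (Phi t y - Phi t x - h *: w t)).
  move: (Phi t y - Phi t x) => A.
  by rewrite -[RHS]scalerN opprB scalerBr scalerA mulVf // scale1r.
rewrite normrN normrZ normfV ler_pdivrMl ?normr_gt0 //.
apply: le_trans u2_le _; rewrite mulr0 add0r.
rewrite (_ : _ * E = `|h| * (e * ((2 * `|v| * E * E) / K))); last by field; rewrite gt_eqF.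
apply: ler_wpM2l => //; rewrite ler_piMr ?(ltW e0) // ler_pdivrMr // mul1r.
by rewrite /K lerDl.
Qed.

(** The derivatives of a flow form again a flow, with the same time interval and
    over the same initial points; this is the step of the induction which gives
    smoothness.  Equicontinuity in the second component compares two variational
    equations with nearby coefficients. *)
Theorem flow_tangent : exists DPhi : R -> 'rV[R]_n -> 'rV[R]_n -> 'rV[R]_n,
  (forall x v (t : R), W x -> 0 <= t <= 1 -> is_derive x v (Phi t) (DPhi t x v)) /\
  is_flow (lsubmx @^-1` U) (lsubmx @^-1` W) (tangent_field X)
    (fun t z => row_mx (Phi t (lsubmx z)) (DPhi t (lsubmx z) (rsubmx z))).
Proof.
have /choice[w wP] : forall xv : 'rV[R]_n * 'rV[R]_n,
    exists w : R -> 'rV[R]_n, W xv.1 -> w 0 = xv.2 /\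
    forall t : R, 0 <= t <= 1 -> is_derive t 1 w (w t *m J (Phi t xv.1)).
  move=> [x v] /=; have [Wx|nWx] := pselect (W x); last by exists (fun=> 0).
  by have [w wP] := linearized_flow_exists v Wx; exists w.
exists (fun t x v => w (x, v) t); split=> [x v t Wx t01|].
  by have [w0 wd] := wP (x, v) Wx; exact: (flow_is_derive Wx w0 wd).
split.
- move=> z /= Wz; have [-> _] := wP (lsubmx z, rsubmx z) Wz.
  by rewrite (flow0 PhiF Wz) hsubmxK.
- by move=> z t /= Wz t01; rewrite row_mxKl; exact: flow_in PhiF _ _ Wz t01.
- move=> z t /= Wz t01; have [_ wd] := wP (lsubmx z, rsubmx z) Wz.
  rewrite /tangent_field row_mxKl row_mxKr.
  apply/is_derive_mxP => i j; rewrite -(splitK j).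
  case: (fintype.split j) => l /=; rewrite ?row_mxEl ?row_mxEr.
    under eq_fun do rewrite row_mxEl.
    by have /is_derive_mxP := flow_ode PhiF Wz t01; exact.
  under eq_fun do rewrite row_mxEr.
  by have /is_derive_mxP := wd t t01; exact.
move=> z e /= Wz e0; set x := lsubmx z in Wz *; set v := rsubmx z.
have [_ wd] := wP (x, v) Wz.
have [B B0 JB] := curve_bounded (fun t t01 => JPhic Wz t01).
have [C C0 wC] := curve_bounded (fun t t01 => is_derive_cont (wd t t01)).
set L := n%:R * (B + 1); have L0 : 0 <= L by rewrite mulr_ge0 // addr_ge0.
set E := expR (2 * (L + 1)); have E0 : 0 < E by exact: expR_gt0.
set K := n%:R * C * E + 1.
have K0 : 0 < K by rewrite ltr_wpDl // !mulr_ge0 // ltW.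
set e' := Num.min 1 (e / (2 * K)).
have e'0 : 0 < e' by rewrite lt_min ltr01 /= divr_gt0 // mulr_gt0.
have [d d0 Jd] := J_tube Wz e'0.
have lz : lsubmx y @[y --> z] --> x by exact: continuous_lsubmx.
have rz : rsubmx y @[y --> z] --> v by exact: continuous_rsubmx.
have Wn : \forall y \near z, W (lsubmx y).
  by apply: lz; exact: open_nbhs_nbhs.
set m := Num.min d e; have m0 : 0 < m by rewrite lt_min d0.
have dn : \forall y \near z, forall t : R, 0 <= t <= 1 ->
    `|Phi t (lsubmx y) - Phi t x| <= m.
  exact: (lz _ (flow_equicontinuous PhiF Wz m0)).
have vn : \forall y \near z, `|v - rsubmx y| <= e / (4 * E).
  have e4 : 0 < e / (4 * E) by rewrite divr_gt0 // mulr_gt0.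
  by move/cvgrPdist_le : rz => /(_ _ e4).
apply: filterS3 Wn dn vn => y Wy yd vy t t01.
set x' := lsubmx y in Wy yd *; set v' := rsubmx y in vy *.
have [w'0 w'd] := wP (x', v') Wy; have [w0 _] := wP (x, v) Wz.
rewrite opp_row_mx add_row_mx.
have JJ (s : R) : 0 <= s <= 1 -> `|J (Phi s x') - J (Phi s x)| <= e'.
  move=> s01; apply: Jd => //; apply: le_trans (yd s s01) _.
  by rewrite ge_min lexx.
have JB' (s : R) : 0 <= s <= 1 -> `|J (Phi s x')| <= B + 1.
  move=> s01; rewrite -(subrK (J (Phi s x)) (J (Phi s x'))) addrC.
  apply: le_trans (ler_normD _ _) _; apply: lerD; first exact: JB.
  by apply: le_trans (JJ s s01) _; rewrite ge_min lexx.
have w_le : `|w (x', v') t - w (x, v) t| <=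
    (2 * (e / (4 * E)) + n%:R * (C * e')) * E.
  apply: (@gronwall _ _ _ (fun s => w (x', v') s - w (x, v) s)
    (fun s => w (x', v') s *m J (Phi s x') - w (x, v) s *m J (Phi s x)) L) => //.
  - by rewrite !mulr_ge0 // ltW.
  - by move=> s s01; apply: is_deriveB; [exact: w'd|exact: wd].
  - move=> s s01.
    have -> : w (x', v') s *m J (Phi s x') - w (x, v) s *m J (Phi s x) =
      (w (x', v') s - w (x, v) s) *m J (Phi s x') +
      w (x, v) s *m (J (Phi s x') - J (Phi s x)).
      by rewrite mulmxBl mulmxBr addrA subrK.
    apply: le_trans (ler_normD _ _) _; apply: lerD.
      apply: le_trans (mulmx_norm _ _) _; rewrite /L -mulrA.
      apply: ler_wpM2l => //; rewrite mulrC; apply: ler_wpM2r => //; exact: JB'.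
    apply: le_trans (mulmx_norm _ _) _.
    by apply: ler_wpM2l => //; apply: ler_pM => //; [exact: wC|exact: JJ].
  by rewrite w0 w'0 /= distrC.
apply: mx_norm_leP; first exact: ltW.
move=> i j; rewrite -(splitK j); case: (fintype.split j) => l /=.
  rewrite row_mxEl; apply: le_trans (mx_norm_entry _ _ _) _.
  by apply: le_trans (yd t t01) _; rewrite ge_min lexx orbT.
rewrite row_mxEr; apply: le_trans (mx_norm_entry _ _ _) _.
apply: le_trans w_le _; rewrite mulrDl.
have -> : 2 * (e / (4 * E)) * E = e / 2 by field; rewrite gt_eqF.
rewrite [leRHS](splitr e); apply: lerD => //.
have -> : n%:R * (C * e') * E = n%:R * C * E * e' by ring.
apply: (@le_trans _ _ (K * (e / (2 * K)))).
  apply: ler_pM; rewrite ?mulr_ge0 ?(ltW E0) ?(ltW e'0) //.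
    by rewrite /K lerDl.
  by rewrite /e' ge_min lexx orbT.
by rewrite le_eqVlt; apply/orP; left; apply/eqP; field; rewrite gt_eqF.
Qed.

End FlowDerivative.

Lemma flow_continuous n (U W : set 'rV[R]_n) X Phi (t : R) x :
  is_flow U W X Phi -> 0 <= t <= 1 -> W x -> {for x, continuous (Phi t)}.
Proof.
move=> PhiF t01 Wx; apply: continuous_dist => e e0; near=> y.
suff : forall s : R, 0 <= s <= 1 -> `|Phi s y - Phi s x| <= e.
  by move=> /(_ t t01).
by near: y; exact: (flow_equicontinuous PhiF Wx e0).
Unshelve. all: by end_near. Qed.

(** Every derivative of a flow is a component of an iterated tangent flow, which
    is a flow on the same time interval; so regularity is gained one order at a
    time, without shrinking the domain. *)
Theorem flow_smooth n (U W : set 'rV[R]_n) X Phi t :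
  open U -> open W -> smooth_on U X -> is_flow U W X Phi -> 0 <= t <= 1 ->
  smooth_on W (Phi t).
Proof.
move=> + + + + t01 k; elim: k n U W X Phi => [|k IH] n U W X Phi oU oW XC PhiF.
  by split; last by []; move=> x; exact: flow_continuous PhiF t01.
split; first by move=> x; exact: flow_continuous PhiF t01.
move=> v; have [DPhi [PhiD DF]] := flow_tangent oU oW XC PhiF.
split; first by move=> x Wx; have [] := PhiD x v t Wx t01.
have TX : smooth_on (lsubmx @^-1` U) (tangent_field X).
  move=> l; have oU' := @open_lsubmx R n n U oU.
  apply: classC_row_mx => //; first exact: classC_comp_lsubmx.
  apply: classC_mulmx => //.
    by apply: classC_rsubmx => //; exact: classC_id.
  by apply: classC_comp_lsubmx => //; exact: classC_jacobian (XC l.+1).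
have := IH _ _ _ _ _ (open_lsubmx oU) (open_lsubmx oW) TX DF.
set TPhi := (fun z => _) => TC.
have TC' : classC k W (TPhi \o (fun x => row_mx x v)).
  apply: (classC_comp oW (open_lsubmx oW)) TC => //.
    by move=> x Wx /=; rewrite row_mxKl.
  by apply: classC_row_mx => //; [exact: classC_id|exact: classC_cst].
apply: eq_classC (classC_rsubmx oW TC') => // x Wx.
rewrite /= row_mxKr row_mxKl row_mxKr.
by rewrite (@derive_val _ _ _ _ _ _ _ (PhiD x v t Wx t01)).
Qed.

End Flow.

(** * The local flow of a vector field *)

Section LocalFlow.
Context {R : realType}.

Definition last_coord n (z : 'rV[R]_(n + 1)) : R := rsubmx z 0 0.

Lemma last_coord_row_mx n (x : 'rV[R]_n) (s : 'rV[R]_1) :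
  last_coord (row_mx x s) = s 0 0.
Proof. by rewrite /last_coord row_mxKr. Qed.

Lemma classC_last_coord (V : normedModType R) n k (U : set V)
    (f : V -> 'rV[R]_(n + 1)) : open U ->
  classC k U f -> classC k U (fun x => last_coord (f x)).
Proof.
by move=> oU /(classC_rsubmx oU) /classC_mxP; exact.
Qed.

Definition cylinder n (x0 : 'rV[R]_n) (e : R) : set 'rV[R]_(n + 1) :=
  [set z | ball x0 e (lsubmx z) /\ `|last_coord z| < e].

Lemma open_cylinder n (x0 : 'rV[R]_n) e : 0 < e -> open (cylinder x0 e).
Proof.
move=> e0.
have -> : cylinder x0 e = (lsubmx @^-1` ball x0 e) `&` (@last_coord n @^-1` ball 0 e).
  apply/seteqP; split=> z [ze se]; split => //.
    by rewrite /= -ball_normE /= sub0r normrN.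
  by move: se; rewrite /= -ball_normE /= sub0r normrN.
apply: openI; first by apply: open_lsubmx; exact: ball_open.
apply: open_comp; last exact: ball_open.
move=> z _; have /classC_last_coord := @classC_id R 'rV[R]_(n + 1) 0 setT.
by move=> /(_ openT) H; exact: classC_continuous H I.
Qed.

Lemma lipschitz_near n p q (U : set 'rV[R]_n) (f : 'rV[R]_n -> 'M[R]_(p, q)) x :
  open U -> classC 1 U f -> U x ->
  exists d L, [/\ 0 < d, 0 <= L, ball x d `<=` U &
    forall y z, ball x d y -> ball x d z -> `|f y - f z| <= L * `|y - z|].
Proof.
move=> oU fC Ux; have [d d0 dP] := strict_differentiable oU fC Ux ltr01.
have [fd _] := classC1_differentiable_mx oU fC Ux.
have [k k0 kP] := linear_lipschitz (diff_continuous fd).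
exists d, (1 + k); split=> //; first by rewrite addr_ge0 // ltW.
  by move=> y xy; exact: (dP y y xy xy).1.
move=> y z xy xz; have xx : ball x d x by exact: ballxx.
have := (dP y z xy xz).2 x xx; rewrite (deriveE _ fd) => H.
rewrite -(subrK ('d f x (y - z)) (f y - f z)); apply: le_trans (ler_normD _ _) _.
by rewrite mulrDl; apply: lerD H (kP _).
Qed.

(** Near a point the vector field is replaced by its composition with the
    retraction on a small ball, which is globally Lipschitz and has the same
    integral curves for a short time.  To differentiate the flow in time as
    well, the flow of s X(x) on the pairs (x, s) is used at time 1. *)
Theorem local_flow n (U : set 'rV[R]_n) (X : 'rV[R]_n -> 'rV[R]_n) x0 :
  open U -> smooth_on U X -> U x0 ->
  exists (e : R) (phi : 'rV[R]_(n + 1) -> 'rV[R]_n),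
    [/\ 0 < e, smooth_on (cylinder x0 e) phi,
        forall z, cylinder x0 e z -> U (phi z),
        forall x, phi (row_mx x 0) = x &
        forall z, cylinder x0 e z -> 'D_(row_mx 0 1%:M) phi z = X (phi z)].
Proof.
move=> oU XC Ux0.
have [d [L [d0 L0 dU XL]]] := lipschitz_near oU (XC 1%N) Ux0.
set r := d / 2; have r0 : 0 < r by rewrite divr_gt0.
have rd : r < d by rewrite /r; lra.
have inr x : `|x - x0| <= r -> ball x0 d x.
  by move=> xr; rewrite -ball_normE /= distrC (le_lt_trans xr).
pose Xc x := X (clamp_row x0 r x).
have XcL x y : `|Xc x - Xc y| <= L * `|x - y|.
  apply: le_trans (XL _ _ _ _) _; try by apply/inr/clamp_row_in/ltW.
  by apply: ler_wpM2l => //; exact: clamp_row_lipschitz.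
set B := `|X x0| + L * r.
have B0 : 0 <= B by rewrite addr_ge0 // mulr_ge0 // ltW.
have XcB x : `|Xc x| <= B.
  rewrite -(subrK (X x0) (Xc x)) addrC; apply: le_trans (ler_normD _ _) _.
  apply: lerD => //; have xx : ball x0 d x0 by exact: ballxx.
  apply: le_trans (XL _ _ _ xx) _; first by apply/inr/clamp_row_in/ltW.
  by apply: ler_wpM2l => //; apply: clamp_row_in; exact: ltW.
have /choice[f fP] : forall v, exists w : R -> 'rV[R]_n, w 0 = v /\
    forall t : R, `|t| <= 1 -> is_derive t 1 w (Xc (w t)).
  move=> v; apply: (@picard R n (fun=> Xc) L v) => // w wc t.
  apply: (@continuous_comp _ _ _ w Xc); first exact: wc.
  by apply: lipschitz_continuous L0 _ _; exact: XcL.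
have fB x (s t : R) : `|s| <= 1 -> `|t| <= 1 -> `|f x t - f x s| <= B * `|t - s|.
  have main a b : a <= b -> `|a| <= 1 -> `|b| <= 1 -> `|f x b - f x a| <= B * (b - a).
    move=> ab a1 b1; have inab (c : R) : a <= c <= b -> `|c| <= 1.
      move: a1 b1; rewrite !ler_norml => /andP[a1 _] /andP[_ b1] /andP[ac cb].
      by rewrite (le_trans a1 ac) (le_trans cb b1).
    have := @mean_value_cst _ _ _ (f x) (fun t => Xc (f x t)) 0 B a b ab.
    rewrite scaler0 subr0; apply.
      by move=> c /inab; have [_] := fP x; exact.
    by move=> c _; rewrite subr0.
  move=> s1 t1; case: (leP s t) => st.
    by rewrite (ger0_norm (_ : 0 <= t - s)) ?subr_ge0 //; exact: main.
  rewrite distrC (distrC t) (ger0_norm (_ : 0 <= s - t)) ?subr_ge0 ?(ltW st) //.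
  by apply: main => //; exact: ltW.
(* B bounds the speed, so that for this e the curves which start within e of x0
   stay within r of it during the time e. *)
set e := Num.min 1 (r / (2 * (B + 1))).
have B1 : 0 < B + 1 by rewrite ltr_wpDl.
have e0 : 0 < e by rewrite lt_min ltr01 /= divr_gt0 // mulr_gt0.
have e1 : e <= 1 by rewrite ge_min lexx.
have eB : e * (2 * (B + 1)) <= r.
  by rewrite -ler_pdivlMr ?mulr_gt0 // ge_min lexx orbT.
have fr x t : ball x0 e x -> `|t| <= e -> `|f x t - x0| <= r.
  rewrite -ball_normE /= => xe te.
  rewrite -(subrK x (f x t)) -addrA; apply: le_trans (ler_normD _ _) _.
  have [f0 _] := fP x; rewrite -[X in `|_ - X| + _]f0.
  have := fB x 0 t; rewrite normr0 subr0 => /(_ ler01 (le_trans te e1)) H.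
  have H2 : `|x - x0| <= e by rewrite distrC ltW.
  have H3 : B * `|t| <= B * e by exact: ler_wpM2l.
  apply: le_trans (lerD (le_trans H H3) H2) _.
  have Be : 0 <= B * e by rewrite mulr_ge0 // ltW.
  by move: Be eB e0; lra.
have fU x t : ball x0 e x -> `|t| <= e -> U (f x t).
  by move=> xe te; apply: dU; apply: inr; exact: fr.
have fd x (t : R) : ball x0 e x -> `|t| <= e -> is_derive t 1 (f x) (X (f x t)).
  move=> xe te; have [_ /(_ t (le_trans te e1))] := fP x.
  by rewrite /Xc clamp_row_id //; exact: fr.
have oC := @open_cylinder n x0 e e0.
pose phi (z : 'rV[R]_(n + 1)) := f (lsubmx z) (last_coord z).
pose Phi (t : R) (z : 'rV[R]_(n + 1)) : 'rV[R]_(n + 1) :=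
  row_mx (f (lsubmx z) (t * last_coord z)) (rsubmx z).
pose Xs (z : 'rV[R]_(n + 1)) : 'rV[R]_(n + 1) :=
  row_mx (last_coord z *: X (lsubmx z)) 0.
have ts (t s : R) : 0 <= t <= 1 -> `|s| < e -> `|t * s| <= e.
  move=> /andP[t0 t1] se; rewrite normrM (ger0_norm t0).
  by apply: le_trans (ltW se); rewrite ler_piMl.
have XsC : smooth_on ((lsubmx : 'rV_(n + 1) -> 'rV_n) @^-1` U) Xs.
  move=> k; have oU' := @open_lsubmx R n 1 U oU.
  apply: classC_row_mx => //; last exact: classC_cst.
  apply: classC_scalemx => //; last exact: classC_comp_lsubmx.
  by apply: classC_last_coord => //; exact: classC_id.
have PhiF : is_flow ((lsubmx : 'rV_(n + 1) -> 'rV_n) @^-1` U) (cylinder x0 e) Xs Phi.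
  split.
  - by move=> z _; rewrite /Phi mul0r (fP _).1 hsubmxK.
  - by move=> z t [ze se] t01; rewrite /Phi /= row_mxKl; apply: fU => //; exact: ts.
  - move=> z t [ze se] t01; rewrite /Xs /Phi row_mxKl last_coord_row_mx.
    apply/is_derive_mxP => i j; rewrite -(splitK j).
    case: (fintype.split j) => l /=; rewrite ?row_mxEl ?row_mxEr.
      under eq_fun do rewrite row_mxEl mulrC.
      have := is_derive_comp_scale (fd _ (last_coord z * t) ze _).
      rewrite mulrC => /(_ (ts _ _ t01 se)) /is_derive_mxP; exact.
    under eq_fun do rewrite row_mxEr.
    by rewrite [X in is_derive _ _ _ X]mxE; exact: is_derive_cst.
  move=> z a [ze se] a0.
  set E := expR (2 * (L + 1)); have E0 : 0 < E by exact: expR_gt0.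
  set K := 2 * E + B + 1; have K0 : 0 < K by rewrite ltr_wpDl // addr_ge0 // mulr_ge0 // ltW.
  have aK : 0 < a / K by rewrite divr_gt0.
  have cyl : \forall y \near z, cylinder x0 e y.
    by apply: open_nbhs_nbhs; split; [exact: open_cylinder|].
  have yn : \forall y \near z, `|z - y| <= a / K.
    by have /cvgrPdist_le := @cvg_id _ (nbhs z); exact.
  apply: filterS2 cyl yn => y [ye sy] yz t t01.
  have xy : `|lsubmx y - lsubmx z| <= a / K.
    apply: mx_norm_leP => [|i j]; first exact: ltW.
    rewrite -raddfB mxE; apply: le_trans (mx_norm_entry _ _ _) _.
    by rewrite distrC.
  have st : `|last_coord y - last_coord z| <= a / K.
    rewrite /last_coord.
    have := mx_norm_entry (z - y) 0 (rshift n 0); rewrite !mxE distrC.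
    by move=> /le_trans; apply.
  rewrite /Phi opp_row_mx add_row_mx; set x := lsubmx z in ze xy *.
  set x' := lsubmx y in ye xy *.
  have H1 : `|f x' (t * last_coord y) - f x (t * last_coord y)| <= 2 * (a / K) * E.
    have := @gronwall _ _ _ (fun t => f x' (t * last_coord y) - f x (t * last_coord y))
      (fun t => last_coord y *: (X (f x' (t * last_coord y))) -
                last_coord y *: (X (f x (t * last_coord y)))) L 0 (a / K) L0 (lexx _).
    rewrite addr0; apply => //; last by rewrite mul0r !(fP _).1.
      move=> s s01; apply: is_deriveB; under eq_fun do rewrite mulrC;
        rewrite [s * _]mulrC; apply: is_derive_comp_scale; apply: fd => //;
        by rewrite mulrC; exact: ts.
    move=> s s01; rewrite addr0 -scalerBr normrZ.
    apply: (@le_trans _ _ (1 * (L * `|f x' (s * last_coord y) - f x (s * last_coord y)|))).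
      apply: ler_pM => //; first exact: le_trans (ltW sy) e1.
      by apply: XL; apply: inr; apply: fr => //; exact: ts.
    by rewrite mul1r.
  have H2 : `|f x (t * last_coord y) - f x (t * last_coord z)| <= B * (a / K).
    apply: le_trans (fB _ _ _ _ _) _; try by apply: le_trans e1; exact: ts.
    apply: ler_wpM2l => //; rewrite -mulrBr normrM.
    have /andP[t0 t1] := t01; rewrite (ger0_norm t0).
    by apply: le_trans st; rewrite ler_piMl.
  have aKE : K * (a / K) = a by rewrite mulrC divfK // gt_eqF.
  apply: mx_norm_leP => [|i j]; first exact: ltW.
  rewrite -(splitK j); case: (fintype.split j) => l /=.
    rewrite row_mxEl; apply: le_trans (mx_norm_entry _ _ _) _.
    rewrite -(subrK (f x (t * last_coord y)) (f x' _)) -addrA.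
    apply: le_trans (ler_normD _ _) _; apply: le_trans (lerD H1 H2) _.
    by rewrite -[leRHS]aKE /K; move: aK; set q := a / _; nra.
  rewrite row_mxEr; apply: le_trans (_ : a / K <= a).
    by rewrite (ord1 l) (ord1 i); apply: le_trans st; rewrite /last_coord !mxE.
  by rewrite ler_pdivrMr // ler_peMr ?(ltW a0) // /K lerDr addr_ge0 // mulr_ge0 // ltW.
have phiC : smooth_on (cylinder x0 e) phi.
  move=> k; have t11 : 0 <= (1 : R) <= 1 by rewrite ler01 lexx.
  have := flow_smooth (open_lsubmx oU) oC XsC PhiF t11 k.
  move=> /(classC_lsubmx oC).
  apply: eq_classC; first exact: oC.
  by move=> z _; rewrite /Phi row_mxKl mul1r.
exists e, phi; split=> //.
- by move=> z [ze se]; apply: fU => //; exact: ltW.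
- by move=> x; rewrite /phi row_mxKl last_coord_row_mx mxE (fP _).1.
move=> z [ze se].
have fz := fd _ _ ze (ltW se).
rewrite -(@derive_val _ _ _ _ _ _ _ fz) /derive.
suff -> : (fun h : R => h^-1 *: ((phi \o shift z) (h *: row_mx 0 1%:M) - phi z)) =
  (fun h : R => h^-1 *: ((f (lsubmx z) \o shift (last_coord z)) (h *: 1) -
     f (lsubmx z) (last_coord z))) by [].
apply/funext => h /=; rewrite /phi; congr (_ *: (f _ _ - _)).
  by rewrite !raddfD /= scale_row_mx row_mxKl scaler0 add0r.
by rewrite /last_coord !raddfD /= scale_row_mx row_mxKr !mxE.
Qed.

End LocalFlow.

(** * Potentials of closed 1-forms *)

Section ProductRule.
Context {R : realType} (V : normedModType R).

Lemma is_derive_mulmx m n p (f : V -> 'M[R]_(m, n)) (g : V -> 'M[R]_(n, p))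
    x v df dg : is_derive x v f df -> is_derive x v g dg ->
  is_derive x v (fun y => f y *m g y) (df *m g x + f x *m dg).
Proof.
move=> /is_derive_mxP fd /is_derive_mxP gd; apply/is_derive_mxP => i j.
have -> : (fun y => (f y *m g y) i j) =
    \sum_l (fun y => f y i l) * (fun y => g y l j).
  by apply/funext => y; rewrite mxE fct_sumE.
apply: is_derive_eq.
rewrite !mxE -big_split; apply: eq_bigr => l _ /=.
by rewrite addrC; congr (_ + _); rewrite /GRing.scale /= mulrC.
Qed.

Lemma is_derive_scalemx m n (c : V -> R) (f : V -> 'M[R]_(m, n))
    x v dc df : is_derive x v c dc -> is_derive x v f df ->
  is_derive x v (fun y => c y *: f y) (dc *: f x + c x *: df).
Proof.
move=> cd /is_derive_mxP fd; apply/is_derive_mxP => i j.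
have -> : (fun y => (c y *: f y) i j) = c * (fun y => f y i j).
  by apply/funext => y; rewrite mxE.
have fij := fd i j; apply: is_derive_eq.
by rewrite !mxE addrC; congr (_ + _); rewrite /GRing.scale /= mulrC.
Qed.

Lemma is_derive_of_bound (W : normedModType R) (f : V -> W) x v l :
  (forall e, 0 < e -> \forall h \near (0 : R)^',
     `|f (h *: v + x) - f x - h *: l| <= e * `|h|) ->
  is_derive x v f l.
Proof.
move=> fl.
suff H : (fun h : R => h^-1 *: ((f \o shift x) (h *: v) - f x)) @ 0^' --> l.
  apply: DeriveDef; first by apply/cvg_ex; exists l.
  exact: cvg_lim H.
apply/cvgrPdist_le => e e0; have := fl e e0.
have hn : \forall h \near (0 : R)^', h != 0 by exact: nbhs_dnbhs_neq.
apply: filterS2 hn => h h0 H /=; rewrite -[f (h *: v + x) - f x](subrK (h *: l)).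
rewrite scalerDr scalerA mulVf // scale1r opprD addrCA subrr addr0 normrN.
by rewrite normrZ normfV ler_pdivrMl ?normr_gt0 // mulrC.
Qed.

End ProductRule.

Section Poincare.
Context {R : realType}.
Variables (n : nat) (b : 'rV[R]_n -> 'cV[R]_n) (x0 : 'rV[R]_n) (r : R).
Hypotheses (r0 : 0 < r) (bC : smooth_on (ball x0 r) b)
  (b_closed : forall x, ball x0 r x ->
     forall u v, v *m 'D_u b x = u *m 'D_v b x).

Let B := ball x0 r.
Let oB : open B. Proof. exact: ball_open. Qed.

Let ray (z : 'rV[R]_(n + 1)) : 'rV[R]_n :=
  x0 + last_coord z *: (lsubmx z - x0).
(** At z = (x, s), the integrand b(x0 + s (x - x0)) applied to x - x0, and its
    derivative along v in the variable x. *)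
Let k (z : 'rV[R]_(n + 1)) : 'M[R]_1 := (lsubmx z - x0) *m b (ray z).
Let dk v (z : 'rV[R]_(n + 1)) : 'M[R]_1 :=
  v *m b (ray z) + last_coord z *: ((lsubmx z - x0) *m 'D_v b (ray z)).
Let pt x (s : R) : 'rV[R]_(n + 1) := row_mx x s%:M.

Let ptl x s : lsubmx (pt x s) = x. Proof. exact: row_mxKl. Qed.
Let ptr x s : last_coord (pt x s) = s.
Proof. by rewrite last_coord_row_mx mxE eqxx. Qed.

Let lsubC l (O : set 'rV[R]_(n + 1)) : open O ->
  classC l O (fun z => lsubmx z - x0).
Proof.
move=> oO; apply: (@classC_add _ _ _ _ _ lsubmx (fun=> - x0)) => //.
  by apply: classC_lsubmx => //; exact: classC_id.
exact: classC_cst.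
Qed.

Let rayC l O : open O -> classC l O ray.
Proof.
move=> oO; apply: (@classC_add _ _ _ _ _ (fun=> x0)
  (fun z => last_coord z *: (lsubmx z - x0))) => //; first exact: classC_cst.
apply: classC_scalemx => //; last exact: lsubC.
by apply: classC_last_coord => //; exact: classC_id.
Qed.

Let O := ray @^-1` B.
Let oO : open O.
Proof.
apply: open_comp oB => z _.
by apply: classC_continuous (rayC 0 openT) _.
Qed.

Let kC l : classC l O k.
Proof.
apply: (classC_mulmx oO); first exact: lsubC.
by apply: (classC_comp oO oB) (bC l) => //; exact: rayC.
Qed.

Let dkC l v : classC l O (dk v).
Proof.
apply: (classC_add oO).
  apply: (classC_mulmx oO); first exact: classC_cst.
  by apply: (classC_comp oO oB) (bC l) => //; exact: rayC.
apply: (classC_scalemx oO).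
  by apply: (classC_last_coord oO); exact: classC_id.
apply: (classC_mulmx oO); first exact: lsubC.
apply: (classC_comp oO oB (g := 'D_v b)) => //; first exact: rayC.
exact: classC_derive (bC l.+1).
Qed.

Let inO x s : B x -> 0 <= s <= 1 -> O (pt x s).
Proof.
by move=> Bx s01; rewrite /O /= /ray ptl ptr; apply: ball_segment => //; exact: ballxx.
Qed.

Let pt_continuous (f : 'rV[R]_n) : continuous (pt f).
Proof.
move=> s; have : classC 0 setT (pt f).
  apply: classC_row_mx; [exact: openT|exact: classC_cst|].
  apply/classC_mxP; first exact: openT.
  move=> i j; apply: eq_classC (@classC_id _ R 0 setT); first exact: openT.
  by move=> t _; rewrite !ord1 mxE eqxx mulr1n.
by move=> H; exact: classC_continuous H I.
Qed.

Let k_derive x v s : B x -> 0 <= s <= 1 ->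
  is_derive x v (fun y => k (pt y s)) (dk v (pt x s)).
Proof.
move=> Bx s01; have := inO Bx s01; rewrite /O /= /dk /ray ptl ptr => Oxs.
have e : (fun y => k (pt y s)) = (fun y => (y - x0) *m b (x0 + s *: (y - x0))).
  by apply/funext => y; rewrite /k /ray ptl ptr.
rewrite e scalemxAr.
have d1 : is_derive x v (fun y : 'rV[R]_n => y - x0) v.
  by rewrite -[v in is_derive _ _ _ v]subr0; apply: is_deriveB.
apply: is_derive_mulmx => //.
have d2 : is_derive x v (fun y : 'rV[R]_n => x0 + s *: (y - x0)) (s *: v).
  rewrite -[s *: v]add0r; apply: is_deriveD; exact: is_deriveZ.
have [dd dE] := d2.
have bd := classC_differentiable oB (bC 1%N) Oxs.
have [cd cE] := derive_comp (f := fun y => x0 + s *: (y - x0)) (g := b) dd bd.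
by apply: DeriveDef; [exact: cd|rewrite cE dE !(deriveE _ bd) linearZ].
Qed.

(** A potential of a closed form is its integral along the rays; closedness
    turns the derivative of the integrand in a direction v into the derivative
    along the ray of s b(v). *)
Theorem poincare : exists f : 'rV[R]_n -> 'M[R]_1,
  [/\ f x0 = 0, smooth_on (ball x0 r) f &
      forall x v, ball x0 r x -> 'D_v f x = v *m b x].
Proof.
have /choice[P PP] : forall x, exists P : R -> 'M[R]_1, B x -> P 0 = 0 /\
    forall s : R, 0 <= s <= 1 -> is_derive s 1 P (k (pt x s)).
  move=> x; have [Bx|] := pselect (B x); last by exists (fun=> 0).
  have [|P [P0 Pd]] := @primitive_mx R _ _ (fun s => k (pt x (clamp 0 1 s))).
    move=> s; apply: (@continuous_comp _ _ _ (clamp 0 1) (fun s => k (pt x s))).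
      exact: clamp_continuous.
    apply: (@continuous_comp _ _ _ (pt x) k); first exact: pt_continuous.
    by apply: classC_continuous (kC 0) _; apply: inO => //; exact: clamp_in.
  exists P => _; split=> // s s01; have := Pd s; rewrite clamp_id //; apply.
  by case/andP: s01 => s0 s1; rewrite ger0_norm // (le_lt_trans s1) // ltr1n.
pose f x := P x 1.
have fd x v : B x -> is_derive x v f (v *m b x).
  move=> Bx; apply: is_derive_of_bound => e e0.
  have [d d0 dP] : exists2 d, 0 < d & forall (s : R) y, 0 <= s <= 1 ->
      `|y - pt x s| <= d -> O y /\ `|dk v y - dk v (pt x s)| <= e.
    apply: (@curve_tube _ _ (pt x) (fun y z => O y /\ `|dk v y - dk v z| <= e)).
      by move=> s _; exact: pt_continuous.
    move=> s s01; have e2 : 0 < e / 2 by rewrite divr_gt0.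
    have Os := inO Bx s01.
    have N1 : \forall y \near pt x s, O y by exact: open_nbhs_nbhs.
    have N2 : \forall y \near pt x s, `|dk v (pt x s) - dk v y| <= e / 2.
      by have /cvgrPdist_le := classC_continuous (dkC 0 v) Os; exact.
    have /nbhs_ballP[d /= d0 dP] : \forall y \near pt x s,
        O y /\ `|dk v (pt x s) - dk v y| <= e / 2 by exact: filterI N1 N2.
    exists d => // y z yd zd; have [Oy H1] := dP y yd; have [_ H2] := dP z zd.
    split=> //; rewrite -(subrK (dk v (pt x s)) (dk v y)) -addrA.
    apply: le_trans (ler_normD _ _) _; rewrite (splitr e).
    by apply: lerD; [rewrite distrC; exact: H1|exact: H2].
  have Bn : \forall h \near (0 : R)^', forall q : R, `|q| <= `|h| ->
      B (x + q *: v) /\ `|q *: v| <= d.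
    have /nbhs_ballP[d' /= d'0 d'P] : \forall y \near x, B y by exact: open_nbhs_nbhs.
    have v1 : 0 < `|v| + 1 by rewrite ltr_wpDl.
    set m := Num.min d d' / (`|v| + 1).
    have m0 : 0 < m by rewrite divr_gt0 // lt_min d0.
    have : \forall h \near (0 : R)^', `|h| < m by exact: dnbhs0_lt.
    apply: filterS => h hm q qh.
    have qm : `|q *: v| < Num.min d d'.
      apply: (@le_lt_trans _ _ (`|h| * (`|v| + 1))).
        by rewrite normrZ; apply: ler_pM => //; rewrite lerDl.
      by rewrite -ltr_pdivlMr.
    split; last by rewrite ltW // (lt_le_trans qm) // ge_min lexx.
    apply: d'P; rewrite -ball_normE /= opprD addrA subrr sub0r normrN.
    by rewrite (lt_le_trans qm) // ge_min lexx orbT.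
  apply: filterS Bn => h hP.
  have [Bxh _] := hP h (lexx _); rewrite addrC in Bxh.
  set y := h *: v + x in Bxh *.
  have [Px0 Pxd] := PP x Bx; have [Py0 Pyd] := PP y Bxh.
  pose u (s : R) := P y s - P x s - h *: (s *: (v *m b (x0 + s *: (x - x0)))).
  pose du (s : R) := k (pt y s) - k (pt x s) - h *: dk v (pt x s).
  have ud (s : R) : 0 <= s <= 1 -> is_derive s 1 u (du s).
    move=> s01; apply: is_deriveB.
      by apply: is_deriveB; [exact: Pyd|exact: Pxd].
    apply: is_deriveZ.
    have Bs := inO Bx s01; rewrite /O /= /ray ptl ptr in Bs.
    rewrite /dk /ray ptl ptr -[X in is_derive _ _ _ (X + _)]scale1r.
    rewrite (b_closed Bs).
    apply: is_derive_scalemx.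
    rewrite -[X in is_derive _ _ _ X]add0r.
    rewrite -[X in is_derive _ _ _ (X + _)](mul0mx _ (b (x0 + s *: (x - x0)))).
    apply: is_derive_mulmx.
    apply: is_derive_line.
    exact: classC_derivable (bC 1%N) Bs.
  have := @mean_value_cst _ _ _ u du 0 (e * `|h|) 0 1 ler01 ud.
  rewrite subr0 scaler0 subr0 mulr1 {1}/u !scale1r [x0 + _]addrC subrK.
  rewrite /u Px0 Py0 scale0r scaler0 !subr0; apply.
  move=> s s01; rewrite subr0 /du.
  have := @mean_value_line _ _ _ _ (fun z => k (pt z s)) x v h (dk v (pt x s)) e.
  rewrite [x + _]addrC; apply => q qh; have [Bq qd] := hP q qh.
  have [kd kE] := k_derive v Bq s01; split=> //; rewrite kE.
  apply: (dP s _ s01 _).2.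
  rewrite opp_row_mx add_row_mx subrr addrC addrA addNr add0r.
  apply: le_trans qd; apply: mx_norm_leP => // i j; rewrite -(splitK j).
  case: (fintype.split j) => l /=; first by rewrite row_mxEl; exact: mx_norm_entry.
  by rewrite row_mxEr mxE normr0.
have fc x : B x -> {for x, continuous f}.
  move=> Bx; apply: continuous_dist => e e0.
  have N1 : \forall y \near x, B y by exact: open_nbhs_nbhs.
  have N2 : \forall y \near x, `|b x - b y| <= 1.
    by have /cvgrPdist_le := classC_continuous (bC 0%N) Bx; exact.
  have /nbhs_ballP[d /= d0 dP] : \forall y \near x, B y /\ `|b x - b y| <= 1.
    exact: filterI N1 N2.
  set K := n%:R * (`|b x| + 1) + 1.
  have K0 : 0 < K by rewrite ltr_wpDl // mulr_ge0 // addr_ge0.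
  apply/nbhs_ballP; exists (Num.min d (e / K)); first by rewrite /= lt_min d0 divr_gt0.
  move=> y; rewrite -ball_normE /= lt_min => /andP[yd ye].
  have := @mean_value_line _ _ _ _ f x (y - x) 1 0 (K * `|y - x|).
  rewrite scaler0 subr0 scale1r [x + _]addrC subrK normr1 mulr1 => H.
  apply: le_trans (H _) _; last by rewrite mulrC -ler_pdivlMr // distrC ltW.
  move=> q q1; have qd : ball x d (x + q *: (y - x)).
    rewrite -ball_normE /= opprD addrA subrr sub0r normrN normrZ.
    by apply: le_lt_trans yd; rewrite distrC ler_piMl.
  have [Bq bq] := dP _ qd; have [fqd fqE] := fd _ (y - x) Bq.
  split=> //; rewrite fqE subr0; apply: le_trans (mulmx_norm _ _) _.
  rewrite [`|y - x| * _]mulrC mulrA; apply: ler_wpM2r => //.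
  apply: (@le_trans _ _ (n%:R * (`|b x| + 1))); last by rewrite lerDl.
  apply: ler_wpM2l => //.
  rewrite -(subrK (b x) (b _)) addrC; apply: le_trans (ler_normD _ _) _.
  by apply: lerD; [exact: lexx|rewrite distrC; exact: bq].
exists f; split.
- have Bx0 : B x0 by exact: ballxx.
  have [P0 Pd] := PP x0 Bx0; rewrite /f.
  have H : forall s : R, 0 <= s <= 1 -> `|k (pt x0 s) - 0| <= 0.
    by move=> s _; rewrite /k ptl subrr mul0mx subr0 normr0.
  have := @mean_value_cst _ _ _ (P x0) (fun s => k (pt x0 s)) 0 0 0 1 ler01 Pd H.
  by rewrite P0 scaler0 !subr0 mul0r normr_le0 => /eqP.
- have dC l (v : 'rV[R]_n) : classC l (ball x0 r) (fun x => v *m b x).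
    by apply: classC_mulmx => //; exact: classC_cst.
  case=> [|l]; split; first exact: fc.
  + by [].
  + exact: fc.
  move=> v; split; first by move=> x Bx; have [] := fd x v Bx.
  apply: (@eq_classC _ _ _ _ _ (fun x => v *m b x) _ oB _ (dC l v)) => x Bx.
  by rewrite (@derive_val _ _ _ _ _ _ _ (fd x v Bx)).
- by move=> x v Bx; rewrite (@derive_val _ _ _ _ _ _ _ (fd x v Bx)).
Qed.

End Poincare.

(** * The inverse function theorem *)

Section InverseFunction.
Context {R : realType}.

(** Once normalized by the inverse of its derivative at z0, the map E differs
    from the identity by a contraction of ratio 1/2. *)
Let strict_inverse n (U : set 'rV[R]_n) (E : 'rV[R]_n -> 'rV[R]_n) z0 :
  open U -> classC 1 U E -> U z0 -> jacobian E z0 \in unitmx ->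
  exists2 d, 0 < d & ball z0 d `<=` U /\
    forall y z, ball z0 d y -> ball z0 d z ->
    `|(E y - E z) *m invmx (jacobian E z0) - (y - z)| <= 2^-1 * `|y - z|.
Proof.
move=> oU EC Uz0 Ju; set T := invmx _.
set K := n%:R * `|T| + 1.
have K0 : 0 < K by rewrite ltr_wpDl // mulr_ge0.
have e0 : 0 < 2^-1 / K by rewrite divr_gt0.
have [d d0 dP] := strict_differentiable oU EC Uz0 e0.
exists d => //; split=> [y yd|y z yd zd]; first exact: (dP y y yd yd).1.
have xx : ball z0 d z0 by exact: ballxx.
have := (dP y z yd zd).2 z0 xx; rewrite (classC_deriveE _ oU EC Uz0) => H.
have -> : (E y - E z) *m T - (y - z) =
    (E y - E z - (y - z) *m jacobian E z0) *m T.
  by rewrite [RHS]mulmxBl -mulmxA mulmxV // mulmx1.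
apply: le_trans (mulmx_norm _ _) _.
apply: (@le_trans _ _ (n%:R * `|T| * (2^-1 / K * `|y - z|))).
  by rewrite -mulrA [`|T| * _]mulrC; apply: ler_wpM2l => //; exact: ler_wpM2r.
rewrite mulrA; apply: ler_wpM2r => //.
rewrite mulrCA ler_piMr // ler_pdivrMr // mul1r.
by rewrite /K lerDl.
Qed.

(** The equation E(y) = w is solved by the Newton iteration with the derivative
    kept at z0; the inverse is differentiable because E is, and then smooth by
    its own differential equation. *)
Theorem inverse_function n (U : set 'rV[R]_n) (E : 'rV[R]_n -> 'rV[R]_n) z0 :
  open U -> smooth_on U E -> U z0 -> jacobian E z0 \in unitmx ->
  exists (e : R) (kappa : 'rV[R]_n -> 'rV[R]_n),
    [/\ 0 < e, ball z0 e `<=` U,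
        forall z, ball z0 e z -> kappa (E z) = z /\ jacobian E z \in unitmx,
        open (E @` ball z0 e) & smooth_on (E @` ball z0 e) kappa].
Proof.
move=> oU EC Uz0 Ju.
have [d d0 [dU dP]] := strict_inverse oU (EC 1%N) Uz0 Ju.
set A := jacobian E z0 in Ju *; set T := invmx A in dP *.
have JC := classC_jacobian oU (EC 1%N).
have [d1 d10 d1P] : exists2 d1, 0 < d1 &
    forall z, ball z0 d1 z -> jacobian E z \in unitmx.
  have dC := classC_continuous (classC_det oU JC) Uz0.
  have : \forall z \near z0, \det (jacobian E z) != 0.
    move/cvgr_neq0 : dC => dC; apply: dC; by rewrite -unitfE -unitmxE.
  move=> /nbhs_ballP[d1 /= d10 d1P]; exists d1; first exact: d10.
  move=> z zd.
  rewrite unitmxE unitfE; exact: d1P zd.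
set e := Num.min d d1; have e0 : 0 < e by rewrite lt_min d0.
have ed z : ball z0 e z -> ball z0 d z by apply: le_ball; rewrite ge_min lexx.
have ed1 z : ball z0 e z -> ball z0 d1 z.
  by apply: le_ball; rewrite ge_min lexx orbT.
pose C := 2 * (n%:R * `|T|).
have C0 : 0 <= C by rewrite !mulr_ge0.
have expand y z : ball z0 d y -> ball z0 d z -> `|y - z| <= C * `|E y - E z|.
  move=> yd zd; have H := dP y z yd zd.
  have H1 : `|(E y - E z) *m T| <= n%:R * `|T| * `|E y - E z|.
    by apply: le_trans (mulmx_norm _ _) _; rewrite mulrCA [leRHS]mulrC mulrA.
  have : `|y - z| <= `|(E y - E z) *m T| + `|(E y - E z) *m T - (y - z)|.
    rewrite -{1}(subrK ((E y - E z) *m T) (y - z)) addrC distrC.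
    by apply: le_trans (ler_normD _ _) _; rewrite distrC.
  by rewrite /C; move: H H1; lra.
have Einj y z : ball z0 d y -> ball z0 d z -> E y = E z -> y = z.
  move=> yd zd Eyz; have := expand y z yd zd.
  by rewrite Eyz subrr normr0 mulr0 normr_le0 subr_eq0 => /eqP.
have Ec z : ball z0 d z -> {for z, continuous E}.
  by move=> /dU; exact: classC_continuous (EC 0%N).
have Eopen : open (E @` ball z0 e).
  rewrite openE => _ [z ze <-].
  have [q /= q0 qe] : nbhs_ball z (ball z0 e).
    by apply/nbhs_ballP; apply: open_nbhs_nbhs; split=> //; exact: ball_open.
  (* The steps of the iteration are at most c / 2^k, so that the iterates stay
     within 2 c < q of z. *)
  pose c := q / 4; have c0 : 0 < c by rewrite divr_gt0.
  have T1 : 0 < n%:R * `|T| + 1 by rewrite ltr_wpDl // mulr_ge0.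
  apply/nbhs_ballP; exists (c / (n%:R * `|T| + 1)); first by rewrite /= divr_gt0.
  move=> w wEb; have wE : `|E z - w| < c / (n%:R * `|T| + 1).
    by move: wEb; rewrite -ball_normE.
  pose u := fix u k := if k is k'.+1 then u k' + (w - E (u k')) *m T else z.
  have wT : `|(w - E z) *m T| <= c.
    apply: le_trans (mulmx_norm _ _) _.
    apply: (@le_trans _ _ ((n%:R * `|T| + 1) * (c / (n%:R * `|T| + 1)))).
      rewrite [`|_| * _]mulrC mulrA distrC; apply: ler_pM; rewrite ?mulr_ge0 //.
        by rewrite lerDl.
      exact: ltW.
    by rewrite mulrC divfK // gt_eqF.
  have uP k : `|u k - z| <= 2 * c * (1 - 2^-1 ^+ k) /\
      `|u k.+1 - u k| <= c * 2^-1 ^+ k.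
    have inq k' : `|u k' - z| <= 2 * c * (1 - 2^-1 ^+ k') -> ball z0 d (u k').
      move=> H; apply/ed/qe; rewrite -ball_normE /= distrC.
      apply: le_lt_trans H _; apply: (@le_lt_trans _ _ (2 * c)).
        apply: ler_piMr; first by apply: mulr_ge0 => //; exact: ltW.
        by rewrite lerBlDr lerDl exprn_ge0.
      by rewrite /c; lra.
    elim: k => [|k [IH1 IH2]].
      rewrite expr0 subrr normr0 mulr1 subrr mulr0; split=> //.
      by rewrite /= addrAC subrr add0r.
    have H1 : `|u k.+1 - z| <= 2 * c * (1 - 2^-1 ^+ k.+1).
      rewrite -(subrK (u k) (u k.+1)) -addrA; apply: le_trans (ler_normD _ _) _.
      apply: le_trans (lerD IH2 IH1) _; rewrite exprS le_eqVlt.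
      by apply/orP; left; apply/eqP; field.
    split=> //; have := dP _ _ (inq _ H1) (inq _ IH1).
    have -> : u k.+2 - u k.+1 = - ((E (u k.+1) - E (u k)) *m T - (u k.+1 - u k)).
      rewrite -/(u k.+1) /= -/(u k.+1) addrAC subrr add0r.
      have -> : u k + (w - E (u k)) *m T - u k = (w - E (u k)) *m T.
        by rewrite addrAC subrr add0r.
      rewrite -mulmxBl -mulNmx; congr (_ *m T).
      by rewrite opprB opprB addrA subrK.
    rewrite normrN => /le_trans; apply; rewrite exprS mulrCA.
    by apply: ler_wpM2l.
  have [l lP] := geometric_cvg (fun k => (uP k).2).
  have lz : ball z q l.
    rewrite -ball_normE /= distrC; have := lP 0%N; rewrite /= expr0 mulr1.
    by move/le_lt_trans; apply; rewrite /c; lra.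
  exists l; first exact: (qe _ lz).
  have ul : u k @[k --> \oo] --> l.
    apply/cvgrPdist_le => a a0.
    have /cvgr_le /(_ a a0) := @cvg_half_expr R (2 * c); apply: filterS => m Hm.
    exact: le_trans (lP m) Hm.
  have Eul : E (u k) @[k --> \oo] --> E l.
    by apply: (@cvg_comp _ _ _ u E) ul _; apply: Ec; apply/ed/qe.
  apply/esym/eqP; rewrite -subr_eq0; apply/eqP.
  suff /(congr1 (mulmx^~ A)) : (w - E l) *m T = 0.
    by rewrite -mulmxA mulVmx // mulmx1 mul0mx.
  pose M := n%:R * `|T|.
  apply/eqP; rewrite -normr_le0; apply/ler_addgt0Pr => a a0; rewrite add0r.
  have a2 : 0 < a / 2 by rewrite divr_gt0.
  have aM : 0 < a / 2 / (M + 1) by rewrite divr_gt0.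
  have N1 : \forall k \near \oo, `|E l - E (u k)| <= a / 2 / (M + 1).
    by move/cvgrPdist_le : Eul; exact.
  have N2 : \forall k \near \oo, c * 2^-1 ^+ k <= a / 2.
    by have /cvgr_le := @cvg_half_expr R c; exact.
  have [k [H1 H2]] := filter_ex (filterI N1 N2).
  have -> : (w - E l) *m T = (w - E (u k)) *m T - (E l - E (u k)) *m T.
    by rewrite -mulmxBl opprB addrA subrK.
  apply: le_trans (ler_normB _ _) _; rewrite (splitr a); apply: lerD.
    have := (uP k).2; rewrite /= addrAC subrr add0r => H; exact: le_trans H H2.
  apply: le_trans (mulmx_norm _ _) _.
  apply: (@le_trans _ _ ((M + 1) * (a / 2 / (M + 1)))).
    rewrite [`|_| * _]mulrC mulrA; apply: ler_pM; rewrite ?mulr_ge0 //.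
    by rewrite lerDl.
  by rewrite mulrC divfK // gt_eqF.
have /choice[kappa kP] : forall w, exists z, (E @` ball z0 e) w ->
    ball z0 e z /\ E z = w.
  move=> w; have [[z ze Ez]|] := pselect ((E @` ball z0 e) w); first by exists z.
  by exists 0.
have kE z : ball z0 e z -> kappa (E z) = z.
  move=> ze; have [] := kP (E z); first by exists z.
  by move=> ke; apply: Einj; exact: ed.
exists e, kappa; split; [exact: e0| | |exact: Eopen|].
- by move=> z /ed /dU.
- by move=> z ze; split; [exact: kE|apply/d1P/ed1].
have kc w : (E @` ball z0 e) w -> {for w, continuous kappa}.
  move=> Ww; apply: continuous_dist => a a0.
  have N1 : \forall w' \near w, (E @` ball z0 e) w' by exact: open_nbhs_nbhs.
  have C1 : 0 < C + 1 by rewrite ltr_wpDl.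
  have aC : 0 < a / (C + 1) by rewrite divr_gt0.
  have N2 : \forall w' \near w, `|w - w'| <= a / (C + 1).
    by have /cvgrPdist_le := @cvg_id _ (nbhs w); exact.
  apply: filterS2 N1 N2 => w' Ww' ww'.
  have [ke kw] := kP w Ww; have [ke' kw'] := kP w' Ww'.
  apply: le_trans (expand _ _ (ed _ ke') (ed _ ke)) _; rewrite kw kw' distrC.
  apply: (@le_trans _ _ ((C + 1) * (a / (C + 1)))).
    by apply: ler_pM => //; rewrite lerDl.
  by rewrite mulrC divfK // gt_eqF.
pose G v z := v *m invmx (jacobian E z) : 'rV[R]_n.
apply: (@smooth_bootstrap R _ n _ (ball z0 e) kappa G) => //.
- exact: ball_open.
- by move=> w /kP[].
- move=> v k; apply: classC_mulmx; [exact: ball_open|exact: classC_cst|].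
  apply: classC_invmx; first exact: ball_open.
    by move=> z ze; apply/d1P/ed1.
  by apply: sub_classC (classC_jacobian oU (EC k.+1)) => z /ed /dU.
move=> v w Ww; have [ke kw] := kP w Ww; set z := kappa w in ke kw *.
have Jzu : jacobian E z \in unitmx by apply/d1P/ed1.
set Ti := invmx (jacobian E z).
suff [kd dE] : differentiable kappa w /\
    'd kappa w = mulmxr Ti :> ('rV[R]_n -> 'rV[R]_n).
  by split; [exact: diff_derivable|rewrite (deriveE _ kd) dE].
have Tc : continuous (mulmxr Ti : 'rV[R]_n -> 'rV[R]_n).
  apply: (@lipschitz_continuous R _ _ _ (n%:R * `|Ti|)); first by rewrite mulr_ge0.
  move=> x y; rewrite /= -mulmxBl; apply: le_trans (mulmx_norm _ _) _.
  by rewrite mulrCA [leRHS]mulrC mulrA.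
apply: (differentiable_eps Tc) => a a0.
set K := n%:R * `|Ti| * C + 1.
have K0 : 0 < K by rewrite ltr_wpDl // !mulr_ge0.
have aK : 0 < a / K by rewrite divr_gt0.
have [q q0 qP] := strict_differentiable oU (EC 1%N) (dU z (ed z ke)) aK.
have zz : ball z q z by exact: ballxx.
have sh : (u + w : 'rV[R]_n) @[u --> (0 : 'rV[R]_n)] --> w.
  have : {for 0, continuous (fun u : 'rV[R]_n => u + w)}.
    by apply: continuousD; [exact: cvg_id|exact: cst_continuous].
  by rewrite /prop_for /continuous_at add0r.
have N1 : \forall u \near (0 : 'rV[R]_n), (E @` ball z0 e) (u + w).
  exact: (sh _ (open_nbhs_nbhs (conj Eopen Ww))).
have N2 : \forall u \near (0 : 'rV[R]_n), ball z q (kappa (u + w)).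
  have kw' : kappa y @[y --> w] --> z by exact: kc.
  have zq : nbhs z (ball z q) by exact: nbhsx_ballx.
  exact: (sh _ (kw' _ zq)).
apply: filterS2 N1 N2 => u Wu kq.
have [ke' kw'] := kP _ Wu; set y := kappa (u + w) in ke' kw' kq *.
have := (qP y z kq zz).2 z zz.
rewrite (classC_deriveE _ oU (EC 1%N) (dU z (ed z ke))) kw kw' addrK => H.
have -> : y - z - mulmxr Ti u = - ((u - (y - z) *m jacobian E z) *m Ti).
  by rewrite mulmxBl -mulmxA mulmxV // mulmx1 opprB.
rewrite normrN; apply: le_trans (mulmx_norm _ _) _.
have yz : `|y - z| <= C * `|u|.
  by have := expand y z (ed _ ke') (ed _ ke); rewrite kw kw' addrK.
apply: (@le_trans _ _ (n%:R * (a / K * (C * `|u|) * `|Ti|))).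
  apply: ler_wpM2l => //; apply: ler_wpM2r => //; apply: le_trans H _.
  by apply: ler_wpM2l => //; exact: ltW.
rewrite (_ : n%:R * _ = a * (n%:R * `|Ti| * C / K) * `|u|); last first.
  by field; rewrite gt_eqF.
apply: ler_wpM2r => //; rewrite ler_piMr ?(ltW a0) // ler_pdivrMr // mul1r.
by rewrite /K lerDl.
Qed.

End InverseFunction.

(** * Exterior and Lie derivatives in coordinates *)

Section JacobianRules.
Context {R : realType}.

Lemma jacobian_rowE m n (f : 'rV[R]_m -> 'rV[R]_n) x (A : 'M[R]_(m, n)) :
  differentiable f x -> (forall v, 'D_v f x = v *m A) -> jacobian f x = A.
Proof.
move=> fd fA; apply/row_matrixP => i.
by rewrite !rowE -(deriveEjacobian _ fd) fA.
Qed.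

Lemma jacobian_comp m n p (f : 'rV[R]_m -> 'rV[R]_n) (g : 'rV[R]_n -> 'rV[R]_p)
    x : differentiable f x -> differentiable g (f x) ->
  jacobian (g \o f) x = jacobian f x *m jacobian g (f x).
Proof.
move=> fd gd; apply: jacobian_rowE; first exact: differentiable_comp.
move=> v; have [_ ->] := derive_comp (diff_derivable (v := v) fd) gd.
by rewrite !deriveEjacobian // mulmxA.
Qed.

Lemma jacobian_near_eq m n (f g : 'rV[R]_m -> 'rV[R]_n) x :
  {near x, f =1 g} -> differentiable f x -> differentiable g x ->
  jacobian f x = jacobian g x.
Proof.
move=> fg fd gd; apply: jacobian_rowE => // v.
by rewrite (near_eq_derive _ fg) deriveEjacobian.
Qed.

Lemma classC_is_derive (V : normedModType R) (W : normedModType R) k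
    (U : set V) (f : V -> W) x v :
  classC k.+1 U f -> U x -> is_derive x v f ('D_v f x).
Proof. by move=> fC Ux; apply: derivableP; exact: classC_derivable fC Ux. Qed.

Lemma derive_near_eq (V W : normedModType R) (U : set V) (f g : V -> W) x v :
  open U -> U x -> (forall y, U y -> f y = g y) -> 'D_v f x = 'D_v g x.
Proof.
move=> oU Ux fg; apply: near_eq_derive.
by apply: filterS (open_nbhs_nbhs (conj oU Ux)) => y; exact: fg.
Qed.

(** Contracting the Jacobian with a fixed vector turns the symmetry of second
    derivatives into a statement about the Jacobian. *)
Lemma derive_jacobian_sym m n (U : set 'rV[R]_m) (f : 'rV[R]_m -> 'rV[R]_n)
    x u v :
  open U -> classC 2 U f -> U x ->
  v *m 'D_u (jacobian f) x = u *m 'D_v (jacobian f) x.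
Proof.
move=> oU fC Ux.
have key w w' : w *m 'D_w' (jacobian f) x = 'D_w' ('D_w f) x.
  have Jd := classC_is_derive w' (classC_jacobian oU fC) Ux.
  have := is_derive_mulmx (is_derive_cst w x w') Jd.
  rewrite mul0mx add0r => H; rewrite -(@derive_val _ _ _ _ _ _ _ H).
  apply: (derive_near_eq _ oU Ux) => y Uy.
  by rewrite (classC_deriveE _ oU fC Uy).
by rewrite !key; exact: derive_sym oU fC Ux.
Qed.

End JacobianRules.

Section Naturality.
Context {R : realType}.

Lemma bil_inj n (A B : 'M[R]_n) : (forall u v, bil A u v = bil B u v) -> A = B.
Proof.
move=> AB; apply/matrixP => i j; have := AB (delta_mx 0 i) (delta_mx 0 j).
have E (C : 'M[R]_n) : bil C (delta_mx 0 i) (delta_mx 0 j) = C i j.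
  by rewrite /bil -rowE trmx_delta -colE !mxE.
by rewrite !E.
Qed.

Lemma mx11_trE (A : 'M[R]_1) : A^T = A.
Proof. by apply/matrixP => i j; rewrite !ord1 mxE. Qed.

Definition ext_d_coord n (a : 'rV[R]_n -> 'cV[R]_n) (x : 'rV[R]_n) : 'M[R]_n :=
  \matrix_(i, j) (2^-1 * ('D_(delta_mx 0 i) (fun y => a y j 0 : R) x -
                          'D_(delta_mx 0 j) (fun y => a y i 0 : R) x)).

(** The coordinate-free formula for the exterior derivative, on constant
    fields. *)
Lemma bil_ext_d_coord n k (U : set 'rV[R]_n) (a : 'rV[R]_n -> 'cV[R]_n) x u v :
  open U -> classC k.+1 U a -> U x ->
  bil (ext_d_coord a x) u v = 2^-1 * (v *m 'D_u a x - u *m 'D_v a x) 0 0.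
Proof.
move=> oU aC Ux.
have aT : classC k.+1 U (fun y => (a y)^T) by exact: classC_trmx.
set A := jacobian (fun y => (a y)^T) x.
have dT w : ('D_w a x)^T = w *m A.
  rewrite -(classC_deriveE _ oU aT Ux); apply/rowP => j.
  rewrite mxE !derive_mxE; [|exact: classC_derivable aT Ux|exact: classC_derivable aC Ux].
  by congr ('D_w _ x); apply/funext => y; rewrite mxE.
clearbody A.
have dE i j : 'D_(delta_mx 0 i) (fun y => a y j 0) x = A i j.
  rewrite -derive_mxE; last exact: classC_derivable aC Ux.
  by have := congr1 (fun M : 'rV[R]_n => M 0 j) (dT (delta_mx 0 i)); rewrite -rowE !mxE.
have -> : ext_d_coord a x = 2^-1 *: (A - A^T).
  by apply/matrixP => i j; rewrite !mxE !dE.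
rewrite /bil -scalemxAr -scalemxAl mxE; congr (_ * _).
rewrite mulmxBr mulmxBl -[v *m _]mx11_trE trmx_mul dT.
by rewrite -(trmxK ('D_v a x)) dT trmx_mul mulmxA.
Qed.

(** The derivatives of the Jacobian cancel by symmetry. *)
Lemma ext_d_coord_pullback m n (U : set 'rV[R]_m) (V : set 'rV[R]_n)
    (psi : 'rV[R]_m -> 'rV[R]_n) (a : 'rV[R]_n -> 'cV[R]_n)
    (b : 'rV[R]_m -> 'cV[R]_m) x :
  open U -> open V -> (forall y, U y -> V (psi y)) ->
  smooth_on U psi -> smooth_on V a ->
  (forall y, U y -> b y = jacobian psi y *m a (psi y)) -> U x ->
  ext_d_coord b x =
  jacobian psi x *m ext_d_coord a (psi x) *m (jacobian psi x)^T.
Proof.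
move=> oU oV UV psiC aC bE Ux; have Vx := UV x Ux.
have apC k : classC k U (a \o psi) by exact: (classC_comp oU oV UV (psiC k) (aC k)).
have bC : classC 1 U b.
  have JaC : classC 1 U (fun y => jacobian psi y *m (a \o psi) y).
    apply: (classC_mulmx oU); last exact: apC.
    exact: classC_jacobian oU (psiC 2%N).
  by apply: eq_classC oU _ JaC => y Uy; rewrite bE.
have bd w : 'D_w b x = 'D_w (jacobian psi) x *m a (psi x) +
    jacobian psi x *m 'D_(w *m jacobian psi x) a (psi x).
  apply: etrans (derive_near_eq w oU Ux bE) _.
  have Jd := classC_is_derive w (classC_jacobian oU (psiC 2%N)) Ux.
  have ad := classC_is_derive w (apC 1%N) Ux.
  have H := is_derive_mulmx Jd ad.
  apply: etrans (@derive_val _ _ _ _ _ _ _ H) _; congr (_ + _ *m _).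
  have [_ ->] := derive_comp (classC_derivable (v := w) (psiC 1%N) Ux)
    (classC_differentiable oV (aC 1%N) Vx).
  by rewrite (classC_deriveE _ oU (psiC 1%N) Ux).
apply: bil_inj => u v.
rewrite (bil_ext_d_coord _ _ oU bC Ux) !bd.
have -> : bil (jacobian psi x *m ext_d_coord a (psi x) *m (jacobian psi x)^T) u v =
    bil (ext_d_coord a (psi x)) (u *m jacobian psi x) (v *m jacobian psi x).
  by rewrite /bil trmx_mul !mulmxA.
rewrite (bil_ext_d_coord _ _ oV (aC 1%N) Vx); congr (_ * _ 0 0).
rewrite !mulmxDr !mulmxA (derive_jacobian_sym u v oU (psiC 2%N) Ux).
by rewrite opprD addrACA subrr add0r.
Qed.

Definition lie_coord n (X : 'rV[R]_n -> 'rV[R]_n) (G : 'rV[R]_n -> 'M[R]_n)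
    (x : 'rV[R]_n) : 'M[R]_n :=
  'D_(X x) G x + jacobian X x *m G x + G x *m (jacobian X x)^T.

(** Differentiating the relation between Y and X exchanges the derivative of the
    Jacobian along Y with the Jacobians of the two fields; this compensates the
    derivatives of the Jacobian in the pulled back tensor. *)
Lemma lie_coord_pullback m n (U : set 'rV[R]_m) (V : set 'rV[R]_n)
    (psi : 'rV[R]_m -> 'rV[R]_n) (X : 'rV[R]_n -> 'rV[R]_n)
    (Y : 'rV[R]_m -> 'rV[R]_m) (G : 'rV[R]_n -> 'M[R]_n)
    (H : 'rV[R]_m -> 'M[R]_m) x :
  open U -> open V -> (forall y, U y -> V (psi y)) ->
  smooth_on U psi -> smooth_on V X -> smooth_on U Y -> smooth_on V G ->
  (forall y, U y -> Y y *m jacobian psi y = X (psi y)) ->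
  (forall y, U y -> H y = jacobian psi y *m G (psi y) *m (jacobian psi y)^T) ->
  U x ->
  lie_coord Y H x =
  jacobian psi x *m lie_coord X G (psi x) *m (jacobian psi x)^T.
Proof.
move=> oU oV UV psiC XC YC GC YX HG Ux; have Vx := UV x Ux.
set J := jacobian psi.
have JC : classC 1 U J by exact: classC_jacobian oU (psiC 2%N).
have GpC : classC 1 U (G \o psi) by exact: (classC_comp oU oV UV (psiC 1%N) (GC 1%N)).
have JTC : classC 1 U (fun y => (J y)^T) by exact: classC_trmx.
set w := Y x; have wJ : w *m J x = X (psi x) by exact: YX.
have dJT : 'D_w (fun y => (J y)^T) x = ('D_w J x)^T.
  apply/matrixP => i j; rewrite mxE !derive_mxE;
    [|exact: classC_derivable JC Ux|exact: classC_derivable JTC Ux].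
  by congr ('D_w _ x); apply/funext => y; rewrite mxE.
have Hd : 'D_w H x = 'D_w J x *m G (psi x) *m (J x)^T +
    J x *m 'D_(X (psi x)) G (psi x) *m (J x)^T +
    J x *m G (psi x) *m ('D_w J x)^T.
  have dG : 'D_w (G \o psi) x = 'D_(X (psi x)) G (psi x).
    have [_ ->] := derive_comp (classC_derivable (v := w) (psiC 1%N) Ux)
      (classC_differentiable oV (GC 1%N) Vx).
    by rewrite (classC_deriveE _ oU (psiC 1%N) Ux) wJ.
  have d1 := is_derive_mulmx (classC_is_derive w JC Ux) (classC_is_derive w GpC Ux).
  have d2 := is_derive_mulmx d1 (classC_is_derive w JTC Ux).
  have e1 := @derive_near_eq R _ _ U H
    (fun y => J y *m (G \o psi) y *m (J y)^T) x w oU Ux HG.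
  apply: etrans e1 _; apply: etrans (@derive_val _ _ _ _ _ _ _ d2) _.
  by rewrite dJT dG mulmxDl.
have rel : 'D_w J x + jacobian Y x *m J x = J x *m jacobian X (psi x).
  apply/row_matrixP => i; rewrite !rowE; set u := delta_mx 0 i.
  have d1 := is_derive_mulmx (classC_is_derive u (YC 1%N) Ux) (classC_is_derive u JC Ux).
  have e1 := @derive_near_eq R _ _ U (fun y => Y y *m J y) (X \o psi) x u oU Ux YX.
  have [_ e2] := derive_comp (classC_derivable (v := u) (psiC 1%N) Ux)
    (classC_differentiable oV (XC 1%N) Vx).
  have E := etrans (esym (@derive_val _ _ _ _ _ _ _ d1)) (etrans e1 e2).
  rewrite (classC_deriveE _ oV (XC 1%N) Vx) in E.
  rewrite (classC_deriveE _ oU (YC 1%N) Ux) (classC_deriveE _ oU (psiC 1%N) Ux) in E.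
  have S : Y x *m 'D_u J x = u *m 'D_w J x.
    exact: derive_jacobian_sym oU (psiC 2%N) Ux.
  rewrite S in E.
  by rewrite mulmxDr !mulmxA addrC; exact: E.
rewrite /lie_coord Hd HG // -/J -/w.
have relT := congr1 trmx rel; rewrite linearD /= !trmx_mul in relT.
rewrite !mulmxDr !mulmxDl.
have -> : J x *m (jacobian X (psi x) *m G (psi x)) *m (J x)^T =
    'D_w J x *m G (psi x) *m (J x)^T + jacobian Y x *m (J x *m G (psi x) *m (J x)^T).
  by rewrite mulmxA -rel !mulmxDl !mulmxA.
have -> : J x *m (G (psi x) *m (jacobian X (psi x))^T) *m (J x)^T =
    J x *m G (psi x) *m ('D_w J x)^T + J x *m G (psi x) *m (J x)^T *m (jacobian Y x)^T.
  by rewrite -[LHS]mulmxA -[X in J x *m X]mulmxA -relT !mulmxDr !mulmxA.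
rewrite -!addrA addrCA; congr (_ + _); congr (_ + _).
by rewrite addrCA.
Qed.

End Naturality.

(** * Charts of the maximal atlas *)

Lemma classC_local {R : realType} (V W : normedModType R) k (U : set V)
    (f : V -> W) :
  (forall x, U x -> exists O, [/\ open O, O x & classC k O f]) -> classC k U f.
Proof.
elim: k f => [|k IH] f H.
  split; last by [].
  by move=> x /H[N [_ Ox fC]]; exact: classC_continuous fC Ox.
split; first by move=> x /H[N [_ Ox fC]]; exact: classC_continuous fC Ox.
move=> v; split; first by move=> x /H[N [_ Ox fC]]; exact: classC_derivable fC Ox.
apply: IH => x /H[N [oO Ox fC]]; exists N; split; [exact: oO|exact: Ox|].
exact: classC_derive fC.
Qed.

Section Charts.
Context {R : realType} {n : nat} {M : manifold R n}.
Implicit Types c : chart R n M.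

Definition overlap c c' : set 'rV[R]_n := cmap c @` (cdom c `&` cdom c').

Definition smooth_trans c c' : Prop :=
  smooth_on (overlap c c') (cmap c' \o cinv c).

(** Charts which belong to the maximal atlas. *)
Definition compat_chart c : Prop :=
  forall c', atlas c' -> smooth_trans c c' /\ smooth_trans c' c.

Lemma atlas_compat_chart c : atlas c -> compat_chart c.
Proof.
move=> ac c' ac'; split; first exact: atlas_compat ac ac'.
exact: atlas_compat ac' ac.
Qed.

Lemma chart_img_open c (A : set M) : open A -> open (cmap c @` (cdom c `&` A)).
Proof.
move=> oA.
have E : cmap c @` (cdom c `&` A) = cmap c @` cdom c `&` cinv c @^-1` A.
  apply/seteqP; split=> [_ [p [cp Ap] <-]|_ [[p cp <-]] /= Ap].
    by split; [exists p | rewrite /= cmapK].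
  by exists p => //; split=> //; rewrite cmapK in Ap.
rewrite openE E => x [cx Ax]; apply: filterI.
  by apply: open_nbhs_nbhs; split=> //; exact: cimg_open.
by apply: (cinv_cont cx); exact: open_nbhs_nbhs.
Qed.

Lemma open_overlap c c' : open (overlap c c').
Proof. by apply: chart_img_open; exact: cdom_open. Qed.

Lemma mem_overlap c c' p : cdom c p -> cdom c' p -> overlap c c' (cmap c p).
Proof. by move=> cp c'p; exists p. Qed.

Lemma overlap_img c c' y : overlap c c' y ->
  (cmap c' @` cdom c') ((cmap c' \o cinv c) y).
Proof. by move=> [p [cp c'p] <-] /=; rewrite cmapK //; exists p. Qed.

Lemma smooth_trans_refl c : smooth_trans c c.
Proof.
move=> k; apply: (eq_classC (@open_overlap c c)) (classC_id _ _).
by move=> _ [p [cp _] <-] /=; rewrite cmapK.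
Qed.

Lemma smooth_trans_differentiable c c' p : smooth_trans c c' ->
  cdom c p -> cdom c' p -> differentiable (cmap c' \o cinv c) (cmap c p).
Proof.
move=> s cp c'p.
exact: classC_differentiable (@open_overlap c c') (s 1%N) (mem_overlap cp c'p).
Qed.

(** The chain rule for the transition maps, on the intersection of the three
    domains. *)
Lemma transM c c' c'' p : smooth_trans c c' -> smooth_trans c' c'' ->
  smooth_trans c c'' -> cdom c p -> cdom c' p -> cdom c'' p ->
  trans c c' p *m trans c' c'' p = trans c c'' p.
Proof.
move=> s1 s2 s3 cp c'p c''p.
have d1 := smooth_trans_differentiable s1 cp c'p.
have d2 := smooth_trans_differentiable s2 c'p c''p.
have d3 := smooth_trans_differentiable s3 cp c''p.
have fp : (cmap c' \o cinv c) (cmap c p) = cmap c' p by rewrite /= cmapK.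
have -> : trans c' c'' p = jacobian (cmap c'' \o cinv c')
    ((cmap c' \o cinv c) (cmap c p)) by rewrite fp.
rewrite -fp in d2.
apply: etrans (esym (jacobian_comp d1 d2)) _.
apply: (jacobian_near_eq _ (differentiable_comp d1 d2) d3).
have oA : open (cdom c' `&` cdom c'') by apply: openI; exact: cdom_open.
have xA : (cmap c @` (cdom c `&` (cdom c' `&` cdom c''))) (cmap c p) by exists p.
have N := open_nbhs_nbhs (conj (chart_img_open oA) xA).
near=> y.
have : (cmap c @` (cdom c `&` (cdom c' `&` cdom c''))) y by near: y; exact: N.
by move=> [q [cq [c'q c''q]] <-] /=; rewrite !cmapK.
Unshelve. all: by end_near.
Qed.

Lemma trans_id c p : cdom c p -> trans c c p = 1%:M.
Proof.
move=> cp; apply: jacobian_rowE.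
  exact: (smooth_trans_differentiable (@smooth_trans_refl c) cp cp).
move=> v; rewrite mulmx1.
rewrite -[RHS](@derive_id R _ (cmap c p) v).
apply: (derive_near_eq _ (@open_overlap c c)); first exact: mem_overlap.
by move=> _ [q [cq _] <-] /=; rewrite cmapK.
Qed.

Lemma trans_inv c c' p : smooth_trans c c' -> smooth_trans c' c ->
  cdom c p -> cdom c' p -> trans c c' p *m trans c' c p = 1%:M.
Proof.
move=> s1 s2 cp c'p; rewrite (transM s1 s2 (@smooth_trans_refl c)) //.
exact: trans_id.
Qed.

Lemma form_locE c (a : one_form M) p : cdom c p ->
  form_loc c a (cmap c p) = trans c (chart_at p) p *m a p.
Proof. by move=> cp; rewrite /form_loc (cmapK cp). Qed.

Lemma vf_locE c (X : vector_field M) p : cdom c p ->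
  vf_loc c X (cmap c p) = X p *m trans (chart_at p) c p.
Proof. by move=> cp; rewrite /vf_loc (cmapK cp). Qed.

Lemma bilin_locE c (b : bilin_field M) p : cdom c p ->
  bilin_loc c b (cmap c p) =
  trans c (chart_at p) p *m b p *m (trans c (chart_at p) p)^T.
Proof. by move=> cp; rewrite /bilin_loc (cmapK cp). Qed.

Lemma endo_locE c (f : endo_field M) p : cdom c p ->
  endo_loc c f (cmap c p) =
  trans c (chart_at p) p *m f p *m trans (chart_at p) c p.
Proof. by move=> cp; rewrite /endo_loc (cmapK cp). Qed.

Section CompatChart.
Variables (c c' : chart R n M).
Hypotheses (cC : compat_chart c) (ac' : atlas c').

Let psi := cmap c' \o cinv c.
Let s1 : smooth_trans c c'. Proof. by have [] := cC ac'. Qed.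
Let s2 : smooth_trans c' c. Proof. by have [] := cC ac'. Qed.

Let at_atlas p : atlas (chart_at p : chart R n M).
Proof. exact: chart_at_atlas. Qed.
Let t1 p : smooth_trans c (chart_at p). Proof. by have [] := cC (at_atlas p). Qed.
Let t2 p : smooth_trans (chart_at p) c. Proof. by have [] := cC (at_atlas p). Qed.
Let t3 p : smooth_trans c' (chart_at p).
Proof. exact: atlas_compat ac' (at_atlas p). Qed.
Let t4 p : smooth_trans (chart_at p) c'.
Proof. exact: atlas_compat (at_atlas p) ac'. Qed.

Let psiE p : cdom c p -> psi (cmap c p) = cmap c' p.
Proof. by move=> cp; rewrite /psi /= (cmapK cp). Qed.

Let c0p p : cdom (chart_at p : chart R n M) p.
Proof. exact: chart_at_dom. Qed.

Lemma form_loc_trans (a : one_form M) y : overlap c c' y ->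
  form_loc c a y = jacobian psi y *m form_loc c' a (psi y).
Proof.
move=> [p [cp c'p] <-]; rewrite (psiE cp) (form_locE _ cp) (form_locE _ c'p).
by rewrite -(transM s1 (@t3 p) (@t1 p) cp c'p (@c0p p)) mulmxA.
Qed.

Lemma vf_loc_trans (X : vector_field M) y : overlap c c' y ->
  vf_loc c X y *m jacobian psi y = vf_loc c' X (psi y).
Proof.
move=> [p [cp c'p] <-]; rewrite (psiE cp) (vf_locE _ cp) (vf_locE _ c'p).
by rewrite -(transM (@t2 p) s1 (@t4 p) (@c0p p) cp c'p) mulmxA.
Qed.

Lemma bilin_loc_trans (b : bilin_field M) y : overlap c c' y ->
  bilin_loc c b y =
  jacobian psi y *m bilin_loc c' b (psi y) *m (jacobian psi y)^T.
Proof.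
move=> [p [cp c'p] <-]; rewrite (psiE cp) (bilin_locE _ cp) (bilin_locE _ c'p).
by rewrite -(transM s1 (@t3 p) (@t1 p) cp c'p (@c0p p)) trmx_mul !mulmxA.
Qed.

Lemma endo_loc_trans (f : endo_field M) y : overlap c c' y ->
  endo_loc c f y = jacobian psi y *m endo_loc c' f (psi y) *m
    jacobian (cmap c \o cinv c') (psi y).
Proof.
move=> [p [cp c'p] <-]; rewrite (psiE cp) (endo_locE _ cp) (endo_locE _ c'p).
rewrite -(transM s1 (@t3 p) (@t1 p) cp c'p (@c0p p)).
by rewrite -(transM (@t4 p) s2 (@t2 p) (@c0p p) c'p cp) !mulmxA.
Qed.

Lemma vf_loc_trans' (X : vector_field M) y : overlap c c' y ->
  vf_loc c X y = vf_loc c' X (psi y) *m jacobian (cmap c \o cinv c') (psi y).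
Proof.
move=> [p [cp c'p] <-]; rewrite (psiE cp) (vf_locE _ cp) (vf_locE _ c'p).
by rewrite -(transM (@t4 p) s2 (@t2 p) (@c0p p) c'p cp) mulmxA.
Qed.

Let psiC k : classC k (overlap c c') psi. Proof. exact: s1. Qed.
Let psi_in y : overlap c c' y -> (cmap c' @` cdom c') (psi y).
Proof. exact: overlap_img. Qed.
Let oO := @open_overlap c c'.
Let oV := @cimg_open _ _ _ c'.

Let psi_loc p q k (F : 'rV[R]_n -> 'M[R]_(p, q)) :
  smooth_on (cmap c' @` cdom c') F -> classC k (overlap c c') (F \o psi).
Proof. by move=> FC; exact: (classC_comp oO oV psi_in (psiC k) (FC k)). Qed.

Let jacC k : classC k (overlap c c') (jacobian psi).
Proof. exact: classC_jacobian oO (psiC k.+1). Qed.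

Let jac'C k : classC k (overlap c c') (jacobian (cmap c \o cinv c') \o psi).
Proof.
apply: (classC_comp oO (@open_overlap c' c)) (psiC k) _.
  by move=> _ [p [cp c'p] <-]; rewrite /psi /= cmapK //; exact: mem_overlap.
exact: classC_jacobian (@open_overlap c' c) (s2 k.+1).
Qed.

Lemma form_loc_smooth_overlap a : smooth_form a ->
  smooth_on (overlap c c') (form_loc c a).
Proof.
move=> aC k.
have H := classC_mulmx oO (jacC k) (psi_loc k (aC c' ac')).
by apply: eq_classC oO _ H => y oy; rewrite form_loc_trans.
Qed.

Lemma vf_loc_smooth_overlap X : smooth_vf X ->
  smooth_on (overlap c c') (vf_loc c X).
Proof.
move=> XC k.
have H := classC_mulmx oO (psi_loc k (XC c' ac')) (jac'C k).
by apply: eq_classC oO _ H => y oy; rewrite vf_loc_trans'.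
Qed.

Lemma bilin_loc_smooth_overlap b : smooth_bilin b ->
  smooth_on (overlap c c') (bilin_loc c b).
Proof.
move=> bC k.
have H := classC_mulmx oO (classC_mulmx oO (jacC k) (psi_loc k (bC c' ac')))
  (classC_trmx oO (jacC k)).
by apply: eq_classC oO _ H => y oy; rewrite bilin_loc_trans.
Qed.

Lemma endo_loc_smooth_overlap f : smooth_endo f ->
  smooth_on (overlap c c') (endo_loc c f).
Proof.
move=> fC k.
have H := classC_mulmx oO (classC_mulmx oO (jacC k) (psi_loc k (fC c' ac')))
  (jac'C k).
by apply: eq_classC oO _ H => y oy; rewrite endo_loc_trans.
Qed.

End CompatChart.

Section CompatSmooth.
Variables (c : chart R n M).
Hypothesis cC : compat_chart c.

(** The preferred charts cover the domain of c. *)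
Let local (W : normedModType R) (F : 'rV[R]_n -> W) :
  (forall c', atlas c' -> smooth_on (overlap c c') F) ->
  smooth_on (cmap c @` cdom c) F.
Proof.
move=> FC k; apply: classC_local => _ [p cp <-].
exists (overlap c (chart_at p)); split; first exact: open_overlap.
  by apply: mem_overlap => //; exact: chart_at_dom.
exact: FC (chart_at_atlas p) k.
Qed.

Lemma form_loc_smooth a : smooth_form a -> smooth_on (cmap c @` cdom c) (form_loc c a).
Proof. by move=> aC; apply: local => c' ac'; exact: form_loc_smooth_overlap. Qed.

Lemma vf_loc_smooth X : smooth_vf X -> smooth_on (cmap c @` cdom c) (vf_loc c X).
Proof. by move=> XC; apply: local => c' ac'; exact: vf_loc_smooth_overlap. Qed.

Lemma bilin_loc_smooth b : smooth_bilin b ->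
  smooth_on (cmap c @` cdom c) (bilin_loc c b).
Proof. by move=> bC; apply: local => c' ac'; exact: bilin_loc_smooth_overlap. Qed.

Lemma endo_loc_smooth f : smooth_endo f ->
  smooth_on (cmap c @` cdom c) (endo_loc c f).
Proof. by move=> fC; apply: local => c' ac'; exact: endo_loc_smooth_overlap. Qed.

Variable p : M.
Hypothesis cp : cdom c p.
Let c0 : chart R n M := chart_at p.
Let T := trans c c0 p.
Let ac0 : atlas c0. Proof. exact: chart_at_atlas. Qed.
Let c0p : cdom c0 p. Proof. exact: chart_at_dom. Qed.

Lemma ext_d_loc a : smooth_form a ->
  ext_d_coord (form_loc c a) (cmap c p) = T *m ext_d a p *m T^T.
Proof.
move=> aC; have [s1 _] := cC ac0.
rewrite (ext_d_coord_pullback (@open_overlap c c0) (@cimg_open _ _ _ c0)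
  (@overlap_img c c0) s1 (aC c0 ac0) _ (mem_overlap cp c0p)); last first.
  by move=> y oy; exact: form_loc_trans.
by rewrite /= cmapK.
Qed.

Lemma lie_bilin_loc X b : smooth_vf X -> smooth_bilin b ->
  lie_coord (vf_loc c X) (bilin_loc c b) (cmap c p) =
  T *m lie_bilin X b p *m T^T.
Proof.
move=> XC bC; have [s1 _] := cC ac0.
rewrite (lie_coord_pullback (@open_overlap c c0) (@cimg_open _ _ _ c0)
  (@overlap_img c c0) s1 (XC c0 ac0) _ (bC c0 ac0) _ _ (mem_overlap cp c0p)).
- rewrite /= cmapK // /lie_coord /lie_bilin -/c0.
  have -> : vf_loc c0 X (cmap c0 p) = X p.
    by rewrite (vf_locE _ c0p) (trans_id c0p) mulmx1.
  have -> : bilin_loc c0 b (cmap c0 p) = b p.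
    by rewrite (bilin_locE _ c0p) (trans_id c0p) mul1mx trmx1 mulmx1.
  by [].
- exact: vf_loc_smooth_overlap.
- by move=> y oy; exact: vf_loc_trans.
- by move=> y oy; exact: bilin_loc_trans.
Qed.

End CompatSmooth.

End Charts.

(** * Straightening a closed form and a transverse field *)

Section Straightening.
Context {R : realType}.

Lemma open_preimageI (V W : topologicalType) (f : V -> W) (A : set V) (C : set W) :
  open A -> (forall x, A x -> {for x, continuous f}) -> open C ->
  open (A `&` f @^-1` C).
Proof.
move=> oA fc oC; rewrite openE => x [Ax Cx]; apply: filterI.
  exact: (open_nbhs_nbhs (conj oA Ax)).
exact: (fc x Ax _ (open_nbhs_nbhs (conj oC Cx))).
Qed.

Lemma is_derive_linear (V W : normedModType R) (L : {linear V -> W}) x v :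
  continuous L -> is_derive x v L (L v).
Proof.
move=> Lc; have Ld : differentiable L x by exact: linear_differentiable.
apply: DeriveDef; first exact: diff_derivable.
by rewrite (deriveE _ Ld) diff_lin.
Qed.

Lemma is_derive_row_mx (V : normedModType R) m n p (f : V -> 'M[R]_(m, n))
    (g : V -> 'M[R]_(m, p)) x v df dg :
  is_derive x v f df -> is_derive x v g dg ->
  is_derive x v (fun y => row_mx (f y) (g y)) (row_mx df dg).
Proof.
move=> /is_derive_mxP fd /is_derive_mxP gd; apply/is_derive_mxP => i j.
rewrite -(splitK j); case: (fintype.split j) => l /=.
  by under eq_fun do rewrite row_mxEl; rewrite row_mxEl; exact: fd.
by under eq_fun do rewrite row_mxEr; rewrite row_mxEr; exact: gd.
Qed.

Lemma mulmx_inj m n (A B : 'M[R]_(m, n)) :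
  (forall v : 'rV[R]_m, v *m A = v *m B) -> A = B.
Proof. by move=> AB; apply/row_matrixP => i; rewrite !rowE. Qed.

Lemma unitmx_ker0 n (A : 'M[R]_n) :
  (forall v : 'rV[R]_n, v *m A = 0 -> v = 0) -> A \in unitmx.
Proof.
move=> A0; rewrite -row_free_unit -kermx_eq0; apply/eqP/row_matrixP => i.
by rewrite row0; apply: A0; apply/sub_kermxP; exact: row_sub.
Qed.

(** The rows of S span the hyperplane on which b vanishes, the tangent space of
    a slice transverse to w. *)
Lemma kernel_basis m (b : 'cV[R]_(m + 1)) (w : 'rV[R]_(m + 1)) :
  w *m b = 1%:M ->
  exists S : 'M[R]_(m, m + 1), row_free S /\ S *m b = 0.
Proof.
move=> wb; have rb : \rank b = 1%N.
  apply/eqP; rewrite eqn_leq rank_leq_col lt0n mxrank_eq0.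
  apply/eqP => b0; have := congr1 (fun A : 'M[R]_1 => A 0 0) wb.
  by rewrite b0 mulmx0 !mxE eqxx => /esym/eqP; rewrite oner_eq0.
have rK : \rank (kermx b) = m by rewrite mxrank_ker rb addnK.
have Sf := row_base_free (kermx b).
have Sb : row_base (kermx b) *m b = 0.
  by apply/sub_kermxP; rewrite eq_row_base.
by move: (row_base _) Sf Sb; rewrite rK => S Sf Sb; exists S.
Qed.

(** Coordinates (u, t) in which a closed form b is dt and a field X with
    b(X) = 1 is the coordinate field of t: t is a potential of b, and u is
    constant along the flow of X.  They are given by their inverse E, which
    flows a point of a slice transverse to X until the potential equals t. *)
Theorem straighten m (O : set 'rV[R]_(m + 1)) b X x0 :
  open O -> O x0 -> smooth_on O b -> smooth_on O X ->
  (forall x, O x -> forall u v, v *m 'D_u b x = u *m 'D_v b x) ->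
  (forall x, O x -> X x *m b x = 1%:M) ->
  exists (e : R) (E kappa : 'rV[R]_(m + 1) -> 'rV[R]_(m + 1)),
    0 < e /\ E 0 = x0 /\
    [/\ smooth_on (ball 0 e) E, open (E @` ball 0 e),
        smooth_on (E @` ball 0 e) kappa &
        forall z, ball 0 e z ->
        [/\ O (E z), kappa (E z) = z, jacobian E z \in unitmx,
            jacobian E z *m b (E z) = col_mx 0 1%:M &
            row_mx 0 1%:M *m jacobian E z = X (E z)]].
Proof.
move=> oO Ox0 bC XC bcl Xb.
have /nbhs_ballP[r /= r0 rO] : nbhs x0 O by exact: open_nbhs_nbhs.
have oB : open (ball x0 r) by exact: ball_open.
have bC' : smooth_on (ball x0 r) b by move=> k; exact: sub_classC rO (bC k).
have XC' : smooth_on (ball x0 r) X by move=> k; exact: sub_classC rO (XC k).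
have bcl' x : ball x0 r x -> forall u v, v *m 'D_u b x = u *m 'D_v b x.
  by move=> /rO; exact: bcl.
have [f [f0 fC fD]] := poincare r0 bC' bcl'.
have Bx0 : ball x0 r x0 by exact: ballxx.
have [eps [phi [eps0 phiC phiB phi0 phiX]]] := local_flow oB XC' Bx0.
have oC := @open_cylinder R _ x0 eps eps0.
have [S [Sf Sb]] := kernel_basis (Xb x0 Ox0).
pose sigma (z : 'rV[R]_(m + 1)) : 'rV[R]_(m + 1) := x0 + lsubmx z *m S.
(* Along X the potential f grows at unit speed, so that it reaches the value t
   after the time t - f (sigma z). *)
pose omega (z : 'rV[R]_(m + 1)) : 'rV[R]_(m + 1 + 1) :=
  row_mx (sigma z) (rsubmx z - f (sigma z)).
have sigmaC k (A : set 'rV[R]_(m + 1)) : open A -> classC k A sigma.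
  move=> oA; apply: (classC_add oA); first exact: classC_cst.
  apply: (classC_mulmx oA); last exact: classC_cst.
  by apply: (classC_lsubmx oA); exact: classC_id.
pose A1 := setT `&` sigma @^-1` ball x0 r.
have oA1 : open A1.
  apply: open_preimageI openT _ oB => z _.
  exact: classC_continuous (sigmaC 0%N setT openT) I.
have omegaC k : classC k A1 omega.
  apply: (classC_row_mx oA1); first exact: sigmaC.
  have fs : classC k A1 (f \o sigma).
    by apply: (classC_comp oA1 oB) (sigmaC k _ oA1) (fC k) => z [].
  have rs : classC k A1 (fun z : 'rV[R]_(m + 1) => rsubmx z).
    by apply: (classC_rsubmx oA1); exact: classC_id.
  have ns : classC k A1 (fun z => (-1) *: (f \o sigma) z).
    by apply: (classC_scalemx oA1) fs; exact: classC_cst.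
  apply: eq_classC oA1 _ (classC_add oA1 rs ns) => z _ /=.
  by rewrite scaleN1r.
pose A2 := A1 `&` omega @^-1` cylinder x0 eps.
have oA2 : open A2.
  apply: open_preimageI oA1 _ oC => z A1z.
  exact: classC_continuous (omegaC 0%N) A1z.
have omegaC2 k : classC k A2 omega by apply: sub_classC (omegaC k) => z [].
pose E := phi \o omega.
have EC : smooth_on A2 E.
  by move=> k; apply: (classC_comp oA2 oC) (omegaC2 k) (phiC k) => z [].
have sigma0 : sigma 0 = x0 by rewrite /sigma linear0 mul0mx addr0.
have omega0 : omega 0 = row_mx x0 0.
  by rewrite /omega sigma0 f0 linear0 subr0.
have E0 : E 0 = x0 by rewrite /E /= omega0 phi0.
have A20 : A2 0.
  split; first by split=> //; rewrite /= sigma0.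
  rewrite /= omega0; split; first by rewrite row_mxKl; exact: ballxx.
  by rewrite last_coord_row_mx mxE normr0.
have EB z : A2 z -> ball x0 r (E z) by move=> [_ /phiB].
have fphi z : cylinder x0 eps z -> f (phi z) = f (lsubmx z) + rsubmx z.
  move=> [ze se]; set t := last_coord z in se.
  have zE : rsubmx z = t%:M by rewrite [LHS]mx11_scalar.
  pose v : 'rV[R]_(m + 1 + 1) := row_mx 0 1%:M.
  have lin s : row_mx (lsubmx z) 0 + s *: v = row_mx (lsubmx z) s%:M.
    by rewrite /v scale_row_mx add_row_mx scaler0 addr0 add0r scalemx1.
  have := @mean_value_line R _ _ _ (f \o phi) (row_mx (lsubmx z) 0) v t 1%:M 0.
  rewrite lin -zE hsubmxK /= phi0 mul0r => H.
  have {}H : `|f (phi z) - f (lsubmx z) - t *: 1%:M| <= 0.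
    apply: H => s st; rewrite lin.
    have cs : cylinder x0 eps (row_mx (lsubmx z) s%:M).
      split; first by rewrite row_mxKl.
      by rewrite last_coord_row_mx mxE eqxx mulr1n (le_lt_trans st).
    have Bs := phiB _ cs.
    have [cd cE] := derive_comp (classC_derivable (v := v) (phiC 1%N) cs)
      (classC_differentiable oB (fC 1%N) Bs).
    split; first exact: cd.
    by rewrite cE (phiX _ cs) (fD _ _ Bs) (Xb _ (rO _ Bs)) subrr normr0.
  by move: H; rewrite normr_le0 scalemx1 -zE subr_eq0 subr_eq addrC => /eqP.
have fE z : A2 z -> f (E z) = rsubmx z.
  move=> [_ /fphi H]; apply: etrans H _.
  by rewrite /omega row_mxKl row_mxKr addrC; exact: subrK.
have omegaD z v : A2 z -> is_derive z v omega
    (row_mx (lsubmx v *m S) (rsubmx v - lsubmx v *m S *m b (sigma z))).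
  move=> [[_ Bz] _].
  have ld : is_derive z v (lsubmx : 'rV[R]_(m + 1) -> 'rV[R]_m) (lsubmx v).
    by apply: is_derive_linear; exact: continuous_lsubmx.
  have rd : is_derive z v (rsubmx : 'rV[R]_(m + 1) -> 'rV[R]_1) (rsubmx v).
    by apply: is_derive_linear; exact: continuous_rsubmx.
  have sd : is_derive z v sigma (lsubmx v *m S).
    rewrite -[X in is_derive _ _ _ X]add0r; apply: is_deriveD.
    have := is_derive_mulmx ld (is_derive_cst S z v).
    by rewrite mulmx0 addr0.
  have [sd1 sd2] := sd.
  have [cd cE] := derive_comp sd1 (classC_differentiable oB (fC 1%N) Bz).
  have fsd : is_derive z v (f \o sigma) (lsubmx v *m S *m b (sigma z)).
    by apply: DeriveDef; [exact: cd|rewrite cE sd2 fD].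
  exact: (is_derive_row_mx sd (is_deriveB rd fsd)).
have ED z v : A2 z -> 'D_v E z =
    'D_(row_mx (lsubmx v *m S) (rsubmx v - lsubmx v *m S *m b (sigma z))) phi (omega z).
  move=> A2z; have [od oE] := omegaD z v A2z; case: (A2z) => _ cz.
  have [_ ->] := derive_comp od (classC_differentiable oC (phiC 1%N) cz).
  by rewrite oE.
have EX z : A2 z -> row_mx 0 1%:M *m jacobian E z = X (E z).
  move=> A2z; rewrite -(classC_deriveE _ oA2 (EC 1%N) A2z) (ED _ _ A2z).
  rewrite row_mxKl row_mxKr !mul0mx subr0.
  by case: (A2z) => _ cz; exact: phiX.
have Eb z : A2 z -> jacobian E z *m b (E z) = col_mx 0 1%:M.
  move=> A2z; apply: mulmx_inj => v; rewrite mulmxA.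
  rewrite -(classC_deriveE _ oA2 (EC 1%N) A2z) -(fD _ _ (EB z A2z)).
  have [_ <-] := derive_comp (classC_derivable (v := v) (EC 1%N) A2z)
    (classC_differentiable oB (fC 1%N) (EB z A2z)).
  have -> : 'D_v (f \o E) z = 'D_v (rsubmx : 'rV[R]_(m + 1) -> 'rV[R]_1) z.
    exact: derive_near_eq oA2 A2z fE.
  have rd : is_derive z v (rsubmx : 'rV[R]_(m + 1) -> 'rV[R]_1) (rsubmx v).
    by apply: is_derive_linear; exact: continuous_rsubmx.
  rewrite (@derive_val _ _ _ _ _ _ _ rd) -[v in RHS]hsubmxK.
  by rewrite mul_row_col mulmx0 add0r mulmx1.
have Eu : jacobian E 0 \in unitmx.
  apply: unitmx_ker0 => v; rewrite -(classC_deriveE _ oA2 (EC 1%N) A20) (ED _ _ A20).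
  rewrite sigma0 omega0 -mulmxA Sb mulmx0 subr0.
  set y := lsubmx v *m S; set t := rsubmx v.
  have c0 : cylinder x0 eps (row_mx x0 0) by case: A20 => _; rewrite /= omega0.
  rewrite (classC_deriveE _ oC (phiC 1%N) c0).
  have -> : row_mx y t = row_mx y 0 + t 0 0 *: row_mx 0 1%:M.
    by rewrite scale_row_mx add_row_mx scaler0 addr0 add0r scalemx1 -mx11_scalar.
  rewrite mulmxDl -scalemxAl -!(classC_deriveE _ oC (phiC 1%N) c0).
  rewrite (phiX _ c0) phi0.
  have -> : 'D_(row_mx y 0) phi (row_mx x0 0) = y.
    rewrite -[RHS](@derive_id R _ x0 y) /derive.
    suff -> : (fun h : R => h^-1 *: ((phi \o shift (row_mx x0 0)) (h *: row_mx y 0)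
        - phi (row_mx x0 0))) =
      (fun h : R => h^-1 *: ((id \o shift x0) (h *: y) - id x0)) by [].
    apply/funext => h /=.
    by rewrite scale_row_mx add_row_mx scaler0 addr0 !phi0.
  move=> yt; have t0 : t 0 0 = 0.
    have := congr1 (fun w => (w *m b x0) 0 0) yt.
    rewrite mulmxDl -scalemxAl (Xb _ Ox0) /y -mulmxA Sb mulmx0 add0r mul0mx.
    by rewrite !mxE eqxx mulr1.
  move: yt; rewrite t0 scale0r addr0 => y0.
  rewrite -[v]hsubmxK -/t [t]mx11_scalar t0.
  have -> : lsubmx v = 0 by apply: (row_free_inj Sf); rewrite mul0mx.
  by apply/rowP => i; rewrite -(splitK i); case: (fintype.split i) => l /=;
    rewrite ?row_mxEl ?row_mxEr !mxE ?mul0rn.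
have [e [kappa [e0 eA kE Eo kC]]] := inverse_function oA2 EC A20 Eu.
exists e, E, kappa; split; [exact: e0|split; [exact: E0|split]].
- by move=> k; exact: sub_classC eA (EC k).
- exact: Eo.
- exact: kC.
move=> z ze; have A2z := eA z ze; have [k1 k2] := kE z ze.
split; [exact/rO/EB|exact: k1|exact: k2|exact: Eb|exact: EX].
Qed.

End Straightening.

(** * Adapted charts of a manifold *)

Section AdaptedChart.
Context {R : realType} {m : nat} {M : manifold R (m + 1)}.

Section ReparametrizedChart.
Variables (c : chart R (m + 1) M) (e : R)
  (E kappa : 'rV[R]_(m + 1) -> 'rV[R]_(m + 1)).
Hypotheses (ac : atlas c) (EC : smooth_on (ball 0 e) E)
  (Eo : open (E @` ball 0 e)) (kC : smooth_on (E @` ball 0 e) kappa)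
  (EO : forall z, ball 0 e z -> (cmap c @` cdom c) (E z))
  (kE : forall z, ball 0 e z -> kappa (E z) = z).

Let D : set M := cdom c `&` cmap c @^-1` (E @` ball 0 e).
Let oB : open (ball (0 : 'rV[R]_(m + 1)) e). Proof. exact: ball_open. Qed.

Let rD_open : open D.
Proof.
by apply: open_preimageI (cdom_open c) _ Eo => p cp; exact: cmap_cont.
Qed.

Let r_img : (kappa \o cmap c) @` D = ball 0 e.
Proof.
apply/seteqP; split=> [_ [p [cp [z ze Ez]] <-]|z ze] /=.
  by rewrite -Ez kE.
have [p cp pE] := EO ze; exists p; last by rewrite /= pE kE.
by split=> //=; exists z.
Qed.

Let r_img_open : open ((kappa \o cmap c) @` D).
Proof. by rewrite r_img. Qed.

Let r_mapK p : D p -> (cinv c \o E) ((kappa \o cmap c) p) = p.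
Proof. by move=> [cp [z ze Ez]] /=; rewrite -Ez (kE ze) Ez (cmapK cp). Qed.

Let r_map_cont p : D p -> {for p, continuous (kappa \o cmap c)}.
Proof.
move=> [cp Wp]; apply: continuous_comp; first exact: cmap_cont cp.
exact: classC_continuous (kC 0) Wp.
Qed.

Let r_inv_cont x : ((kappa \o cmap c) @` D) x -> {for x, continuous (cinv c \o E)}.
Proof.
rewrite r_img => xe; apply: continuous_comp.
  exact: classC_continuous (EC 0) xe.
exact: cinv_cont (EO xe).
Qed.

Definition reparam_chart : chart R (m + 1) M :=
  Chart rD_open r_img_open r_mapK r_map_cont r_inv_cont.

Lemma reparam_img : cmap reparam_chart @` cdom reparam_chart = ball 0 e.
Proof. exact: r_img. Qed.

Lemma reparam_compat : compat_chart reparam_chart.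
Proof.
move=> c' ac'; have s1 := atlas_compat ac ac'; have s2 := atlas_compat ac' ac.
split=> k.
  have oE z : overlap reparam_chart c' z -> ball 0 e z /\ overlap c c' (E z).
    move=> [p [[cp [w we Ew]] c'p] <-] /=; rewrite -Ew (kE we).
    by split=> //; rewrite Ew; exact: mem_overlap.
  apply: (classC_comp (@open_overlap _ _ _ reparam_chart c')
    (@open_overlap _ _ _ c c')) (s1 k).
    by move=> z /oE[].
  by apply: sub_classC (EC k) => z /oE[].
have oE z : overlap c' reparam_chart z -> overlap c' c z /\
    (E @` ball 0 e) ((cmap c \o cinv c') z).
  move=> [p [c'p [cp Wp]] <-] /=; rewrite (cmapK c'p).
  by split=> //; exact: mem_overlap.
apply: (classC_comp (@open_overlap _ _ _ c' reparam_chart) Eo) (kC k).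
  by move=> z /oE[].
by apply: sub_classC (s2 k) => z /oE[].
Qed.

Lemma reparam_jacobian z : ball 0 e z ->
  overlap reparam_chart c z /\ (cmap c \o cinv reparam_chart) z = E z /\
  jacobian (cmap c \o cinv reparam_chart) z = jacobian E z.
Proof.
have psiE y : ball 0 e y -> (cmap c \o cinv reparam_chart) y = E y.
  by move=> ye; have [p cp pE] := EO ye; rewrite /= -pE (cmapK cp).
move=> ze.
have oz : overlap reparam_chart c z.
  move: (ze); rewrite -reparam_img => -[p Dp <-].
  by apply: mem_overlap => //; case: Dp.
split; [exact: oz|split; first exact: psiE].
have [s _] := reparam_compat ac.
apply: jacobian_rowE.
  exact: classC_differentiable (@open_overlap _ _ _ reparam_chart c) (s 1%N) oz.
move=> v; rewrite -(classC_deriveE v oB (EC 1%N) ze).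
exact: derive_near_eq oB ze psiE.
Qed.

End ReparametrizedChart.

(** The coordinates of [straighten], applied in the preferred chart at p0 and
    shrunk to a ball, make up a chart of the maximal atlas. *)
Theorem adapted_chart (b : one_form M) (X : vector_field M) p0 :
  smooth_form b -> smooth_vf X -> (forall p, ext_d b p = 0) ->
  (forall p, ev (b p) (X p) = 1) ->
  exists (c : chart R (m + 1) M) (e : R),
    [/\ 0 < e, compat_chart c, cdom c p0, cmap c @` cdom c = ball 0 e &
        forall z, ball 0 e z -> form_loc c b z = col_mx 0 1%:M /\
                                vf_loc c X z = row_mx 0 1%:M].
Proof.
move=> bC XC db bX; pose c : chart R (m + 1) M := chart_at p0.
have ac : atlas c by exact: chart_at_atlas.
have cp0 : cdom c p0 by exact: chart_at_dom.
have cC := atlas_compat_chart ac.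
have oO := @cimg_open _ _ _ c.
have Ox0 : (cmap c @` cdom c) (cmap c p0) by exists p0.
have bcl x : (cmap c @` cdom c) x -> forall u v,
    v *m 'D_u (form_loc c b) x = u *m 'D_v (form_loc c b) x.
  move=> [p cp <-] u v.
  have Op : (cmap c @` cdom c) (cmap c p) by exists p.
  have := bil_ext_d_coord u v oO (bC c ac 1%N) Op.
  have b0 : bil (0 : 'M[R]_(m + 1)) u v = 0 by rewrite /bil mulmx0 mul0mx mxE.
  rewrite (ext_d_loc cC cp bC) db mulmx0 mul0mx b0.
  set q := (_ - _) => H; have q0 : q 0 0 = 0 by move: H; move: (q 0 0) => y; lra.
  apply/eqP; rewrite -subr_eq0 -/q; apply/eqP.
  by rewrite [q]mx11_scalar q0 raddf0.
have bX1 x : (cmap c @` cdom c) x -> vf_loc c X x *m form_loc c b x = 1%:M.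
  move=> [p cp <-]; rewrite (vf_locE _ cp) (form_locE _ cp) -mulmxA.
  rewrite [trans (chart_at p) c p *m _]mulmxA.
  have ap : atlas (chart_at p : chart R _ M) by exact: chart_at_atlas.
  have [s1 s2] := cC _ ap.
  rewrite (trans_inv s2 s1 (chart_at_dom p) cp) mul1mx.
  by rewrite [LHS]mx11_scalar; have := bX p; rewrite /ev => ->.
have [e [E [kappa [e0 [E0 [EC Eo kC EP]]]]]] :=
  straighten oO Ox0 (bC c ac) (XC c ac) bcl bX1.
have EO z : ball 0 e z -> (cmap c @` cdom c) (E z) by move=> /EP[].
have kE z : ball 0 e z -> kappa (E z) = z by move=> /EP[].
pose c' := reparam_chart EC Eo kC EO kE.
have c'C : compat_chart c' by exact: reparam_compat.
exists c', e; split; [exact: e0|exact: c'C| |exact: reparam_img|].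
  by split=> //=; exists 0; [exact: ballxx|exact: E0].
move=> z ze; have [_ _ Ju Jb XJ] := EP z ze.
have [oz [pz Jz]] := reparam_jacobian ac EC Eo kC EO kE ze.
split; first by rewrite (form_loc_trans c'C ac b oz) pz Jz.
have H := vf_loc_trans c'C ac X oz; rewrite pz Jz -XJ in H.
exact: (can_inj (mulmxK Ju) H).
Qed.

End AdaptedChart.

(** * Exterior forms under linear maps *)

Section ExteriorAlgebra.
Context {R : realType}.

(** With arguments stored as the rows of a matrix, pulling back a form amounts
    to multiplying them by the matrix of the linear map. *)
Lemma wedge_pull n m (A : 'M[R]_(n, m)) k l (a : @kform R m k) (b : @kform R m l)
    (a' : @kform R n k) (b' : @kform R n l) :
  (forall w, a' w = a (w *m A)) -> (forall w, b' w = b (w *m A)) ->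
  forall v, wedge a' b' v = wedge a b (v *m A).
Proof.
move=> aE bE v; rewrite /wedge; congr (_ * _); apply: eq_bigr => s _.
have sE : row_perm s (v *m A) = row_perm s v *m A.
  by apply/matrixP => i j; rewrite !mxE; apply: eq_bigr => q _; rewrite mxE.
by rewrite aE bE sE -mul_usub_mx -mul_dsub_mx.
Qed.

Lemma wedge_pow_pull n m (A : 'M[R]_(n, m)) (b : @kform R m 2)
    (b' : @kform R n 2) k :
  (forall w, b' w = b (w *m A)) ->
  forall v, wedge_pow b' k v = wedge_pow b k (v *m A).
Proof.
by move=> bE; elim: k => [|k IH] v //=; exact: wedge_pull.
Qed.

Lemma kform1_pull n m (A : 'M[R]_(n, m)) (a : 'cV[R]_m) w :
  kform1 (A *m a) w = kform1 a (w *m A).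
Proof. by rewrite /kform1 /ev mulmxA. Qed.

Lemma kform2_pull n m (A : 'M[R]_(n, m)) (b : 'M[R]_m) w :
  kform2 (A *m b *m A^T) w = kform2 b (w *m A).
Proof. by rewrite /kform2 /bil !row_mul trmx_mul !mulmxA. Qed.

Lemma wedge_eq0 n k l (a : @kform R n k) (b : @kform R n l) :
  (forall w, a w = 0) -> forall v, wedge a b v = 0.
Proof.
by move=> a0 v; rewrite /wedge big1 ?mulr0 // => s _; rewrite a0 mul0r mulr0.
Qed.

Let ord2 (i : 'I_2) : i = 0 \/ i = 1.
Proof.
by case: i => [[|[|//]] h]; [left|right]; apply: val_inj.
Qed.

Let alternating2 (F : 'I_2 -> 'I_2 -> R) :
  (forall i j, F i j = - F j i) -> forall s : 'S_2,
  (-1) ^+ s * F (s 0) (s 1) = F 0 1.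
Proof.
move=> FA s.
have s01 : s 0 != s 1 by rewrite (inj_eq perm_inj).
have [s0|s0] := ord2 (s 0).
  have s1 : s 1 = 1.
    by case: (ord2 (s 1)) => // s1; rewrite s0 s1 eqxx in s01.
  have -> : s = 1%g.
    by apply/permP => i; rewrite perm1; case: (ord2 i) => ->.
  by rewrite odd_perm1 expr0 mul1r !perm1.
have s1 : s 1 = 0.
  by case: (ord2 (s 1)) => // s1; rewrite s0 s1 eqxx in s01.
have -> : s = tperm 0 1.
  by apply/permP => i; case: (ord2 i) => ->; rewrite ?tpermL ?tpermR.
by rewrite odd_tperm /= expr1 tpermL tpermR mulN1r FA opprK.
Qed.

(** The first wedge power of an alternating bilinear form is that form: the
    permutations of the two arguments contribute equal terms. *)
Lemma wedge_pow1_eq0 n (B : 'M[R]_n) : B^T = - B ->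
  (forall v, wedge_pow (kform2 B) 1 v = 0) -> B = 0.
Proof.
move=> BT B0; apply/matrixP => i j; rewrite mxE.
have BA u w : bil B u w = - bil B w u.
  have -> : bil B u w = (u *m B *m w^T)^T 0 0 by rewrite mxE.
  by rewrite !trmx_mul trmxK BT mulNmx mulmxN mxE mulmxA.
pose v : 'M[R]_(2, n) := \matrix_(k, l) (if k == 0 then (i == l)%:R else (j == l)%:R).
have := B0 v; rewrite /= /wedge.
under eq_bigr => s _.
  rewrite mulr1 /kform2.
  have re (k : 'I_2) : row k (usubmx (row_perm s v)) = row ((s : 'S_2) k) v.
    apply/rowP => l; rewrite !mxE.
    by have -> : lshift (0 * 2) k = k :> 'I_2 by exact: val_inj.
  rewrite !re.
  rewrite (@alternating2 (fun k k' => bil B (row k v) (row k' v))); last first.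
    by move=> *; exact: BA.
  over.
rewrite sumr_const -[X in _ * X]mulr_natl mulrA.
have -> : #|{: 'S_(2 + 0 * 2)}| = (2 + 0 * 2)`! by rewrite card_Sn.
rewrite mulVf ?mul1r; last by rewrite pnatr_eq0 -lt0n fact_gt0.
have -> : row 0 v = delta_mx 0 i by apply/rowP => l; rewrite !mxE /= [l == _]eq_sym.
have -> : row 1 v = delta_mx 0 j by apply/rowP => l; rewrite !mxE /= [l == _]eq_sym.
by rewrite /bil -rowE trmx_delta -colE !mxE.
Qed.

End ExteriorAlgebra.

(** * Open subsets of R^m as manifolds *)

Section OpenSubmanifold.
Context {R : realType}.

(** Balls with rational centers and radii. *)
Lemma rV_second_countable m : @second_countable 'rV[R]_m.
Proof.
pose I (z : 'rV[rat]_m * rat) : set 'rV[R]_m :=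
  ball (map_mx (ratr : rat -> R) z.1 : 'rV[R]_m) (ratr z.2).
exists (I @` setT); first by apply: card_le_trans (card_image_le _ _) _; exact: countableP.
split=> [_ [z _ <-]|x A /nbhs_ballP[e /= e0 eA]]; first exact: ball_open.
have e2 : 0 < e / 2 by rewrite divr_gt0.
have [s] := rat_in_itvoo e2; rewrite in_itv /= => /andP[s0 se].
have s2 : 0 < (ratr s : R) / 2 by rewrite divr_gt0.
have /choice[q qP] : forall i : 'I_m, exists q : rat,
    `|x 0 i - ratr q| <= ratr s / 2.
  move=> i; have lt : x 0 i < x 0 i + ratr s / 2 by rewrite ltrDl.
  have [q] := rat_in_itvoo lt; rewrite in_itv /= => /andP[q0 q1].
  by exists q; rewrite ler_norml; lra.
have xq : `|x - map_mx (ratr : rat -> R) (\row_i q i)| < ratr s.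
  apply: (@le_lt_trans _ _ (ratr s / 2)); last by lra.
  by apply: mx_norm_leP => [|i j]; [exact: ltW|rewrite !mxE (ord1 i)].
exists (I (\row_i q i, s)).
  split; first by exists (\row_i q i, s).
  by rewrite /I /= -ball_normE /= distrC.
move=> y /=; rewrite /I /= -ball_normE /= => yq; apply: eA.
rewrite -ball_normE /= -(subrK (map_mx (ratr : rat -> R) (\row_i q i)) x) -addrA.
apply: le_lt_trans (ler_normD _ _) _.
by have := ltrD xq yq; lra.
Qed.

Variables (m : nat) (W : set 'rV[R]_m) (w0 : 'rV[R]_m).
Hypotheses (oW : open W) (Ww0 : W w0).

Let val_in (w : W) : W (set_val w).
Proof. exact: set_valP. Qed.

Definition sub_inv (x : 'rV[R]_m) : W := insubd (exist _ w0 (mem_set Ww0)) x.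

Lemma sub_invK x : W x -> set_val (sub_inv x) = x.
Proof. by move=> Wx; rewrite set_valE /sub_inv insubdK //; exact: mem_set. Qed.

Lemma set_valK (w : W) : sub_inv (set_val w) = w.
Proof. by apply: val_inj; have := sub_invK (val_in w); rewrite set_valE. Qed.

Let val_cont : continuous (set_val : W -> 'rV[R]_m).
Proof. exact: initial_continuous. Qed.

Let sub_img : (set_val : W -> 'rV[R]_m) @` setT = W.
Proof.
apply/seteqP; split=> [_ [w _ <-]|x Wx]; first exact: val_in.
by exists (sub_inv x) => //; exact: sub_invK.
Qed.

Let sub_img_open : open ((set_val : W -> 'rV[R]_m) @` setT).
Proof. by rewrite sub_img. Qed.

Let sub_inv_cont x : ((set_val : W -> 'rV[R]_m) @` setT) x ->
  {for x, continuous sub_inv}.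
Proof.
rewrite sub_img => Wx A; rewrite nbhsE => -[B [[C oC CB] Bx] BA].
have Cx : C x by move: Bx; rewrite -CB /= (sub_invK Wx).
have N : \forall y \near x, C y /\ W y.
  exact: filterI (open_nbhs_nbhs (conj oC Cx)) (open_nbhs_nbhs (conj oW Wx)).
suff : \forall y \near x, A (sub_inv y) by [].
apply: filterS N => y [Cy Wy]; apply: BA.
by rewrite -CB /= (sub_invK Wy).
Qed.

Definition sub_chart : chart R m W :=
  @Chart R m W setT set_val sub_inv openT sub_img_open
    (fun w _ => set_valK w) (fun w _ => @val_cont w) sub_inv_cont.

Let sub_hausdorff : hausdorff_space W.
Proof.
move=> p q pq; apply: val_inj; apply: (@norm_hausdorff R 'rV[R]_m) => A B pA qB.
have [w [Aw Bw]] := pq _ _ (val_cont pA) (val_cont qB).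
by exists (set_val w).
Qed.

Let sub_countable : @second_countable W.
Proof.
have [B Bc [Bo Bb]] := rV_second_countable m.
exists ((fun A => set_val @^-1` A) @` B).
  exact: card_le_trans (card_image_le _ _) Bc.
split=> [_ [A BA <-]|w A]; first by exists A => //; exact: Bo.
rewrite nbhsE => -[_ [[C oC <-] Cw] CA].
have [D [BD Dw] DC] := Bb (set_val w) C (open_nbhs_nbhs (conj oC Cw)).
exists (set_val @^-1` D); first by split; [exists D|].
by move=> y Dy; apply: CA; exact: DC.
Qed.

Definition open_submanifold : manifold R m.
Proof.
refine (@Manifold R m W sub_hausdorff sub_countable [set sub_chart] _
  (fun=> sub_chart) _ _).
- move=> _ _ -> -> k; rewrite setIid /= sub_img.
  by apply: eq_classC oW _ (classC_id k W) => x Wx /=; rewrite (sub_invK Wx).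
- by [].
- by [].
Defined.

End OpenSubmanifold.

(** * Tensor fields on an open subset of R^m *)

Section OpenSubmanifoldTensors.
Context {R : realType} {m : nat} {W : set 'rV[R]_m} {w0 : 'rV[R]_m}.
Variables (oW : open W) (Ww0 : W w0).
Let F := open_submanifold oW Ww0.
Let c : chart R m F := sub_chart oW Ww0.

Lemma sub_chart_img : cmap c @` cdom c = W.
Proof.
apply/seteqP; split=> [_ [w _ <-]|x Wx]; first exact: set_valP.
by exists (sub_inv Ww0 x) => //; exact: sub_invK.
Qed.

Let cinvK x : W x -> cmap c (cinv c x) = x.
Proof. exact: sub_invK. Qed.

Let loc (V : normedModType R) (A B : 'rV[R]_m -> V) : smooth_on W B ->
  (forall w : F, A (cmap c w) = B (cmap c w)) -> smooth_on (cmap c @` cdom c) A.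
Proof.
move=> BC AB k; rewrite sub_chart_img; apply: eq_classC oW _ (BC k) => x Wx.
by rewrite -(cinvK Wx) AB.
Qed.

Let tid (w : F) : trans c (chart_at w) w = 1%:M.
Proof. by apply: (@trans_id R m F c w). Qed.

Let tid' (w : F) : trans (chart_at w) c w = 1%:M.
Proof. by apply: (@trans_id R m F c w). Qed.

Variables (om : 'rV[R]_m -> 'cV[R]_m) (Z : 'rV[R]_m -> 'rV[R]_m)
  (b : 'rV[R]_m -> 'M[R]_m).

Let sub_form : one_form F := fun w => om (set_val w).
Let sub_vf : vector_field F := fun w => Z (set_val w).
Let sub_mx (w : F) : 'M[R]_m := b (set_val w).

Lemma sub_form_smooth : smooth_on W om -> smooth_form sub_form.
Proof.
move=> omC _ ->; apply: loc omC _ => w.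
by rewrite (@form_locE R m F c _ w I) tid mul1mx.
Qed.

Lemma sub_vf_smooth : smooth_on W Z -> smooth_vf sub_vf.
Proof.
move=> ZC _ ->; apply: loc ZC _ => w.
by rewrite (@vf_locE R m F c _ w I) tid' mulmx1.
Qed.

Lemma sub_endo_smooth : smooth_on W b -> smooth_endo (sub_mx : endo_field F).
Proof.
move=> bC _ ->; apply: loc bC _ => w.
by rewrite (@endo_locE R m F c _ w I) tid mulmx1 mul1mx.
Qed.

Lemma sub_bilin_smooth : smooth_on W b -> smooth_bilin (sub_mx : bilin_field F).
Proof.
move=> bC _ ->; apply: loc bC _ => w.
by rewrite (@bilin_locE R m F c _ w I) tid trmx1 mulmx1 mul1mx.
Qed.

Lemma sub_ext_d (w : F) : ext_d sub_form w = ext_d_coord om (set_val w).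
Proof.
have Ww : W (set_val w) by exact: set_valP.
have E x : W x -> form_loc c sub_form x = om x.
  move=> Wx; rewrite -(cinvK Wx) (@form_locE R m F c _ _ I) tid mul1mx /sub_form.
  by rewrite -[set_val _]/(cmap c (cinv c x)) (cinvK Wx).
have D v (i : 'I_m) : 'D_v (fun x => form_loc c sub_form x i 0 : R) (set_val w) =
    'D_v (fun x => om x i 0 : R) (set_val w).
  by apply: (derive_near_eq v oW Ww) => x /E ->.
by apply/matrixP => i j; rewrite !mxE !D.
Qed.

End OpenSubmanifoldTensors.

Section BlockForms.
Context {R : realType} {m : nat}.

Lemma bil_block (A : 'M[R]_m) (B : 'M[R]_1) (u v : 'rV[R]_m) :
  bil (block_mx A 0 0 B) (row_mx u 0) (row_mx v 0) = bil A u v.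
Proof.
rewrite /bil mul_row_block !mulmx0 !mul0mx !addr0 tr_row_mx mul_row_col mul0mx.
by rewrite addr0.
Qed.

Lemma ball_row_mx0 (u : 'rV[R]_m) e :
  ball (0 : 'rV[R]_m) e u -> ball (0 : 'rV[R]_(m + 1)) e (row_mx u 0).
Proof.
rewrite -!ball_normE /= !sub0r !normrN; apply: le_lt_trans.
apply: mx_norm_leP => // i j; rewrite -(splitK j).
by case: (fintype.split j) => l /=; rewrite ?row_mxEl ?row_mxEr ?mxE ?normr0 //;
  exact: mx_norm_entry.
Qed.

Lemma ball_lsubmx (z : 'rV[R]_(m + 1)) e :
  ball (0 : 'rV[R]_(m + 1)) e z -> ball (0 : 'rV[R]_m) e (lsubmx z).
Proof.
rewrite -!ball_normE /= !sub0r !normrN; apply: le_lt_trans.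
by apply: mx_norm_leP => // i j; rewrite mxE; exact: mx_norm_entry.
Qed.

(** A function on a ball of R^m x R whose derivative in the last variable
    vanishes does not depend on that variable: balls of the sup norm are convex
    boxes. *)
Lemma constant_along_last p q (f : 'rV[R]_(m + 1) -> 'M[R]_(p, q)) e z :
  classC 1 (ball 0 e) f ->
  (forall y, ball 0 e y -> 'D_(row_mx 0 1%:M) f y = 0) ->
  ball 0 e z -> f z = f (row_mx (lsubmx z) 0).
Proof.
move=> fC fD ze; set v : 'rV[R]_(m + 1) := row_mx (0 : 'rV[R]_m) 1%:M; set s := last_coord z.
have lin r : row_mx (lsubmx z) 0 + r *: v = row_mx (lsubmx z) r%:M.
  by rewrite /v scale_row_mx add_row_mx scaler0 addr0 add0r scalemx1.
have zE : z = row_mx (lsubmx z) 0 + s *: v.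
  by rewrite lin -[LHS]hsubmxK; congr row_mx; rewrite [LHS]mx11_scalar.
have := @mean_value_line R _ _ _ f (row_mx (lsubmx z) 0) v s 0 0.
rewrite -zE scaler0 subr0 mul0r => H.
apply/eqP; rewrite -subr_eq0 -normr_le0; apply: H => r rs.
have re : ball 0 e (row_mx (lsubmx z) 0 + r *: v).
  move: ze; rewrite lin -!ball_normE /= !sub0r !normrN; apply: le_lt_trans.
  apply: mx_norm_leP => // i j; rewrite -(splitK j).
  case: (fintype.split j) => l /=; rewrite ?row_mxEl ?row_mxEr mxE.
    exact: mx_norm_entry.
  rewrite !ord1 eqxx mulr1n; apply: le_trans rs _.
  by rewrite /s /last_coord mxE; exact: mx_norm_entry.
by split; [exact: classC_derivable fC re|rewrite (fD _ re) subr0 normr0].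
Qed.

End BlockForms.

(** * The splitting *)

Lemma ext_d_antisym (R : realType) (n : nat) (M : manifold R n) (a : one_form M) p :
  (ext_d a p)^T = - ext_d a p.
Proof. by apply/matrixP => i j; rewrite !mxE -mulrN opprB. Qed.

Lemma bilBr {R : realType} {n : nat} (b : 'M[R]_n) u v w :
  bil b u (v - w) = bil b u v - bil b u w.
Proof. by rewrite /bil linearB mulmxBr !mxE. Qed.

(** A positive definite form is nondegenerate, so an endomorphism is recovered
    from its composition with it. *)
Lemma endo_unique {R : realType} {n : nat} (b d P Q : 'M[R]_n) :
  (forall v, v != 0 -> 0 < bil b v v) ->
  (forall u v, bil b u (v *m P) = bil d u v) ->
  (forall u v, bil b u (v *m Q) = bil d u v) -> P = Q.
Proof.
move=> b0 bP bQ; apply: mulmx_inj => v; apply/eqP; rewrite -subr_eq0.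
apply: contraT => /b0; rewrite bilBr bP bQ subrr.
by rewrite ltxx.
Qed.

Section Splitting.
Context {R : realType} {m h : nat} {M : manifold R (m + 1)}
  {a1 a2 : one_form M} {phi : endo_field M} {g : bilin_field M}
  {Z1 Z2 : vector_field M}.
Hypotheses (mcp : metric_contact_pair h 0 a1 a2 phi g Z1 Z2)
  (Z2_killing : killing g Z2).

Let cps := mcp_structure mcp.
Let cp := cps_pair cps.
Let rb := cps_reeb cps.

Lemma closed_second_form p : ext_d a2 p = 0.
Proof.
apply: wedge_pow1_eq0; first exact: ext_d_antisym.
by move=> v; exact: cp_class2 cp p v.
Qed.

Variables (c : chart R (m + 1) M) (e : R).
Hypotheses (e0 : 0 < e) (cC : compat_chart c)
  (c_img : cmap c @` cdom c = ball 0 e)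
  (c_adapted : forall z, ball 0 e z -> form_loc c a2 z = col_mx 0 1%:M /\
     vf_loc c Z2 z = row_mx 0 1%:M).

Let B : set 'rV[R]_(m + 1) := ball 0 e.
Let W : set 'rV[R]_m := ball 0 e.
Let oB : open B. Proof. exact: ball_open. Qed.
Let oW : open W. Proof. exact: ball_open. Qed.
Let W0 : W 0. Proof. exact: ballxx. Qed.
Let dt : 'rV[R]_(m + 1) := row_mx 0 1%:M.

Let al := form_loc c a1.
Let G := bilin_loc c g.
Let Ph := endo_loc c phi.
Let Ze := vf_loc c Z1.
Let D := ext_d_coord al.

Let alC : smooth_on B al.
Proof. by rewrite /B -c_img; exact: (form_loc_smooth cC (cp_smooth1 cp)). Qed.
Let GC : smooth_on B G.
Proof.
have [gC _ _] := mcp_riemannian mcp.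
by rewrite /B -c_img; exact: (bilin_loc_smooth cC gC).
Qed.
Let PhC : smooth_on B Ph.
Proof. by rewrite /B -c_img; exact: (endo_loc_smooth cC (cps_smooth cps)). Qed.
Let ZeC : smooth_on B Ze.
Proof. by rewrite /B -c_img; exact: (vf_loc_smooth cC (reeb_smooth1 rb)). Qed.

(** The change of frame between the adapted chart and the preferred chart,
    through which the pointwise identities are transported. *)
Let frame z : B z -> exists q (T T' : 'M[R]_(m + 1)),
  [/\ T *m T' = 1%:M, T' *m T = 1%:M, cdom c q, cmap c q = z &
      [/\ T = trans c (chart_at q) q & T' = trans (chart_at q) c q]].
Proof.
rewrite /B -c_img => -[q cq <-].
have aq : atlas (chart_at q : chart R _ M) by exact: chart_at_atlas.
have [s1 s2] := cC aq.
exists q, (trans c (chart_at q) q), (trans (chart_at q) c q); split => //.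
  exact: (trans_inv s1 s2 cq (chart_at_dom q)).
exact: (trans_inv s2 s1 (chart_at_dom q) cq).
Qed.

Let ptw z : B z -> exists q (T : 'M[R]_(m + 1)),
  [/\ T \in unitmx, al z = T *m a1 q, D z = T *m ext_d a1 q *m T^T,
      G z = T *m g q *m T^T &
      [/\ Ph z *m T = T *m phi q, Ze z *m T = Z1 q, dt *m T = Z2 q &
          col_mx 0 1%:M = T *m a2 q]].
Proof.
move=> zB; have [q [T [T' [TT TT' cq zE [TE T'E]]]]] := frame zB.
exists q, T; split.
- by case: (mulmx1_unit TT).
- by rewrite /al -zE (form_locE _ cq) -TE.
- by rewrite /D /al -zE (ext_d_loc cC cq (cp_smooth1 cp)) -TE.
- by rewrite /G -zE (bilin_locE _ cq) -TE.
have [h1 h2] := c_adapted zB; split.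
- by rewrite /Ph -zE (endo_locE _ cq) -TE -T'E -mulmxA TT' mulmx1.
- by rewrite /Ze -zE (vf_locE _ cq) -T'E -mulmxA TT' mulmx1.
- by rewrite /dt -h2 -zE (vf_locE _ cq) -T'E -mulmxA TT' mulmx1.
- by rewrite -h1 -zE (form_locE _ cq) -TE.
Qed.

Let evM (T : 'M[R]_(m + 1)) a v : ev (T *m a) v = ev a (v *m T).
Proof. by rewrite /ev mulmxA. Qed.
Let bilM (T b : 'M[R]_(m + 1)) u v : bil (T *m b *m T^T) u v = bil b (u *m T) (v *m T).
Proof. by rewrite /bil trmx_mul !mulmxA. Qed.

Let al_dt z : B z -> dt *m al z = 0.
Proof.
move=> /ptw[q [T [_ aE _ _ [_ _ dE _]]]].
rewrite aE mulmxA dE [LHS]mx11_scalar.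
by have := reeb12 rb q; rewrite /ev => ->; rewrite raddf0.
Qed.

Let D_dt z v : B z -> bil (D z) dt v = 0.
Proof.
move=> /ptw[q [T [_ _ DE _ [_ _ dE _]]]].
by rewrite DE bilM dE (reeb_d12 rb).
Qed.

Let G_sym z u v : B z -> bil (G z) u v = bil (G z) v u.
Proof.
move=> /ptw[q [T [_ _ _ GE _]]]; rewrite GE !bilM.
by case: (mcp_riemannian mcp) => _ gs _; exact: gs.
Qed.

Let G_pos z (v : 'rV[R]_(m + 1)) : B z -> v != 0 -> 0 < bil (G z) v v.
Proof.
move=> /ptw[q [T [Tu _ _ GE _]]] v0; rewrite GE bilM.
case: (mcp_riemannian mcp) => _ _ gp; apply: gp.
by apply: contraNneq v0 => vT; rewrite -[v](mulmxK Tu) vT mul0mx.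
Qed.

Let G_dt z v : B z -> bil (G z) v dt = ev (col_mx 0 1%:M) v.
Proof.
move=> /ptw[q [T [_ _ _ GE [_ _ dE bE]]]].
by rewrite GE bilM dE (mcp_Z2 mcp) bE evM.
Qed.

Let G_Ze z v : B z -> bil (G z) v (Ze z) = ev (al z) v.
Proof.
move=> /ptw[q [T [_ aE _ GE [_ ZE _ _]]]].
by rewrite GE bilM ZE (mcp_Z1 mcp) aE evM.
Qed.

Let al_Ze z : B z -> ev (al z) (Ze z) = 1.
Proof.
by move=> /ptw[q [T [_ aE _ _ [_ ZE _ _]]]]; rewrite aE evM ZE (reeb11 rb).
Qed.

Let Ze_last z : B z -> ev (col_mx 0 1%:M) (Ze z) = 0.
Proof.
by move=> /ptw[q [T [_ _ _ _ [_ ZE _ bE]]]]; rewrite bE evM ZE (reeb21 rb).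
Qed.

Let D_Ze z v : B z -> bil (D z) (Ze z) v = 0.
Proof.
by move=> /ptw[q [T [_ _ DE _ [_ ZE _ _]]]]; rewrite DE bilM ZE (reeb_d11 rb).
Qed.

Let G_Ph z u v : B z -> bil (G z) u (v *m Ph z) = bil (D z) u v.
Proof.
move=> /ptw[q [T [_ _ DE GE [PE _ _ _]]]].
rewrite GE DE !bilM -(mulmxA v) PE mulmxA (mcp_assoc mcp).
by rewrite closed_second_form addr0.
Qed.

Let Ph_sqr z v : B z -> v *m Ph z *m Ph z =
  - v + ev (al z) v *: Ze z + ev (col_mx 0 1%:M) v *: dt.
Proof.
move=> /ptw[q [T [Tu aE _ _ [PE ZE dE bE]]]].
apply: (can_inj (mulmxK Tu)).
rewrite !mulmxDl -!scalemxAl ZE dE mulNmx aE bE !evM.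
move: (Ph z) PE => P PE; rewrite -(cps_sqr cps) -!mulmxA PE (mulmxA P) PE.
by rewrite !mulmxA.
Qed.

Let Ph_dt z : B z -> dt *m Ph z = 0.
Proof.
move=> /ptw[q [T [Tu _ _ _ [PE _ dE _]]]].
apply: (can_inj (mulmxK Tu)).
move: (Ph z) PE => P PE; by rewrite -mulmxA PE mulmxA dE (cps_Z2 cps) mul0mx.
Qed.

Let Ph_Ze z : B z -> Ze z *m Ph z = 0.
Proof.
move=> /ptw[q [T [Tu _ _ _ [PE ZE _ _]]]].
apply: (can_inj (mulmxK Tu)).
move: (Ph z) PE => P PE; by rewrite -mulmxA PE mulmxA ZE (cps_Z1 cps) mul0mx.
Qed.

Let cut (z : 'rV[R]_(m + 1)) : 'rV[R]_(m + 1) := row_mx (lsubmx z : 'rV[R]_m) 0.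
Let cutB z : B z -> B (cut z).
Proof. by move=> /ball_lsubmx /ball_row_mx0. Qed.
Let liftB u : W u -> B (row_mx u 0).
Proof. exact: ball_row_mx0. Qed.

(** Cartan's formula: the Lie derivative of the first form along the last
    coordinate field vanishes. *)
Let al_cut z : B z -> al z = al (cut z).
Proof.
move=> zB; apply: (constant_along_last (alC 1%N)) => // y yB.
rewrite -/dt; have key (v : 'rV[R]_(m + 1)) : v *m 'D_dt al y = 0.
  have := bil_ext_d_coord dt v oB (alC 1%N) yB; rewrite -/D (D_dt _ yB).
  have -> : dt *m 'D_v al y = 0.
    have H := is_derive_mulmx (is_derive_cst dt y v) (classC_is_derive v (alC 1%N) yB).
    rewrite mul0mx add0r in H; rewrite -(@derive_val _ _ _ _ _ _ _ H).
    rewrite (derive_near_eq v oB yB (fun x xB => al_dt xB)).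
    exact: derive_cst.
  rewrite subr0 => /esym/eqP; rewrite mulf_eq0 invr_eq0 pnatr_eq0 /= => /eqP q0.
  by rewrite [LHS]mx11_scalar q0 raddf0.
by apply: mulmx_inj => v; rewrite key mulmx0.
Qed.

(** In the adapted chart the Lie derivative along the last coordinate field is
    a partial derivative, which the Killing equation annihilates. *)
Let G_cut z : B z -> G z = G (cut z).
Proof.
move=> zB; apply: (constant_along_last (GC 1%N)) => // y yB.
rewrite -/dt; move: (yB); rewrite /B -c_img => -[q cq qE].
have gC : smooth_bilin g by case: (mcp_riemannian mcp).
have := lie_bilin_loc cC cq (reeb_smooth2 rb) gC.
rewrite Z2_killing mulmx0 mul0mx qE /lie_coord.
have J0 : jacobian (vf_loc c Z2) y = 0.
  have VC : smooth_on B (vf_loc c Z2).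
    by rewrite /B -c_img; exact: (vf_loc_smooth cC (reeb_smooth2 rb)).
  apply: jacobian_rowE; first exact: classC_differentiable oB (VC 1%N) yB.
  move=> v; rewrite mulmx0 (derive_near_eq v oB yB (fun x xB => (c_adapted xB).2)).
  exact: derive_cst.
by rewrite J0 trmx0 mul0mx mulmx0 !addr0 (c_adapted yB).2.
Qed.

Let om (u : 'rV[R]_m) : 'cV[R]_m := usubmx (al (row_mx u 0)).
Let zF (u : 'rV[R]_m) : 'rV[R]_m := lsubmx (Ze (row_mx u 0)).
Let gF (u : 'rV[R]_m) : 'M[R]_m := ulsubmx (G (row_mx u 0)).
Let pF (u : 'rV[R]_m) : 'M[R]_m := ulsubmx (Ph (row_mx u 0)).

Let al_block z : B z -> al z = col_mx (om (lsubmx z)) 0.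
Proof.
move=> zB; rewrite (al_cut zB) /om -[LHS]vsubmxK; congr col_mx.
have := al_dt (cutB zB); rewrite -[al _]vsubmxK /dt mul_row_col mul0mx add0r mul1mx.
by rewrite col_mxKd.
Qed.

Let Ze_block z : B z -> Ze z = row_mx (lsubmx (Ze z)) 0.
Proof.
move=> zB; rewrite -[LHS]hsubmxK; congr row_mx.
have := Ze_last zB; rewrite -{1}[Ze z]hsubmxK /ev mul_row_col mulmx0 add0r mulmx1 => H.
by rewrite [LHS]mx11_scalar H raddf0.
Qed.

Let G_block z : B z -> G z = block_mx (gF (lsubmx z)) 0 0 1%:M.
Proof.
move=> zB; rewrite (G_cut zB) /gF -/(cut z); set y := cut z.
have yB : B y by exact: cutB.
have Gr : G y *m dt^T = col_mx 0 1%:M.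
  apply: mulmx_inj => v; rewrite mulmxA [LHS]mx11_scalar [RHS]mx11_scalar.
  by congr (_%:M); exact: G_dt.
have GT : (G y)^T = G y.
  apply: bil_inj => u v; have := G_sym u v yB; move: (G y) => A ->; rewrite /bil.
  have -> : u *m A^T *m v^T = (v *m A *m u^T)^T by rewrite !trmx_mul trmxK mulmxA.
  exact: mxE.
rewrite -{1}[G y]submxK in Gr.
rewrite /dt tr_row_mx trmx0 trmx1 mul_block_col !mulmx0 !mulmx1 !add0r in Gr.
have /eq_col_mx [G12 G22] := Gr.
have G21 : dlsubmx (G y) = 0 by rewrite -GT -trmx_ursub G12 trmx0.
by rewrite -[LHS]submxK G12 G21 G22.
Qed.

Let slice_smooth p q (T : 'rV[R]_(m + 1) -> 'M[R]_(p, q)) : smooth_on B T ->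
  smooth_on W (fun u => T (row_mx u 0)).
Proof.
move=> TC k; apply: (classC_comp oW oB) (TC k); first exact: liftB.
by apply: (classC_row_mx oW); [exact: classC_id|exact: classC_cst].
Qed.

Let omC : smooth_on W om.
Proof.
move=> k; apply: (classC_entries (r := lshift 1) (c := id) oW _ (slice_smooth alC k)).
by move=> u i j; rewrite !mxE.
Qed.

Let ulsub_smooth (T : 'rV[R]_(m + 1) -> 'M[R]_(m + 1)) : smooth_on B T ->
  smooth_on W (fun u => ulsubmx (T (row_mx u 0))).
Proof.
move=> TC k.
apply: (classC_entries (r := lshift 1) (c := lshift 1) oW _ (slice_smooth TC k)).
by move=> u i j; rewrite !mxE.
Qed.

Let gFC : smooth_on W gF.
Proof. exact: ulsub_smooth GC. Qed.

Let pFC : smooth_on W pF.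
Proof. exact: ulsub_smooth PhC. Qed.

Let zFC : smooth_on W zF.
Proof. by move=> k; apply: (classC_lsubmx oW); exact: (slice_smooth ZeC k). Qed.

Let D_block z : B z -> D z = block_mx (ext_d_coord om (lsubmx z)) 0 0 0.
Proof.
move=> zB.
have pc : continuous (lsubmx : 'rV[R]_(m + 1) -> 'rV[R]_m) by exact: continuous_lsubmx.
have lC : smooth_on B (lsubmx : 'rV[R]_(m + 1) -> 'rV[R]_m).
  by move=> k; apply: (classC_lsubmx oB); exact: classC_id.
have lJ y : B y -> jacobian (lsubmx : 'rV[R]_(m + 1) -> 'rV[R]_m) y = col_mx 1%:M 0.
  move=> yB; apply: jacobian_rowE; first exact: classC_differentiable oB (lC 1%N) yB.
  move=> v; have H := is_derive_linear y v pc.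
  rewrite (@derive_val _ _ _ _ _ _ _ H) -[v in RHS]hsubmxK.
  by rewrite mul_row_col mulmx1 mulmx0 addr0.
rewrite /D (ext_d_coord_pullback oB oW (@ball_lsubmx R m ^~ e) lC omC _ zB); last first.
  by move=> y yB; rewrite (lJ y yB) mul_col_mx mul1mx mul0mx; exact: al_block.
rewrite (lJ z zB) tr_col_mx trmx1 trmx0 mul_col_mx mul1mx mul0mx.
by rewrite mul_col_row !mulmx1 !mulmx0 ?mul0mx.
Qed.

Let gF_pos u v : W u -> v != 0 -> 0 < bil (gF u) v v.
Proof.
move=> Wu v0; have uB := liftB Wu.
have := G_block uB; rewrite row_mxKl => GE.
rewrite -(bil_block _ 1%:M) -GE; apply: G_pos => //.
apply: contraNneq v0 => E; have := congr1 (fun x => lsubmx x) E.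
by rewrite /= row_mxKl linear0 => ->.
Qed.

(** The last row vanishes with phi Z2, and the last column because the metric
    turns it into d a1 contracted with Z2. *)
Let Ph_block' z : B z -> Ph z = block_mx (ulsubmx (Ph z)) 0 0 0.
Proof.
move=> zB; have := Ph_dt zB.
rewrite -{1}[Ph z]submxK /dt mul_row_block !mul0mx !mul1mx !add0r.
rewrite -[X in _ = X](@row_mx0 _ 1 m 1) => /eq_row_mx [P21 P22].
have col : Ph z *m col_mx 0 1%:M = 0.
  apply: mulmx_inj => v; rewrite mulmx0 mulmxA [LHS]mx11_scalar.
  have := G_dt (v *m Ph z) zB; rewrite /ev => <-.
  by rewrite (G_sym _ _ zB) (G_Ph _ _ zB) (D_dt _ zB) raddf0.
rewrite -[Ph z]submxK mul_block_col !mulmx0 !mulmx1 !add0r in col.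
rewrite -[X in _ = X](@col_mx0 _ m 1 1) in col.
have /eq_col_mx [P12 _] := col.
by rewrite -[LHS]submxK P12 P21 P22.
Qed.

Let gF_Ph z u v : B z ->
  bil (gF (lsubmx z)) u (v *m ulsubmx (Ph z)) = bil (ext_d_coord om (lsubmx z)) u v.
Proof.
move=> zB.
rewrite -(bil_block _ 1%:M) -(bil_block (ext_d_coord om _) 0).
rewrite -(G_block zB) -(D_block zB) -(G_Ph _ _ zB); congr bil.
by rewrite (Ph_block' zB) mul_row_block !mulmx0 ?mul0mx !addr0 block_mxKul.
Qed.

(** The endomorphism field is determined by the metric and the differential of
    the form, hence does not depend on the last coordinate either. *)
Let Ph_block z : B z -> Ph z = block_mx (pF (lsubmx z)) 0 0 0.
Proof.
move=> zB; suff E : ulsubmx (Ph z) = pF (lsubmx z).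
  exact: (etrans (Ph_block' zB) (congr1 (fun A => block_mx A 0 0 0) E)).
have Wz : W (lsubmx z) by exact: ball_lsubmx zB.
have H : forall u v, bil (gF (lsubmx z)) u (v *m pF (lsubmx z)) =
    bil (ext_d_coord om (lsubmx z)) u v.
  have cz : lsubmx (cut z) = lsubmx z by exact: row_mxKl.
  by move=> u v; rewrite -{1 3}cz; exact: (gF_Ph u v (cutB zB)).
exact: (endo_unique (fun v => @gF_pos _ v Wz) (fun u v => gF_Ph u v zB) H).
Qed.

Let F := open_submanifold oW W0.
Let omF : one_form F := fun w => om (set_val w).
Let pFF : endo_field F := fun w => pF (set_val w).
Let gFF : bilin_field F := fun w => gF (set_val w).
Let zFF : vector_field F := fun w => zF (set_val w).

Let ev_lift u v : W u -> ev (om u) v = ev (al (row_mx u 0)) (row_mx v 0).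
Proof.
move=> Wu; rewrite (al_block (liftB Wu)) row_mxKl /ev mul_row_col mul0mx.
by rewrite addr0.
Qed.

Let Ze_lift u : W u -> Ze (row_mx u 0) = row_mx (zF u) 0.
Proof. by move=> Wu; exact: Ze_block (liftB Wu). Qed.

Let D_lift u x y : W u -> bil (ext_d_coord om u) x y =
  bil (D (row_mx u 0)) (row_mx x 0) (row_mx y 0).
Proof. by move=> Wu; rewrite (D_block (liftB Wu)) row_mxKl bil_block. Qed.

Let G_lift u x y : W u -> bil (gF u) x y =
  bil (G (row_mx u 0)) (row_mx x 0) (row_mx y 0).
Proof. by move=> Wu; rewrite (G_block (liftB Wu)) row_mxKl bil_block. Qed.

Let Ph_lift u (v : 'rV[R]_m) : W u -> row_mx (v *m pF u) 0 = row_mx v 0 *m Ph (row_mx u 0).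
Proof.
move=> Wu; rewrite (Ph_block (liftB Wu)) row_mxKl mul_row_block.
by rewrite !mulmx0 ?mul0mx !addr0.
Qed.

(** At a point of the slice, a1 and d a1 are the pullbacks of the form on F and
    of its differential under the projection with matrix A.  If the contact
    volume vanished on F, so would its pullback, which is a factor of the volume
    on M. *)
Let contact_nonzero u : W u -> exists v,
  wedge (kform1 (om u)) (wedge_pow (kform2 (ext_d_coord om u)) h) v != 0.
Proof.
move=> Wu; have uB := liftB Wu; have [q [T [Tu aE DE _ _]]] := ptw uB.
have [w wN] := cp_volume cp q.
pose A : 'M[R]_(m + 1, m) := invmx T *m col_mx 1%:M 0.
have a1E : a1 q = A *m om u.
  rewrite /A -mulmxA mul_col_mx mul1mx mul0mx.
  by have := al_block uB; rewrite row_mxKl => <-; rewrite aE mulKmx.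
have d1E : ext_d a1 q = A *m ext_d_coord om u *m A^T.
  have := D_block uB; rewrite row_mxKl DE => E.
  have -> : ext_d a1 q = invmx T *m (T *m ext_d a1 q *m T^T) *m (invmx T)^T.
    rewrite trmx_inv !mulmxA mulVmx // mul1mx -mulmxA mulmxV ?mulmx1 //.
    by rewrite unitmx_tr.
  rewrite E /A trmx_mul tr_col_mx trmx1 trmx0 !mulmxA; congr (_ *m _).
  rewrite -!mulmxA; congr (_ *m _).
  by rewrite mul_mx_row mulmx1 mulmx0 mul_col_row !mulmx0 !mul1mx !mul0mx.
apply: contrapT => nv; move: wN; rewrite wedge_eq0 ?eqxx // => x.
rewrite (@wedge_pull R _ _ A _ _ (kform1 (om u))
  (wedge_pow (kform2 (ext_d_coord om u)) h)).
- by apply: contrapT => /eqP ne; apply: nv; exists (x *m A).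
- by move=> y; rewrite a1E; exact: kform1_pull.
- by apply: wedge_pow_pull => y; rewrite d1E; exact: kform2_pull.
Qed.

Hypothesis mE : m = h.*2.+1.

Lemma slice_contact_metric : contact_metric h omF pFF gFF zFF.
Proof.
have Wv (w : F) : W (set_val w) by exact: set_valP.
split.
- exact: sub_form_smooth omC.
- exact: sub_vf_smooth zFC.
- exact: sub_endo_smooth pFC.
- split.
  + exact: sub_bilin_smooth gFC.
  + move=> w u v; have Ww := Wv w; rewrite /gFF (G_lift _ _ Ww) (G_lift _ _ Ww).
    exact: G_sym (liftB Ww).
  + by move=> w v v0; exact: gF_pos.
- exact: mE.
- by move=> w; rewrite sub_ext_d; exact: contact_nonzero.
- move=> w; have Ww := Wv w; rewrite /omF /zFF (ev_lift _ Ww) -(Ze_lift Ww).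
  exact: al_Ze (liftB Ww).
- move=> w v; have Ww := Wv w; rewrite sub_ext_d (D_lift _ _ Ww) -(Ze_lift Ww).
  exact: D_Ze (liftB Ww).
- move=> w v; have Ww := Wv w; have H := Ph_sqr (row_mx v 0) (liftB Ww).
  rewrite -(Ph_lift _ Ww) -(Ph_lift _ Ww) -(ev_lift _ Ww) (Ze_lift Ww) in H.
  have := congr1 (fun x => lsubmx x) H.
  rewrite !linearD !linearZ linearN /= !row_mxKl scaler0 addr0.
  exact.
- move=> w; have Ww := Wv w; have := Ph_Ze (liftB Ww).
  rewrite (Ze_lift Ww) -(Ph_lift _ Ww) => H.
  by have := congr1 (fun x => lsubmx x) H; rewrite row_mxKl linear0.
- move=> w v; have Ww := Wv w; rewrite /gFF /omF /zFF (G_lift _ _ Ww) -(Ze_lift Ww).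
  by rewrite (G_Ze _ (liftB Ww)) (ev_lift _ Ww).
- move=> w u v; have Ww := Wv w.
  rewrite sub_ext_d /gFF /pFF (G_lift _ _ Ww) (Ph_lift _ Ww).
  by rewrite (G_Ph _ _ (liftB Ww)) (D_lift _ _ Ww).
Qed.

Let PC : chart R (m + 1) (F * R)%type := prod_chart (sub_chart oW W0 : chart R m F).
Let f : M -> prodR F := cinv PC \o cmap c.
Let f' : prodR F -> M := cinv c \o cmap PC.
Let U : set M := cdom c.
Let V : set (prodR F) := cmap PC @^-1` B.

Let PCdom x : cdom PC x. Proof. by []. Qed.

Let PCK z : B z -> cmap PC (cinv PC z) = z.
Proof.
move=> zB; rewrite /PC /= /pc_map /pc_inv /= sub_invK; last exact: ball_lsubmx zB.
by rewrite -mx11_scalar hsubmxK.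
Qed.

Let fK p : U p -> cmap PC (f p) = cmap c p.
Proof. by move=> Up; apply: PCK; rewrite /B -c_img; exists p. Qed.

Let f'K x : V x -> cmap c (f' x) = cmap PC x /\ U (f' x).
Proof.
by rewrite /V /= /B -c_img => -[p Up pE]; rewrite /f' /= -pE (cmapK Up).
Qed.

Let PCB z : B z -> (cmap PC @` cdom PC) z.
Proof. by move=> zB; exists (cinv PC z) => //; exact: PCK. Qed.

(** In the product chart of F x R the map f is the adapted chart, so its
    smoothness and that of its inverse are the compatibility of that chart with
    the atlas. *)
Lemma splitting_diffeo : diffeo_on U V f.
Proof.
split.
- exact: cdom_open.
- rewrite -[V]setTI; apply: open_preimageI openT _ oB => x _.
  exact: cmap_cont (PCdom x).
- apply/seteqP; split=> [_ [p Up <-]|x Vx].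
    by rewrite /V /preimage /mkset (fK Up) /B -c_img; exists p.
  have [E cf] := f'K Vx; exists (f' x) => //.
  by rewrite /f /= E; exact: cmapK (PCdom x).
- split.
    move=> p Up; apply: continuous_comp; first exact: cmap_cont Up.
    by apply: cinv_cont; apply: PCB; rewrite /B -c_img; exists p.
  move=> c1 c2 ac1 [_ -> <-] k.
  have [_ s] := cC ac1.
  apply: (@sub_classC _ _ _ _ (overlap c1 c)).
    by move=> _ [p [[Up c1p] _] <-]; exact: mem_overlap.
  apply: eq_classC (@open_overlap _ _ _ c1 c) _ (s k).
  by move=> _ [p [c1p Up] <-] /=; rewrite (cmapK c1p) -(fK Up).
exists f'; split; first by move=> p Up; have := congr1 (cinv c) (fK Up); rewrite (cmapK Up).
split.
  move=> x Vx; apply: continuous_comp; first exact: cmap_cont (PCdom x).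
  by apply: cinv_cont; rewrite c_img.
move=> c2 c1 [_ -> <-] ac1 k.
have [s _] := cC ac1.
apply: (@sub_classC _ _ _ _ (overlap c c1)).
  move=> _ [x [[Vx _] c1x] <-]; have [E cf] := f'K Vx.
  by rewrite -/PC -E; exact: mem_overlap.
apply: eq_classC (@open_overlap _ _ _ c c1) _ (s k).
move=> _ [p [Up c1p] <-] /=; rewrite (cmapK Up).
have pB : B (cmap c p) by rewrite /B -c_img; exists p.
by have := PCK pB; rewrite /f' /PC /= => ->; rewrite (cmapK Up).
Qed.

(** The preferred charts of F x R are the product chart, where f is the adapted
    chart. *)
Let f_tangent q : U q -> tangent_map f q = trans (chart_at q) c q.
Proof.
move=> cq; set c0 : chart R _ M := chart_at q.
have ac0 : atlas c0 by exact: chart_at_atlas.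
have c0q : cdom c0 q by exact: chart_at_dom.
have [_ s] := cC ac0.
have E y : overlap c0 c y -> (cmap c \o cinv c0) y =
    (cmap (chart_at (f q)) \o f \o cinv c0) y.
  by move=> [p [c0p Up] <-] /=; rewrite (cmapK c0p) -(fK Up).
have oO := @open_overlap _ _ _ c0 c.
have qO : overlap c0 c (cmap c0 q) by exact: mem_overlap.
have sf : classC 1 (overlap c0 c) (cmap (chart_at (f q)) \o f \o cinv c0).
  exact: eq_classC oO E (s 1%N).
apply: jacobian_rowE; first exact: classC_differentiable oO sf qO.
move=> v; rewrite -(derive_near_eq v oO qO E).
exact: classC_deriveE oO (s 1%N) qO.
Qed.

Lemma splitting_preserves : preserves_on U f a1 a2 phi g
  (prod_form omF) (dt_form F) (prod_endo pFF) (prod_metric gFF).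
Proof.
have data q : U q -> let z := cmap c q in let T := trans c (chart_at q) q in
    let T' := tangent_map f q in
    [/\ B z, set_val (f q).1 = lsubmx z, T' *m T = 1%:M &
      [/\ T *m a1 q = al z, T *m a2 q = col_mx 0 1%:M,
         T *m phi q *m T' = Ph z & T *m g q *m T^T = G z]].
  move=> cq z T T'.
  have zB : B z by rewrite /B -c_img; exists q.
  have aq : atlas (chart_at q : chart R _ M) by exact: chart_at_atlas.
  have [s1 s2] := cC aq; rewrite /T' (f_tangent cq).
  split; [exact: zB| | |split].
  - by rewrite /f /= sub_invK //; exact: ball_lsubmx zB.
  - exact: (trans_inv s2 s1 (chart_at_dom q) cq).
  - by rewrite /al (form_locE _ cq).
  - by rewrite -(c_adapted zB).1 (form_locE _ cq).
  - by rewrite /Ph (endo_locE _ cq).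
  - by rewrite /G (bilin_locE _ cq).
split=> q Uq; have [zB fq TT [aE bE PE GE]] := data q Uq; move: (tangent_map f q) TT PE => T' TT PE.
- move=> v; rewrite /prod_form /omF fq -(al_block zB) -aE /ev.
  by rewrite !mulmxA -(mulmxA v) TT mulmx1.
- by move=> v; rewrite /dt_form -bE /ev !mulmxA -(mulmxA v) TT mulmx1.
- move=> v; rewrite /prod_endo /pFF fq -(Ph_block zB) -PE.
  by rewrite !mulmxA -(mulmxA v) TT mulmx1.
- move=> v w; rewrite /prod_metric /gFF fq -(G_block zB) -GE bilM.
  by rewrite -!mulmxA TT !mulmx1.
Qed.

End Splitting.

Theorem theorem22 (R : realType) (h n : nat) (M : manifold R n)
    (a1 a2 : one_form M) (phi : endo_field M) (g : bilin_field M)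
    (Z1 Z2 : vector_field M) :
  metric_contact_pair h 0 a1 a2 phi g Z1 Z2 ->
  killing g Z2 ->
  locally_product h a1 a2 phi g.
Proof.
move=> mcp kil.
have nE : n = (h.*2.+1 + 1)%N.
  by rewrite (cp_dim (cps_pair (mcp_structure mcp))) double0 addn0 addn1.
subst n => p0.
have rb := cps_reeb (mcp_structure mcp).
have [c [e [e0 cC cp0 cI cA]]] := adapted_chart p0
  (cp_smooth2 (cps_pair (mcp_structure mcp))) (reeb_smooth2 rb)
  (closed_second_form mcp) (reeb22 rb).
exists h.*2.+1; do 5 eexists; split.
  exact: (slice_contact_metric mcp kil e0 cC cI cA erefl).
exists (cdom c); do 2 eexists; split; [exact: cp0| |].
  exact: (splitting_diffeo e0 cC cI).
exact: (splitting_preserves mcp kil e0 cC cI cA).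
Qed.
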